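(* The exploration process $\rho=(\rho_t,t\ge 0)$, viewed as a Markov process on $\mathcal{M}_f(E)$ equipped with the topology of weak convergence, is Feller. That is, if $P_tF(\mu)=\mathbb{E}_\mu[F(\rho_t)]$ denotes its transition semigroup, then for every $F\in\mathcal{C}_0(\mathcal{M}_f(E))$: (i) $P_tF\in \mathcal{C}_0(\mathcal{M}_f(E))$ for every $t\ge 0$; (ii) $\lim_{t\to 0}P_tF(\mu)=F(\mu)$ for every $\mu\in\mathcal{M}_f(E)$.
   Context: **The Lévy process.** $X=(X_t,t\ge 0)$ is a real-valued (càdlàg) Lévy process with no negative jumps and no Brownian part, $X_0=0$, with $\mathbb{E}[e^{-\lambda X_t}]=e^{t\psi(\lambda)}$ for $\lambda\ge 0$, where $$\psi(\lambda)=\alpha_0\lambda+\int_{(0,+\infty)}\pi(d\ell)\,[e^{-\lambda\ell}-1+\lambda\ell],$$ $\alpha_0\ge 0$, and $\pi$ is a positive $\sigma$-finite measure on $(0,\infty)$ with $\int_{(0,\infty)}(\ell\wedge\ell^2)\pi(d\ell)<\infty$ and $\int_{(0,1)}\ell\,\pi(d\ell)=\infty$. Set $I_t=\inf_{0\le s\le t}X_s$ and, for $0\le s\le t$, $I_t^s=\inf_{s\le r\le t}X_r$. **Measures.** $E=\mathbb{R}_+\cup\{+\infty\}$ with a distance making it compact (the usual topology of $[0,+\infty]$). $\mathcal{M}_f(E)$ is the set of finite measures on $E$ with the topology of weak convergence, and $\mathcal{M}_f=\mathcal{M}_f(\mathbb{R}_+)$. Write $\langle\mu,f\rangle=\int f\,d\mu$.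 For $\mu\in\mathcal{M}_f(E)$, $H^\mu=\sup\mathrm{Supp}(\mu)\in[0,\infty]$ (closed support, $\sup\emptyset=0$). $\mathcal{C}_0(\mathcal{M}_f(E))$ is the set of real continuous functions $F$ on $\mathcal{M}_f(E)$ such that $F(\mu_n)\to 0$ whenever $\langle\mu_n,1\rangle\to\infty$. *Erasing:* for $a\in[0,\langle\mu,1\rangle]$, $k_a\mu$ is the measure with $k_a\mu([0,r])=\mu([0,r])\wedge(\langle\mu,1\rangle-a)$, $r\in E$; if $a>\langle\mu,1\rangle$, $k_a\mu=0$. *Concatenation:* $\langle[\mu,\nu],f\rangle=\langle\mu,f\rangle+\langle\nu,f(H^\mu+\cdot)\rangle$ for non-negative measurable $f$ on $E$, with $x+\infty=+\infty$. **The exploration process.** There is a sequence $\varepsilon_k\downarrow 0$ of positive reals such that $\tilde H_t=\lim_{k\to\infty}\varepsilon_k^{-1}\int_0^t\mathbf{1}_{\{X_s<I_t^s+\varepsilon_k\}}ds$ exists and is finite a.s. for all $t\ge 0$. By Duquesne and Le Gall there is an $\mathcal{M}_f$-valued process $\rho^0=(\rho^0_t,t\ge 0)$, a.s. càdlàg (for the variation distance), such that, with $H^0_s=H^{\rho^0_s}$: for each $t\ge0$, a.s. $H^0_t=\tilde H_t$; for all non-negative measurable $f$ on $\mathbb{R}_+$, $\langle\rho^0_t,f\rangle=\int_{[0,t]}d_sI_t^s\,f(H^0_s)$, equivalently $\rho^0_t(dr)=\sum_{0<s\le t,\,X_{s-}<I_t^s}(I_t^s-X_{s-})\,\delta_{H^0_s}(dr)$;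 and a.s. for every $t>0$, $\langle\rho^0_t,1\rangle=X_t-I_t$. The exploration process started at $\mu\in\mathcal{M}_f(E)$ is $\rho_0=\mu$, $\rho_t=[k_{-I_t}\mu,\rho^0_t]$ for $t>0$; its law is $\mathbb{P}_\mu$. It is known (Duquesne and Le Gall) that $\rho$ is a homogeneous Markov process. *)

(* Defs.v *)
From HB Require Import structures.
From mathcomp Require Import all_boot all_order all_algebra.
From mathcomp Require Import all_classical all_reals all_analysis.
From mathcomp Require Import measurable_realfun.

Set Implicit Arguments.
Unset Strict Implicit.
Unset Printing Implicit Defensive.

Import Order.TTheory GRing.Theory Num.Theory.
Import numFieldNormedType.Exports.

Local Open Scope classical_set_scope.
Local Open Scope ring_scope.

Definition Eset (R : realType) : set (\bar R) := [set x | (0 <= x)%E].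

(* A finite Borel measure on E = [0, +oo] is encoded as a finite Borel measure
   on \bar R that does not charge the complement of E. Library measures are
   total functions on sets; only their values on measurable sets matter below,
   and two elements that agree on those are topologically indistinguishable. *)
Record Mf (R : realType) := MkMf {
  Mf_measure :> {finite_measure set (\bar R) -> \bar R} ;
  Mf_carried : Mf_measure (~` @Eset R) = 0%E }.

Section finite_measures.
Context {R : realType}.
Implicit Types mu nu : Mf R.

(* E is compact, so these are the bounded continuous functions on E. *)
Definition test_fun := {f : \bar R -> R | {within @Eset R, continuous f}}.

Definition Mf_ev mu : {ptws test_fun -> R} :=
  fun f => \int[mu]_(x in @Eset R) sval f x.

HB.instance Definition _ := gen_eqMixin (Mf R).
HB.instance Definition _ := gen_choiceMixin (Mf R).
(* The topology of weak convergence: see Mf_cvgP. *)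
HB.instance Definition _ :=
  Topological.copy (Mf R) (initial_topology Mf_ev).

Lemma Mf_cvgP (F : set_system (Mf R)) mu : Filter F ->
  F --> mu <->
  forall f : \bar R -> R, {within @Eset R, continuous f} ->
    \int[nu]_(x in @Eset R) f x @[nu --> F] --> \int[mu]_(x in @Eset R) f x.
Proof.
move=> FF; split=> [Fmu f cf|H].
  have cev : continuous (Mf_ev : initial_topology Mf_ev -> _).
    exact: initial_continuous.
  pose cf' : test_fun := exist _ f cf.
  have /cvg_sup/(_ cf') h : Mf_ev nu @[nu --> F] --> Mf_ev mu.
    by apply: cvg_trans (cev mu); exact: cvg_app.
  have := @initial_continuous (forall x : test_fun, R) R
    (fun g => g cf') (Mf_ev mu).
  by apply: cvg_trans; exact: (cvg_app (fun g : test_fun -> R => g cf') h).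
have h : Mf_ev nu @[nu --> F] --> Mf_ev mu.
  apply/cvg_sup => -[f cf] A /= [B [[C oC <-] /= Cf] BA].
  apply: (filterS BA) => /=.
  apply: (H f cf); exact: open_nbhs_nbhs.
move=> A [B [[C oC <-] /= Cmu] BA]; apply: (filterS BA).
exact: (h C (open_nbhs_nbhs (conj oC Cmu))).
Qed.

Lemma measurable_Eset : measurable (@Eset R).
Proof.
rewrite (_ : @Eset R = `[0%E, +oo[%classic :> set (\bar R)); last first.
  by apply/seteqP; split => x; rewrite /Eset /= in_itv/= andbT.
exact: emeasurable_itv.
Qed.

Lemma measurable_0r (r : \bar R) : measurable [set x : \bar R | (0 <= x <= r)%E].
Proof.
rewrite (_ : [set _ | _] = `[0%E, r]%classic); last first.
  by apply/seteqP; split => x; rewrite /= in_itv/=.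
exact: emeasurable_itv.
Qed.

Definition mass mu : R := fine (mu setT).

Lemma massE mu : (mass mu)%:E = mu setT.
Proof. by rewrite /mass fineK// fin_num_measure. Qed.

Lemma mass_Eset mu : mu (@Eset R) = (mass mu)%:E.
Proof.
rewrite massE -(setUv (@Eset R)) measureU//; last by rewrite setICr.
- by rewrite -[LHS]adde0; congr (_ + _)%E; exact/esym/Mf_carried.
- exact: measurable_Eset.
- exact: measurableC measurable_Eset.
Qed.

Definition supp mu : set (\bar R) :=
  [set x | Eset x /\ forall U, open U -> U x -> (0 < mu U)%E].

(* H^mu = sup Supp(mu); adjoining 0 gives the convention sup set0 = 0. *)
Definition height mu : \bar R := ereal_sup (supp mu `|` [set 0%E]).

Lemma height_ge0 mu : (0 <= height mu)%E.
Proof. by apply: ereal_sup_ubound; right. Qed.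


Section build.
Variable f : set (\bar R) -> \bar R.
Hypotheses (f0 : f set0 = 0%E) (f_ge0 : forall A, (0 <= f A)%E).
Hypotheses (f_add : semi_sigma_additive f) (f_fin : fin_num_fun f).
Hypothesis fE : f (~` @Eset R) = 0%E.

Let f_isMeasure := isMeasure.Build _ _ _ f f0 f_ge0 f_add.
Let fM : {measure set (\bar R) -> \bar R} := HB.pack f f_isMeasure.
Let f_isFinite := Measure_isFinite.Build _ _ _ fM f_fin.
Let fF : {finite_measure set (\bar R) -> \bar R} := HB.pack f f_isMeasure f_isFinite.

Definition Mf_of : Mf R := @MkMf R fF fE.

Lemma Mf_ofE A : Mf_of A = f A. Proof. by []. Qed.
End build.

Definition Mf_zero : Mf R.
Proof.
apply: (@Mf_of (fun=> 0%E)) => //.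
exact: (@measure_semi_sigma_additive _ _ _ (@mzero _ (\bar R) R)).
Defined.

(* k_a mu, characterized by its values on the sets [0, r]. *)
Definition is_erasure (a : R) mu nu := forall r : \bar R, (0 <= r)%E ->
  nu [set x | (0 <= x <= r)%E] =
  mine (mu [set x | (0 <= x <= r)%E]) (mass mu - a)%:E.

Definition erase (a : R) mu : Mf R :=
  if a <= mass mu then xget Mf_zero (is_erasure a mu) else Mf_zero.

Section erasure_exists.
Variables (mu : Mf R) (c : R).
Hypotheses (c_ge0 : 0 <= c) (c_le : c <= mass mu).

Let G (x : \bar R) : \bar R := mu [set y | (0 <= y <= x)%E].
Let Q (u : R) : \bar R := ereal_inf [set x | (0 <= x)%E /\ (u%:E <= G x)%E].

Let G_nd x y : (x <= y)%E -> (G x <= G y)%E.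
Proof.
move=> xy; apply: le_measure; rewrite ?inE; [exact: measurable_0r..|].
by move=> z /= /andP[-> zx]; rewrite (le_trans zx).
Qed.

Let Gy : G +oo%E = (mass mu)%:E.
Proof.
rewrite -mass_Eset /G; congr (_ _); apply/seteqP; split=> x; rewrite /Eset /=.
  by move=> /andP[].
by rewrite leey andbT.
Qed.

Let G_fin x : G x \is a fin_num.
Proof. by rewrite fin_num_measure//; exact: measurable_0r. Qed.

Let QP u x : u <= c -> (0 <= x)%E -> (Q u <= x)%E = (u%:E <= G x)%E.
Proof.
move=> uc x0; apply/idP/idP => [Qx|ux]; last by apply: ereal_inf_lbound.
have [->|xoo] := eqVneq x +oo%E.
  by rewrite Gy lee_fin (le_trans uc).
have [y xy] : exists y : R, x = y%:E.
  by case: x x0 {Qx} xoo => // y _ _; exists y.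
rewrite {}xy {x xoo} in x0 Qx *.
pose F n := [set z : \bar R | (0 <= z <= (y + n.+1%:R^-1)%:E)%E].
have FE : \bigcap_n F n = [set z | (0 <= z <= y%:E)%E].
  apply/seteqP; split=> [z h|z /= /andP[z0 zy] n _]; last first.
    rewrite /F /= z0 (le_trans zy)// lee_fin lerDl invr_ge0.
    exact: ler0n.
  have /= /andP[z0 _] := h 0%N Logic.I; rewrite /= z0 /=.
  apply/lee_addgt0Pr => e e0.
  have [n ne] : exists n, n.+1%:R^-1 < e :> R.
    case: (near_infty_natSinv_lt (PosNum e0)) => n _ /(_ n (leqnn n)) ?.
    by exists n.
  have /= /andP[_ zn] := h n Logic.I; apply: (le_trans zn).
  by rewrite -EFinD lee_fin lerD2l ltW.
have mF n : measurable (F n) by exact: measurable_0r.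
have : mu \o F @ \oo --> mu (\bigcap_n F n).
  apply: nonincreasing_cvg_mu => //.
  - rewrite -ge0_fin_numE; last exact: measure_ge0.
    by apply: fin_num_measure; exact: mF.
  - by rewrite FE; exact: measurable_0r.
  - move=> m n mn; apply/subsetPset => z /= /andP[z0 zn].
    rewrite /F /= z0 (le_trans zn)// lee_fin lerD2l lef_pV2 ?posrE//.
    by rewrite ler_nat ltnS.
rewrite FE => cv; rewrite -[leRHS](cvg_lim _ cv)//.
apply: lime_ge; first exact: cvgP cv.
apply: nearW => n /=.
have [z /= [z0 uz] zy] : exists2 z, (0 <= z)%E /\ (u%:E <= G z)%E &
    (z < (y + n.+1%:R^-1)%:E)%E.
  apply: ereal_inf_lt; apply: (le_lt_trans Qx).
  by rewrite lte_fin ltrDl invr_gt0.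
by apply: (le_trans uz); apply: G_nd; exact: ltW.
Qed.

Let mQ : measurable_fun `]0, c] Q.
Proof.
apply: (measurability _ (ErealGenOInfty.measurableE R)) => _ /= -[_ [r ->] <-].
have [r0|r0] := ltP r 0.
  rewrite (_ : _ `&` _ = `]0, c]%classic)//.
  apply/seteqP; split=> [x []//|x xc]; split => //=.
  rewrite in_itv/= andbT; apply: (@lt_le_trans _ _ 0%E); first by rewrite lte_fin.
  by apply: le_ereal_inf_tmp => z [].
rewrite (_ : _ `&` _ = `]0, c]%classic `&` `]fine (G r%:E), +oo[%classic)//.
  exact: measurableI.
have QE x : x \in `]0, c] -> (r%:E < Q x)%E = (fine (G r%:E) < x).
  rewrite in_itv/= => /andP[_ xc].
  by rewrite ltNge QP// -ltNge -[X in (X < _)%E]fineK// lte_fin.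
apply/seteqP; split=> x [/= xc]; rewrite !in_itv/= !andbT => h; split => //.
  by rewrite -QE.
by rewrite QE.
Qed.

Let erased (A : set (\bar R)) : \bar R :=
  @lebesgue_measure R (`]0, c]%classic `&` Q @^-1` A).

Lemma erasure_ex : exists nu : Mf R, forall r : \bar R, (0 <= r)%E ->
  nu [set x | (0 <= x <= r)%E] = mine (mu [set x | (0 <= x <= r)%E]) c%:E.
Proof.
have e0 : erased set0 = 0%E by rewrite /erased preimage_set0 setI0 measure0.
have e_ge0 A : (0 <= erased A)%E by exact: measure_ge0.
have e_add : semi_sigma_additive erased.
  move=> F mF tF mUF; rewrite /erased preimage_bigcup setI_bigcupr.
  apply: measure_semi_sigma_additive.
  - by move=> n; exact: mQ.
  - apply/trivIsetP => i j _ _ ij; rewrite setIACA setIid -preimage_setI.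
    by move/trivIsetP : tF => -> //; rewrite preimage_set0 setI0.
  - by rewrite -setI_bigcupr -preimage_bigcup; exact: mQ.
have c_itv : @lebesgue_measure R `]0, c] = c%:E.
  rewrite lebesgue_measure_itv/= lte_fin.
  case: ltP => c0; first by rewrite oppr0 adde0.
  by congr EFin; apply/le_anti; rewrite c_ge0 c0.
have e_fin : fin_num_fun erased.
  move=> A mA; rewrite ge0_fin_numE//; apply: (@le_lt_trans _ _ c%:E).
    rewrite -c_itv; apply: le_measure; rewrite ?inE//; exact: mQ.
  exact: ltry.
have Q_ge0 x : (0 <= Q x)%E by apply: le_ereal_inf_tmp => z [].
have eE : erased (~` @Eset R) = 0%E.
  rewrite /erased (_ : _ `&` _ = set0) ?measure0//.
  by apply/seteqP; split => // x [_]; rewrite /Eset /= Q_ge0.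
exists (Mf_of e0 e_ge0 e_add e_fin eE) => r r0.
rewrite Mf_ofE /erased -/(G r).
have -> : `]0, c]%classic `&` Q @^-1` [set x | (0 <= x <= r)%E] =
    `]0, (Num.min (fine (G r)) c)]%classic.
  apply/seteqP; split=> x /=; rewrite !in_itv/= Q_ge0/=.
    move=> [/andP[-> xc]]; rewrite QP// => xG.
    by rewrite le_min xc andbT -lee_fin fineK.
  rewrite le_min => /andP[-> /andP[xG xc]]; rewrite xc QP//; split => //.
  by rewrite -(fineK (G_fin r)) lee_fin.
have G0 : 0 <= fine (G r) by apply/fine_ge0/measure_ge0.
have -> : mine (G r) c%:E = (Num.min (fine (G r)) c)%:E.
  by rewrite EFin_min fineK.
rewrite lebesgue_measure_itv/= lte_fin oppr0 adde0; case: ltP => // h; congr EFin; apply/le_anti.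
by rewrite h le_min G0 c_ge0.
Qed.

End erasure_exists.

Lemma erase_erasure (a : R) mu : a <= mass mu -> is_erasure a mu (erase a mu).
Proof.
move=> am; rewrite /erase am; case: xgetP => // h.
have [nu nuE] : exists nu : Mf R, is_erasure a mu nu; last by have := h nu.
have [a0|a0] := leP 0 a.
  by apply: erasure_ex; rewrite ?subr_ge0// lerBlDr lerDl.
exists mu => r r0; apply/esym/min_idPl.
apply: (@le_trans _ _ (mu setT)).
  by apply: le_measure; rewrite ?inE//; exact: measurable_0r.
by rewrite -massE lee_fin lerDl oppr_ge0 ltW.
Qed.

Lemma erasure_unique (a : R) mu nu nu' :
  is_erasure a mu nu -> is_erasure a mu nu' ->
  forall A : set (\bar R), measurable A -> nu A = nu' A.
Proof.
move=> H H' A mA.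
pose GG := [set A : set (\bar R) | exists r, A = [set x | (x <= r)%E]].
have GGE r : [set x : \bar R | (x <= r)%E] = ~` `]r, +oo[%classic.
  by rewrite setCitvr; apply/seteqP; split=> x; rewrite /= in_itv.
have Nr (nu1 : Mf R) (r : \bar R) :
    nu1 [set x | (x <= r)%E] = nu1 [set x | (0 <= x <= r)%E].
  have mr : measurable [set x : \bar R | (x <= r)%E].
    by rewrite GGE; apply: measurableC; exact: emeasurable_itv.
  rewrite (_ : [set x | (0 <= x <= r)%E] = [set x | (x <= r)%E] `&` @Eset R).
    rewrite -{1}(setIT [set x | (x <= r)%E]) -(setUv (@Eset R)) setIUr.
    rewrite measureU; last first.
    - by rewrite setIACA setICr setI0.
    - by apply: measurableI => //; exact/measurableC/measurable_Eset.
    - by apply: measurableI => //; exact: measurable_Eset.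
    rewrite -[RHS]adde0; congr (_ + _)%E; apply/eqP; rewrite eq_le.
    rewrite measure_ge0 andbT -(Mf_carried nu1).
    apply: le_measure; rewrite ?inE.
    - by apply: measurableI => //; exact/measurableC/measurable_Eset.
    - exact/measurableC/measurable_Eset.
    - exact: subIsetr.
  by apply/seteqP; split=> x; rewrite /Eset /=; [move=> /andP[]|move=> [-> ->]].
have HH' r : nu [set x | (x <= r)%E] = nu' [set x | (x <= r)%E].
  rewrite !Nr; have [r0|r0] := leP 0%E r; first by rewrite H// H'.
  rewrite (_ : [set _ | _] = set0) ?measure0//.
  apply/seteqP; split=> x //= /andP[x0 xr].
  by have := le_lt_trans (le_trans x0 xr) r0; rewrite ltxx.
apply: (@measure_unique _ _ _ GG (fun=> setT)) => //.
- rewrite [LHS]ErealGenOInfty.measurableE; apply/seteqP; split.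
    apply: smallest_sub; first exact: smallest_sigma_algebra.
    move=> _ [r ->]; rewrite -[X in _ X]setCK -GGE.
    apply: sigma_algebraC.
    by apply: sub_sigma_algebra; exists r%:E.
  apply: smallest_sub; first exact: smallest_sigma_algebra.
  move=> _ [r ->]; rewrite -ErealGenOInfty.measurableE GGE.
  by apply: (@measurableC _ (\bar R)); exact: emeasurable_itv.
- move=> _ _ [r ->] [s ->]; exists (mine r s).
  apply/seteqP; split=> x /=; rewrite le_min; first by move=> [-> ->].
  by move=> /andP[].
- move=> _; exists +oo%E; apply/seteqP; split=> x //= _; exact: leey.
- by rewrite bigcup_const//; exists 0%N.
- by move=> _ [r ->]; exact: HH'.
- by move=> _; rewrite -ge0_fin_numE// fin_num_measure.
Qed.

Section concatenation.
Variables mu nu : Mf R.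

Let shift (x : \bar R) : \bar R := (height mu + x)%E.

(* mu plus the image of nu under x |-> H^mu + x *)
Let concat_fun (A : set (\bar R)) : \bar R :=
  (mu A + nu [set x | A (height mu + x)%E])%E.

Let measurable_shift : measurable_fun setT shift.
Proof. by apply: emeasurable_funD => //; exact: measurable_cst. Qed.

Let measurable_preshift A : measurable A -> measurable (shift @^-1` A).
Proof. by move=> mA; rewrite -[X in _ X]setTI; exact: measurable_shift. Qed.

Let concat0 : concat_fun set0 = 0%E.
Proof. by rewrite /concat_fun -[X in nu X]/set0 !measure0 adde0. Qed.

Let concat_ge0 A : (0 <= concat_fun A)%E.
Proof. by rewrite adde_ge0. Qed.

Let concat_add : semi_sigma_additive concat_fun.
Proof.
move=> F mF tF mUF; rewrite /concat_fun.
rewrite -[X in nu X]/(shift @^-1` _) preimage_bigcup.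
under eq_fun do rewrite big_split/=.
apply: cvgeD; first by rewrite ge0_adde_def// inE.
  exact: measure_semi_sigma_additive.
apply: measure_semi_sigma_additive => //.
- by move=> n; exact: measurable_preshift.
- apply/trivIsetP => i j _ _ ij; rewrite -preimage_setI.
  by move/trivIsetP : tF => -> //; rewrite preimage_set0.
- by rewrite -preimage_bigcup; exact: measurable_preshift.
Qed.

Let concat_fin : fin_num_fun concat_fun.
Proof.
move=> A mA; rewrite fin_numD !fin_num_measure//.
exact: measurable_preshift.
Qed.

Let concat_Eset : concat_fun (~` @Eset R) = 0%E.
Proof.
rewrite -[RHS]adde0; congr (_ + _)%E; first exact: Mf_carried.
apply/eqP; rewrite eq_le measure_ge0 andbT -(Mf_carried nu).
apply: le_measure; rewrite ?inE.
- exact/measurable_preshift/measurableC/measurable_Eset.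
- exact/measurableC/measurable_Eset.
- by move=> x /= h x0; apply: h; rewrite /Eset /= adde_ge0// height_ge0.
Qed.

Definition concat : Mf R :=
  Mf_of concat0 concat_ge0 concat_add concat_fin concat_Eset.

Lemma concat_integral (f : \bar R -> \bar R) :
  measurable_fun (@Eset R) f -> (forall x, 0 <= x -> 0 <= f x)%E ->
  (\int[concat]_(x in @Eset R) f x =
   \int[mu]_(x in @Eset R) f x +
   \int[nu]_(x in @Eset R) f (height mu + x))%E.
Proof.
move=> mf f0; have mE := measurable_Eset.
pose image_measure : {measure set (\bar R) -> \bar R} := pushforward nu shift.
pose shifted := image_measure measurable_shift.
transitivity (\int[measure_add mu shifted]_(x in @Eset R) f x)%E.
  by apply: eq_measure_integral => A mA _; exact/esym/measure_addE.
rewrite ge0_integral_measure_add//; congr (_ + _)%E.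
rewrite ge0_integral_pushforward//; last by move=> x; rewrite inE => /f0.
rewrite (ge0_negligible_integral (N := ~` @Eset R))//.
- congr (integral _ _ _); rewrite setDE setCK.
  apply/seteqP; split=> x /=; first by case.
  by rewrite /Eset /shift /= => x0; rewrite adde_ge0// height_ge0.
- exact: measurableC.
- exact: measurable_preshift.
- apply: (measurable_comp mE) => //; first by move=> _ [x ? <-].
  exact: measurable_funTS.
- by move=> x; exact: f0.
- exact: Mf_carried.
Qed.

End concatenation.

End finite_measures.

Section paths.
Context {R : realType}.
Implicit Types x : R -> R.

Definition left_lim x (t : R) : R := lim (x r @[r --> t^'-]).

Definition cadlag x :=
  (forall t, 0 <= t -> x r @[r --> t^'+] --> x t) /\
  (forall t, 0 < t -> cvg (x r @[r --> t^'-])).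

(* I_t^s; I_t is path_inf x 0 t. *)
Definition path_inf x (s t : R) : R := inf [set x r | r in `[s, t]].

Definition height_approx x (eps t : R) : R :=
  eps^-1 * \int[lebesgue_measure]_(s in `[0, t])
             \1_[set s : R | x s < path_inf x s t + eps] s.

Definition tv_dist (mu nu : Mf R) : R :=
  sup [set `|fine (mu A) - fine (nu A)| | A in measurable].

Definition cadlag_tv (m : R -> Mf R) :=
  (forall t, 0 <= t -> tv_dist (m r) (m t) @[r --> t^'+] --> 0) /\
  (forall t, 0 < t ->
    exists nu : Mf R, tv_dist (m r) nu @[r --> t^'-] --> 0).

End paths.

Section processes.
Context {R : realType} d {Omega : measurableType d} (P : probability Omega R).
Implicit Types X : R -> {RV P >-> R}.

(* Only the times t >= 0 are constrained. *)
Record levy_process X : Prop := {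
  levy_start : forall w, X 0 w = 0 ;
  levy_cadlag : forall w, cadlag (X ^~ w) ;
  levy_indep : forall (n : nat) (t : nat -> R) (B : nat -> set R),
    0 <= t 0%N -> (forall i, (i < n)%N -> t i <= t i.+1) ->
    (forall i, measurable (B i)) ->
    P (\bigcap_(i < n) [set w | B i (X (t i.+1) w - X (t i) w)]) =
    (\prod_(i < n) P [set w | B i (X (t i.+1) w - X (t i) w)%R])%E ;
  levy_stationary : forall (s h : R) (B : set R),
    0 <= s -> 0 <= h -> measurable B ->
    P [set w | B (X (s + h) w - X s w)] = P [set w | B (X h w)] }.

Definition no_negative_jumps X :=
  {ae P, forall w, forall t, 0 < t -> left_lim (X ^~ w) t <= X t w}.

(* The measure pi on (0, +oo), extended by 0 to R. *)
Record jump_measure (Pi : {sigma_finite_measure set R -> \bar R}) : Prop := {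
  jump_carried : Pi `]-oo, 0]%classic = 0%E ;
  jump_moment :
    (\int[Pi]_(l in `]0%R, +oo[) (Num.min l (l ^+ 2))%:E < +oo)%E ;
  jump_infinite_variation : (\int[Pi]_(l in `]0%R, 1%R[) l%:E = +oo)%E }.

Definition psi (alpha0 : R) (Pi : {sigma_finite_measure set R -> \bar R})
    (lambda : R) : R :=
  alpha0 * lambda +
  \int[Pi]_(l in `]0, +oo[) (expR (- (lambda * l)) - 1 + lambda * l).

Definition laplace_exponent X (f : R -> R) :=
  forall t lambda : R, 0 <= t -> 0 <= lambda ->
  ('E_P[fun w => expR (- (lambda * X t w))] = (expR (t * f lambda))%:E)%E.

Definition height_cvg (eps : nat -> R) X := forall t, 0 <= t ->
  {ae P, forall w, cvgn (fun k => height_approx (X ^~ w) (eps k) t)}.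

Definition height_process (eps : nat -> R) X (t : R) (w : Omega) : R :=
  limn (fun k => height_approx (X ^~ w) (eps k) t).

Record exploration0 (eps : nat -> R) X (rho0 : R -> Omega -> Mf R) : Prop := {
  expl_finite_heights : forall t w, 0 <= t -> rho0 t w [set +oo%E] = 0%E ;
  expl_measurable : forall t (A : set (\bar R)), 0 <= t -> measurable A ->
    measurable_fun setT (fun w => rho0 t w A) ;
  expl_cadlag : {ae P, forall w, cadlag_tv (rho0 ^~ w)} ;
  expl_height : forall t, 0 <= t ->
    {ae P, forall w, height (rho0 t w) = (height_process eps X t w)%:E} ;
  (* dI is the Stieltjes measure d_s I_t^s, which has no mass at 0. *)
  expl_integral : forall t, 0 <= t -> {ae P, forall w,
    forall dI : {measure set R -> \bar R},
    (forall a b, 0 <= a -> a <= b -> b <= t ->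
      dI `]a, b]%classic = (path_inf (X ^~ w) b t - path_inf (X ^~ w) a t)%:E) ->
    forall f : \bar R -> \bar R, measurable_fun (@Eset R) f ->
    (forall x, 0 <= x -> 0 <= f x)%E ->
    (\int[rho0 t w]_(x in @Eset R) f x =
     \int[dI]_(s in `]0%R, t]) f (height (rho0 s w)))%E} ;
  expl_atoms : forall t, 0 <= t -> {ae P, forall w,
    forall A : set (\bar R), measurable A ->
    rho0 t w A =
    (\esum_(s in [set s | (0 < s <= t)%R /\
                  (left_lim (X ^~ w) s < path_inf (X ^~ w) s t)%R])
       (path_inf (X ^~ w) s t - left_lim (X ^~ w) s)%:E *
       \d_(height (rho0 s w)) A)%E} ;
  expl_mass : {ae P, forall w, forall t, 0 < t ->
    mass (rho0 t w) = X t w - path_inf (X ^~ w) 0 t} }.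

Definition exploration X (rho0 : R -> Omega -> Mf R) (mu : Mf R) (t : R) (w : Omega) : Mf R :=
  if t == 0 then mu
  else concat (erase (- path_inf (X ^~ w) 0 t) mu) (rho0 t w).

Definition transition X (rho0 : R -> Omega -> Mf R) (t : R) (F : Mf R -> R) (mu : Mf R) : R :=
  fine ('E_P[fun w => F (exploration X rho0 mu t w)])%E.

End processes.

Definition C0_Mf {R : realType} (F : Mf R -> R) :=
  continuous F /\
  forall mu : nat -> Mf R, mass (mu n) @[n --> \oo] --> +oo ->
    F (mu n) @[n --> \oo] --> 0.

Definition feller {R : realType} (T : R -> (Mf R -> R) -> Mf R -> R) :=
  forall F, C0_Mf F ->
  (forall t, 0 <= t -> C0_Mf (T t F)) /\
  (forall mu, T t F mu @[t --> 0^'+] --> F mu).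

(* Main.v *)
Require Import Defs.
From HB Require Import structures.
From mathcomp Require Import all_boot all_order all_algebra.
From mathcomp Require Import all_classical all_reals all_analysis.
From mathcomp Require Import measurable_realfun.
From mathcomp Require Import ring lra.

Set Implicit Arguments.
Unset Strict Implicit.
Unset Printing Implicit Defensive.

Import Order.TTheory GRing.Theory Num.Theory.
Import numFieldNormedType.Exports.

Local Open Scope classical_set_scope.
Local Open Scope ring_scope.

(* The quantile function of mu parametrizes it by ]0, mass mu]: erasing the mass a
   truncates this interval at c = mass mu - a, and the height of the erased measure
   is the quantile at c. So [k_a mu, rho] depends continuously on (mu, a) wherever
   the quantile function of mu is continuous at c, i.e. for all but countably many a.
   By dominated convergence, P_t F is continuous as soon as I_t has no atom for
   t > 0. It vanishes at infinity since rho_t has mass at least <mu, 1> + I_t, and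
   P_t F --> F as t --> 0 because both I_t and the mass X_t - I_t of rho0_t tend to 0.

   That I_t has no atom follows from the diffuseness of X_s for s > 0: splitting at a
   small s, either the infimum is already reached before s, which is unlikely if its
   value is nonzero, or X_s plus an independent variable equals it. The value 0 is
   excluded by optional stopping of exponential martingales.

   If X_s had atoms, then for small t the heaviest atom of X_t would have mass close
   to 1, hence by uniqueness be located at b t for some b, and X would follow the line
   b t on dyadic grids with probability bounded below. But psi lambda + b lambda is
   positive for large lambda, the variation being infinite, and then X_t - b t takes
   negative values immediately. *)

(** For a fixed a the map mu |-> [k_a mu, rho] is not continuous: if the quantile function of mu
    jumps at the level mass mu - a, an arbitrarily small change of mu can move the height of k_a mu
    across the gap, and all of rho is shifted with it. Continuity of P_t F therefore has to come
    from the law of I_t. Dominated convergence works along sequences, whereas the weak topology is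
    defined by all continuous functions on E. The countable family [test_seq] yields the same
    neighbourhoods; it reduces continuity to sequences and also makes F of a random measure
    measurable. The dominating constant is a bound of F, obtained from compactness of the sets of
    measures of bounded mass. The law of X is accessible only through its independent stationary
    increments and its Laplace transform on lambda >= 0, whence an elementary treatment of atoms.
    The line b t appears because an atom heavy enough to be unique has a location additive in t. *)

(** * Topology of E and continuous functions on it *)

Section contract_topology.
Context {R : realType}.
Local Notation contract := (@contract R).
Local Notation expand := (@expand R).

(** The distance of [\bar R] is the pullback by [contract] of the distance of [-1, 1]. *)
Lemma cvg_contractP {T : Type} (F : set_system T) (FF : Filter F)
    (u : T -> \bar R) (l : \bar R) :
  u x @[x --> F] --> l <-> contract (u x) @[x --> F] --> contract l.
Proof.
split => [/cvg_ballP h|/cvgrPdist_lt h].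
  apply/cvgrPdist_lt => e e0; have := h e e0.
  by apply: filterS => x; rewrite /ball /= /ereal_ball.
by apply/cvg_ballP => e e0; exact: h.
Qed.

Lemma continuous_contract : continuous contract.
Proof. by move=> x; apply/(cvg_contractP _ _); exact: cvg_id. Qed.

Lemma measurable_contract : measurable_fun setT contract.
Proof.
apply: (measurability _ (RGenOInfty.measurableE R)) => _ /= -[_ [c ->] <-].
rewrite setTI; have [c1|c1] := ltP c (-1).
  rewrite (_ : _ @^-1` _ = setT)//; apply/seteqP; split => // x _ /=.
  rewrite in_itv/= andbT (lt_le_trans c1)//.
  by have := contract_le1 x; rewrite ler_norml => /andP[].
have [c2|c2] := ltP 1 c.
  rewrite (_ : _ @^-1` _ = set0)//; apply/seteqP; split => // x /=.
  rewrite in_itv/= andbT => cx; have := lt_trans c2 cx.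
  by have := contract_le1 x; rewrite ler_norml => /andP[_ /le_lt_trans h] /h; rewrite ltxx.
rewrite (_ : _ @^-1` _ = `]expand c, +oo[%classic); first exact: emeasurable_itv.
apply/seteqP; split => x /=; rewrite !in_itv/= !andbT.
  by rewrite -lt_expandLR// inE ler_norml c1.
by rewrite lt_expandLR// inE ler_norml c1.
Qed.

Lemma contract_ge0 (x : \bar R) : (0 <= contract x) = (0 <= x)%E.
Proof. by rewrite -(le_contract 0%E) contract0. Qed.

Lemma expand_ge0 (c : R) : 0 <= c -> (0 <= expand c)%E.
Proof.
move=> c0; have [c1|c1] := leP c 1.
  by rewrite -contract_ge0 expandK// inE ger0_norm.
by rewrite expand1 ?leey// ltW.
Qed.

End contract_topology.

Section continuous_on_Eset.
Context {R : realType}.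
Local Notation E := (@Eset R).
Variable f : \bar R -> R.
Hypothesis cf : {within E, continuous f}.

Lemma Eset_cvg {T : Type} (F : set_system T) (FF : Filter F)
    (u : T -> \bar R) (l : \bar R) :
  (forall x, (0 <= u x)%E) -> (0 <= l)%E -> u x @[x --> F] --> l ->
  f (u x) @[x --> F] --> f l.
Proof.
move=> u0 l0 ul; have /subspace_continuousP /(_ l l0) := cf.
move=> cfl; apply: cvg_trans cfl => A /= /ul; rewrite /nbhs /= => h.
by apply: filterS h => x /=; apply; exact: u0.
Qed.

Let continuous_expand : {within `[0, 1]%classic, continuous (f \o @expand R)}.
Proof.
apply/subspace_continuousP => x /=; rewrite in_itv/= => /andP[x0 x1].
have /subspace_continuousP cf' := cf.
have ex : E (@expand R x) by exact: expand_ge0.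
apply: cvg_trans (cf' _ ex) => A /=; rewrite /within /= => /nbhs_ballP[e e0 eA].
apply/nbhs_ballP; exists e => // y xy; rewrite /= in_itv/= => /andP[y0 y1].
apply: eA; last exact: expand_ge0.
by move: xy; rewrite /ball /= /ereal_ball !expandK// inE ger0_norm.
Qed.

(** E is the image of the segment [0, 1] by [expand], so compactness of E is that of a segment. *)
Lemma Eset_bounded : exists2 M : R, 0 <= M &
  forall x, (0 <= x)%E -> `|f x| <= M.
Proof.
have /compact_bounded[M [_ MP]] :=
  continuous_compact continuous_expand (@segment_compact R 0 1).
exists `|M + 1| => // x x0; apply: (le_trans _ (ler_norm _)).
apply: (MP (M + 1)); first by rewrite ltrDl.
exists (contract x); last by rewrite /= contractK.
by rewrite /= in_itv/= contract_ge0 x0; have := contract_le1 x; rewrite ler_norml => /andP[].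
Qed.

Lemma Eset_measurable : measurable_fun E f.
Proof.
have mE := @measurable_Eset R.
apply: (eq_measurable_fun ((f \o @expand R) \o @contract R)).
  by move=> x _; rewrite /= contractK.
have mc : measurable_fun E (@contract R) := measurable_funTS measurable_contract.
have m01 : measurable (`[0%R, 1%R]%classic : set R) by exact: measurable_itv.
apply: (measurable_comp m01 _ _ mc).
  move=> _ [x x0 <-] /=; rewrite in_itv/= contract_ge0.
  by apply/andP; split=> //; have := contract_le1 x; rewrite ler_norml => /andP[].
exact: subspace_continuous_measurable_fun.
Qed.

End continuous_on_Eset.

Lemma nondecreasing_measurable_ereal {R : realType} (Q : R -> \bar R) :
  {homo Q : u v / u <= v >-> (u <= v)%E} -> measurable_fun setT Q.
Proof.
move=> ndQ.
apply: (measurability _ (ErealGenOInfty.measurableE R)) => _ /= -[_ [r ->] <-].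
rewrite setTI; apply: is_interval_measurable => u v /=.
rewrite !in_itv/= !andbT => ru _ w /andP[uw _]; rewrite in_itv/= andbT.
exact: (lt_le_trans ru (ndQ _ _ uw)).
Qed.

(** * Quantile functions of finite measures on E *)

Section itv_pushforward.
Context {R : realType}.
Local Notation E := (@Eset R).
Local Notation leb := (@lebesgue_measure R).
Variables (Q : R -> \bar R).
Hypotheses (mQ : measurable_fun setT Q) (Q0 : forall u, (0 <= Q u)%E).

Lemma leb_itv0 (c : R) : leb `]0, c] = (Num.max c 0)%:E.
Proof.
rewrite lebesgue_measure_itv/= lte_fin; case: ltP => c0; last by [].
by rewrite oppr0 adde0.
Qed.

Let mitv (c : R) : measurable (`]0, c]%classic : set R).
Proof. exact: measurable_itv. Qed.

(** All erasures of one measure are of this form with the same [Q]; only c varies. *)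
Definition itv_pushforward (c : R) : {measure set (\bar R) -> \bar R}.
Proof.
refine (pushforward (mrestr leb (mitv c)) Q).
exact: mQ.
Defined.

Lemma itv_pushforwardE c A :
  itv_pushforward c A = leb (Q @^-1` A `&` `]0, c]%classic).
Proof. by []. Qed.

Lemma itv_pushforward_Mf c :
  exists nu : Mf R, forall A, nu A = itv_pushforward c A.
Proof.
have e_fin : fin_num_fun (itv_pushforward c).
  move=> B mB; rewrite ge0_fin_numE//; apply: (@le_lt_trans _ _ (leb `]0, c]%classic)).
    rewrite itv_pushforwardE; apply: le_measure; rewrite ?inE//.
    by apply: measurableI => //; rewrite -[X in measurable X]setTI; exact: mQ.
  by rewrite leb_itv0 ltry.
have eE : itv_pushforward c (~` E) = 0%E.
  rewrite itv_pushforwardE (_ : _ `&` _ = set0) ?measure0//.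
  by apply/seteqP; split => // x []; rewrite /= /Eset /= Q0.
by exists (Mf_of (measure0 _) (measure_ge0 (itv_pushforward c))
  (@measure_semi_sigma_additive _ _ _ _) e_fin eE).
Qed.

Lemma ge0_integral_itv_pushforward c (f : \bar R -> \bar R) :
  measurable_fun E f -> (forall x, 0 <= x -> 0 <= f x)%E ->
  (\int[itv_pushforward c]_(x in E) f x =
   \int[leb]_(u in `]0%R, c]) f (Q u))%E.
Proof.
move=> mf f0; have mE := @measurable_Eset R.
have QT : Q @^-1` E = setT.
  by apply/seteqP; split => // x _; exact: Q0.
rewrite /itv_pushforward ge0_integral_pushforward//; last by move=> x; rewrite inE => /f0.
have mfQ : measurable_fun setT (f \o Q).
  apply: (measurable_comp mE) => //.
  by move=> _ [x _ <-]; exact: Q0.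
rewrite QT -(setUv `]0, c]%classic) ge0_integral_setU//.
- rewrite [X in (_ + X)%E](_ : _ = 0%E) ?adde0; last first.
    rewrite (eq_measure_integral mzero) ?integral_measure_zero// => A mA AD.
    rewrite -[LHS]/(leb (A `&` `]0, c]%classic)).
    by rewrite (_ : A `&` _ = set0) ?measure0//; exact/disjoints_subset.
  by apply: eq_measure_integral => A mA AD; rewrite /= /mrestr setIidl.
- exact: measurableC.
- by rewrite setUv.
- by move=> x _ /=; rewrite f0// Q0.
- by apply/disj_setPS; rewrite setICr.
Qed.

End itv_pushforward.

Section quantile.
Context {R : realType}.
Implicit Type mu : Mf R.
Local Notation E := (@Eset R).
Local Notation leb := (@lebesgue_measure R).

Definition cdfE mu (x : \bar R) : R := fine (mu [set y | (0 <= y <= x)%E]).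

Lemma cdfEE mu x : (cdfE mu x)%:E = mu [set y | (0 <= y <= x)%E].
Proof. by rewrite /cdfE fineK// fin_num_measure//; exact: measurable_0r. Qed.

Lemma cdfE_nd mu (x y : \bar R) : (x <= y)%E -> cdfE mu x <= cdfE mu y.
Proof.
move=> xy; rewrite -lee_fin !cdfEE; apply: le_measure; rewrite ?inE; [exact: measurable_0r..|].
by move=> z /= /andP[-> zx]; rewrite (le_trans zx).
Qed.

Lemma cdfEy mu : cdfE mu +oo%E = mass mu.
Proof.
apply: EFin_inj; rewrite cdfEE -mass_Eset; congr (_ _).
by apply/seteqP; split=> x; rewrite /Eset /= leey andbT.
Qed.

Lemma cdfE_le_mass mu x : cdfE mu x <= mass mu.
Proof. by rewrite -cdfEy; apply: cdfE_nd; exact: leey. Qed.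

Lemma cdfE_ge0 mu x : 0 <= cdfE mu x.
Proof. exact/fine_ge0/measure_ge0. Qed.

Lemma mass_ge0 mu : 0 <= mass mu.
Proof. exact/fine_ge0/measure_ge0. Qed.

(* [quantile mu] carries Lebesgue measure on ]0, mass mu] to mu; it is +oo beyond
   [mass mu] (infimum of the empty set). *)
Definition quantile mu (u : R) : \bar R :=
  ereal_inf [set x | (0 <= x)%E /\ u <= cdfE mu x].

Lemma quantile_ge0 mu u : (0 <= quantile mu u)%E.
Proof. by apply: le_ereal_inf_tmp => z []. Qed.

Lemma quantile_nd mu u v : u <= v -> (quantile mu u <= quantile mu v)%E.
Proof.
by move=> uv; apply: le_ereal_inf => x [x0 vx]; split => //; exact: le_trans vx.
Qed.

(** The value 0 at levels u <= 0 is what lets [height_erase] cover erasures exceeding the total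
    mass. *)
Lemma quantile_le0 mu u : u <= 0 -> quantile mu u = 0%E.
Proof.
move=> u0; apply/eqP; rewrite eq_le quantile_ge0 andbT.
by apply: ereal_inf_lbound; split => //; rewrite (le_trans u0)// cdfE_ge0.
Qed.

(** Galois connection between the quantile and the distribution function. It rests on right
    continuity of the latter, that is on continuity from above along the sets [0, y + 1 / (n + 1)].
    At y = +oo it fails for u above the mass, whence the two versions. *)
Lemma quantile_le_fin mu u (y : R) : 0 <= y ->
  (quantile mu u <= y%:E)%E = (u <= cdfE mu y%:E).
Proof.
move=> y0; apply/idP/idP => [Qx|ux]; last first.
  by apply: ereal_inf_lbound; split; rewrite ?lee_fin.
pose F n := [set z : \bar R | (0 <= z <= (y + n.+1%:R^-1)%:E)%E].
have FE : \bigcap_n F n = [set z | (0 <= z <= y%:E)%E].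
  apply/seteqP; split=> [z h|z /= /andP[z0 zy] n _]; last first.
    by rewrite /F /= z0 (le_trans zy)// lee_fin lerDl invr_ge0.
  have /= /andP[z0 _] := h 0%N Logic.I; rewrite /= z0 /=.
  apply/lee_addgt0Pr => e e0.
  have [n ne] : exists n, n.+1%:R^-1 < e :> R.
    case: (near_infty_natSinv_lt (PosNum e0)) => n _ /(_ n (leqnn n)) ?.
    by exists n.
  have /= /andP[_ zn] := h n Logic.I; apply: (le_trans zn).
  by rewrite -EFinD lee_fin lerD2l ltW.
have mF n : measurable (F n) by exact: measurable_0r.
have : mu \o F @ \oo --> mu (\bigcap_n F n).
  apply: nonincreasing_cvg_mu => //.
  - rewrite -ge0_fin_numE; last exact: measure_ge0.
    by apply: fin_num_measure; exact: mF.
  - by rewrite FE; exact: measurable_0r.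
  - move=> m n mn; apply/subsetPset => z /= /andP[z0 zn].
    rewrite /F /= z0 (le_trans zn)// lee_fin lerD2l lef_pV2 ?posrE//.
    by rewrite ler_nat ltnS.
rewrite FE -cdfEE => cv; rewrite -lee_fin -[leRHS](cvg_lim _ cv)//.
apply: lime_ge; first exact: cvgP cv.
apply: nearW => n /=.
have [z /= [z0 uz] zy] : exists2 z, (0 <= z)%E /\ u <= cdfE mu z &
    (z < (y + n.+1%:R^-1)%:E)%E.
  apply: ereal_inf_lt; apply: (le_lt_trans Qx).
  by rewrite lte_fin ltrDl invr_gt0.
by rewrite -cdfEE lee_fin (le_trans uz)//; apply: cdfE_nd; exact: ltW.
Qed.

Lemma quantile_le mu u (x : \bar R) : u <= mass mu -> (0 <= x)%E ->
  (quantile mu u <= x)%E = (u <= cdfE mu x).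
Proof.
case: x => [y| |//] um x0; first by rewrite quantile_le_fin.
by rewrite leey cdfEy um.
Qed.

Lemma measurable_quantile mu : measurable_fun setT (quantile mu).
Proof. by apply: nondecreasing_measurable_ereal => u v; exact: quantile_nd. Qed.

Definition quantile_measure mu := itv_pushforward (@measurable_quantile mu).

Lemma quantile_measureE mu c A :
  quantile_measure mu c A = leb (quantile mu @^-1` A `&` `]0, c]%classic).
Proof. by []. Qed.

(** The u in ]0, c] with quantile at most r form the interval ]0, min (cdf r) c], whose length is
    the value prescribed for the erasure on [0, r]; these values determine the measure. *)
Lemma quantile_measure_erasure mu nu a : 0 <= a <= mass mu ->
  is_erasure a mu nu -> forall A, measurable A ->
  nu A = quantile_measure mu (mass mu - a) A.
Proof.
move=> /andP[a0 am] nuP A mA; set c := mass mu - a.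
have c0 : 0 <= c by rewrite subr_ge0.
have [nu' nu'E] := itv_pushforward_Mf (@measurable_quantile mu) (@quantile_ge0 mu) c.
rewrite -nu'E; apply: (erasure_unique nuP _ mA) => r r0.
rewrite nu'E quantile_measureE -cdfEE -/c -EFin_min.
have -> : quantile mu @^-1` [set x | (0 <= x <= r)%E] `&` `]0, c]%classic =
    `]0, (Num.min (cdfE mu r) c)]%classic.
  apply/seteqP; split=> x /=; rewrite !in_itv/= quantile_ge0/=.
    move=> [+ /andP[-> xc]]; rewrite quantile_le// => [xG|].
      by rewrite le_min xc xG.
    by rewrite (le_trans xc)// /c gerBl.
  rewrite le_min => /andP[-> /andP[xG xc]]; rewrite xc quantile_le//.
  by rewrite (le_trans xc)// /c gerBl.
rewrite leb_itv0; congr EFin; apply/max_idPl.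
by rewrite le_min cdfE_ge0 c0.
Qed.

(** A measure is its own erasure by a = 0. *)
Lemma Mf_quantileE mu A : measurable A -> mu A = quantile_measure mu (mass mu) A.
Proof.
move=> mA; rewrite -[mass mu]subr0; apply: (quantile_measure_erasure _ _ mA).
  by rewrite lexx mass_ge0.
move=> r r0; rewrite subr0 -cdfEE -EFin_min; congr EFin.
exact/esym/min_idPl/cdfE_le_mass.
Qed.

Lemma eraseE mu a A : 0 <= a -> measurable A ->
  erase a mu A = quantile_measure mu (mass mu - a) A.
Proof.
move=> a0 mA; have [am|am] := leP a (mass mu).
  by apply: quantile_measure_erasure mA; [rewrite a0|exact: erase_erasure].
rewrite /erase leNgt am/= quantile_measureE.
rewrite (_ : `]0, _]%classic = set0) ?setI0 ?measure0//.
by rewrite set_itv_ge// bnd_simp -leNgt subr_le0 ltW.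
Qed.

Lemma ge0_integral_erase mu a (f : \bar R -> \bar R) : 0 <= a ->
  measurable_fun E f -> (forall x, 0 <= x -> 0 <= f x)%E ->
  (\int[erase a mu]_(x in E) f x =
   \int[leb]_(u in `]0%R, (mass mu - a)%R]) f (quantile mu u))%E.
Proof.
move=> a0 mf f0.
rewrite -(ge0_integral_itv_pushforward (@measurable_quantile mu) (@quantile_ge0 mu))//.
by apply: eq_measure_integral => A mA _; exact: eraseE.
Qed.

Lemma ge0_integral_Mf mu (f : \bar R -> \bar R) :
  measurable_fun E f -> (forall x, 0 <= x -> 0 <= f x)%E ->
  (\int[mu]_(x in E) f x =
   \int[leb]_(u in `]0%R, mass mu]) f (quantile mu u))%E.
Proof.
move=> mf f0.
rewrite -(ge0_integral_itv_pushforward (@measurable_quantile mu) (@quantile_ge0 mu))//.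
by apply: eq_measure_integral => A mA _; exact: Mf_quantileE.
Qed.

End quantile.

(** * Continuity and convergence of quantiles *)

Section quantile_convergence.
Context {R : realType}.
Implicit Type mu : Mf R.
Local Notation E := (@Eset R).
Local Notation leb := (@lebesgue_measure R).

Lemma contract_rat_between (x y : \bar R) : (x < y)%E ->
  exists q : rat, contract x < ratr q < contract y.
Proof.
rewrite -lt_contract => /rat_in_itvoo[q]; rewrite in_itv/= => qP.
by exists q.
Qed.

Lemma open_measurable_ereal (U : set (\bar R)) : open U -> measurable U.
Proof.
move=> oU.
have mU : measurable ((@EFin R @` (@EFin R @^-1` U)) : set (\bar R)).
  apply: measurable_image_EFin; apply: open_measurable.
  by apply: open_comp => // x _; apply: cvg_EFin; [exact: nearW|exact: cvg_id].
have m1 (x : \bar R) : measurable [set y | y = x /\ U y].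
  have [Ux|Ux] := pselect (U x).
    rewrite (_ : [set _ | _] = [set x])//.
    by apply/seteqP; split=> [y []//|y ->].
  rewrite (_ : [set _ | _] = set0)//.
  by apply/seteqP; split=> // y [-> //].
rewrite (_ : U = (@EFin R @` (@EFin R @^-1` U)) `|`
  ([set y | y = +oo%E /\ U y] `|` [set y | y = -oo%E /\ U y])).
  by apply: measurableU => //; apply: measurableU.
apply/seteqP; split => [[r| |] Ux|x [[r Ur <-]//|[[]|[]]//]].
- by left; exists r.
- by right; left.
- by right; right.
Qed.

Lemma quantile_lbound mu u x : (0 <= x)%E -> u <= cdfE mu x ->
  (quantile mu u <= x)%E.
Proof. by move=> x0 ux; exact: ereal_inf_lbound. Qed.

(** Left continuity of the quantile, with the explicit threshold v = cdf x provided by the Galois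
    connection. *)
Lemma quantile_left_cont mu c x : 0 < c -> (x < quantile mu c)%E ->
  exists2 v, 0 <= v < c & forall u, v < u -> (x < quantile mu u)%E.
Proof.
move=> c0 xc; have [x0|x0] := ltP x 0%E.
  exists 0; first by rewrite lexx.
  by move=> u _; rewrite (lt_le_trans x0)// quantile_ge0.
exists (cdfE mu x).
  rewrite cdfE_ge0/= ltNge; apply/negP => /(quantile_lbound x0).
  by rewrite leNgt xc.
move=> u xu; rewrite ltNge; apply/negP => ux; move: xu; rewrite ltNge.
have xE : x \is a fin_num.
  by rewrite ge0_fin_numE// (lt_le_trans xc)// leey.
by rewrite -(fineK xE) -quantile_le_fin ?fineK ?ux// fine_ge0.
Qed.

(** By monotonicity no level up to c is sent beyond the quantile at c. By left continuity every
    neighbourhood of that quantile receives a whole interval ]v, c] of levels, hence positive mass,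
    so it belongs to the support. If c <= 0 the erased measure is null and both sides are 0. *)
Lemma height_erase mu a : 0 <= a ->
  height (erase a mu) = quantile mu (mass mu - a).
Proof.
move=> a0; set c := mass mu - a; have [c0|c0] := leP c 0.
  have e0 A : measurable A -> erase a mu A = 0%E.
    move=> mA; rewrite eraseE// quantile_measureE (_ : `]0, _]%classic = set0).
      by rewrite setI0 measure0.
    by rewrite set_itv_ge// bnd_simp -leNgt.
  rewrite quantile_le0// /height (_ : supp _ = set0) ?set0U ?ereal_sup1//.
  by apply/seteqP; split => // x [_ /(_ setT openT Logic.I)]; rewrite e0// ltxx.
apply/eqP; rewrite eq_le; apply/andP; split.
  apply: ge_ereal_sup => x [[x0 xS]|->]; last exact: quantile_ge0.
  rewrite leNgt; apply/negP => Qx.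
  have := xS _ (@open_ereal_gt_ereal R (quantile mu c)) Qx.
  rewrite (_ : [set _ | _] = `]quantile mu c, +oo[%classic); last first.
    by apply/seteqP; split => y; rewrite /= in_itv/= andbT.
  rewrite eraseE//; last exact: emeasurable_itv.
  rewrite quantile_measureE (_ : _ `&` _ = set0) ?measure0 ?ltxx//.
  apply/seteqP; split => // u [/=]; rewrite !in_itv/= andbT => Qu /andP[_ uc].
  by move: Qu; rewrite ltNge quantile_nd.
apply: ereal_sup_ubound; left; split; first exact: quantile_ge0.
move=> U oU Uc.
have [v /andP[v0 vc] vP] : exists2 v, 0 <= v < c &
    forall u, v < u -> u <= c -> U (quantile mu u).
  have /nbhs_ballP[e e0 eU] : nbhs (quantile mu c) U by exact: open_nbhs_nbhs.
  have close x : contract (quantile mu c) - e < contract x ->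
      (x <= quantile mu c)%E -> U x.
    move=> ex xc; apply: eU; rewrite /ball /= /ereal_ball.
    by rewrite ger0_norm ?subr_ge0 ?le_contract// ltrBlDl -ltrBlDr.
  have [ce0|ce0] := leP 0 (contract (quantile mu c) - e).
    have ce1 : contract (quantile mu c) - e \in [pred r | `|r| <= 1].
      rewrite inE ger0_norm// (le_trans (_ : _ <= contract (quantile mu c)))//.
        by rewrite gerBl ltW.
      by rewrite (le_trans (ler_norm _))// contract_le1.
    have [|v vP vQ] := @quantile_left_cont mu c
        (expand (contract (quantile mu c) - e)) c0.
      by rewrite lt_expandLR// ltrBlDr ltrDl.
    exists v => // u vu uc; apply: close; last exact: quantile_nd.
    by rewrite -lt_expandLR// vQ.
  exists 0; rewrite ?lexx// => u _ uc; apply: close; last exact: quantile_nd.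
  by rewrite (lt_le_trans ce0)// contract_ge0 quantile_ge0.
have mU := open_measurable_ereal oU.
rewrite eraseE// quantile_measureE.
have : (0 < leb `]v, c])%E.
  by rewrite lebesgue_measure_itv/= lte_fin vc -EFinB lte_fin subr_gt0.
move=> /lt_le_trans; apply; apply: le_measure; rewrite ?inE.
- exact: measurable_itv.
- apply: measurableI; last exact: measurable_itv.
  rewrite -[X in measurable X]setTI; exact: measurable_quantile.
- move=> u /=; rewrite !in_itv/= => /andP[vu uc]; split; first exact: vP.
  by rewrite uc (le_lt_trans v0).
Qed.

(** For nondecreasing [Q] this is right continuity at u: a single v > u controls all levels between
    u and v. *)
Definition right_continuity_pt (Q : R -> \bar R) u := forall x, (Q u < x)%E ->
  exists2 v, u < v & (Q v < x)%E.

(* A non-right-continuity point is labelled by a rational in the gap. *)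
Lemma countable_jumps (Q : R -> \bar R) :
  {homo Q : u v / u <= v >-> (u <= v)%E} ->
  countable [set u | ~ right_continuity_pt Q u].
Proof.
move=> ndQ; have /choice[g gP] (u : R) : exists q : rat, ~ right_continuity_pt Q u ->
    contract (Q u) < ratr q /\
    forall v, u < v -> ratr q < contract (Q v).
  have [h|h] := pselect (right_continuity_pt Q u); first by exists 0.
  have [x ux xP] : exists2 x, (Q u < x)%E &
      forall v, u < v -> (x <= Q v)%E.
    move/existsNP : h => [x /not_implyP[ux h]]; exists x => // v uv.
    by rewrite leNgt; apply/negP => vx; apply: h; exists v.
  have [q /andP[uq qx]] := contract_rat_between ux.
  by exists q => _; split => // v uv; rewrite (lt_le_trans qx)// le_contract xP.
have gI u v : ~ right_continuity_pt Q u -> ~ right_continuity_pt Q v ->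
    u < v -> g u != g v.
  move=> /gP[_ gu] /gP[gv _] uv; apply/eqP => guv.
  by have := lt_trans (gu _ uv) gv; rewrite guv ltxx.
apply/countable_injP; exists (pickle \o g) => u v; rewrite !inE => ju jv /=.
move=> /(pcan_inj pickleK) guv.
have [uv|vu|//] := ltgtP u v.
- by have := gI _ _ ju jv uv; rewrite guv eqxx.
- by have := gI _ _ jv ju vu; rewrite guv eqxx.
Qed.

(** Continuous version of the indicator of [0, x], affine in the coordinate [contract] between c and
    d. Its integrals are squeezed between two values of the distribution function. *)
Definition tent (c d : R) (x : \bar R) : R :=
  Num.max 0 (Num.min 1 ((d - contract x) / (d - c))).

Lemma continuous_tent c d : {within E, continuous (tent c d)}.
Proof.
apply: continuous_subspaceT => x; rewrite /tent.
apply: (@continuous_max _ _ (fun=> 0) (fun x => Num.min 1 ((d - contract x) / (d - c)))).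
  exact: cvg_cst.
apply: (@continuous_min _ _ (fun=> 1) (fun x => ((d - contract x) / (d - c)))).
  exact: cvg_cst.
apply: cvgMl; apply: cvgB; first exact: cvg_cst.
exact: continuous_contract.
Qed.

Lemma tent_ge0 c d x : 0 <= tent c d x.
Proof. by rewrite /tent le_max lexx. Qed.

Lemma tent_le1 c d x : tent c d x <= 1.
Proof. by rewrite /tent ge_max ler01 ge_min lexx. Qed.

Lemma tent1 c d x : c < d -> contract x <= c -> tent c d x = 1.
Proof.
move=> cd xc; rewrite /tent min_l ?max_r//.
by rewrite ler_pdivlMr ?subr_gt0// mul1r lerB.
Qed.

Lemma tent0 c d x : c < d -> d <= contract x -> tent c d x = 0.
Proof.
move=> cd dx; rewrite /tent max_l// ge_min; apply/orP; right.
by rewrite pmulr_lle0 ?invr_gt0 ?subr_gt0// subr_le0.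
Qed.

Lemma Mf_lty mu A : measurable A -> (mu A < +oo)%E.
Proof. by move=> mA; rewrite -ge0_fin_numE// fin_num_measure. Qed.

Lemma Mf_integrable mu (f : \bar R -> R) : {within E, continuous f} ->
  mu.-integrable E (EFin \o f).
Proof.
move=> cf; have mE := @measurable_Eset R.
apply: measurable_bounded_integrable => //; first exact: Mf_lty.
  exact: Eset_measurable.
have [M M0 fM] := Eset_bounded cf.
by exists M; split; first exact: num_real; move=> r Mr x /= x0; rewrite (le_trans (fM _ x0))// ltW.
Qed.

Lemma EFin_Mf_integral mu (f : \bar R -> R) : {within E, continuous f} ->
  (\int[mu]_(x in E) f x)%:E = (\int[mu]_(x in E) (f x)%:E)%E.
Proof.
move=> cf; rewrite /Rintegral fineK//.
exact: (integrable_fin_num (@measurable_Eset R) (Mf_integrable mu cf)).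
Qed.

Lemma Mf_integral_cst mu (r : R) : \int[mu]_(x in E) r = r * mass mu.
Proof.
rewrite Rintegral_cst; last exact: measurable_Eset.
transitivity (r * fine (mass mu)%:E) => //; congr (r * fine _); exact: mass_Eset.
Qed.

Lemma cdfE_le_tent (nu : Mf R) c d x : c < d -> contract x <= c ->
  cdfE nu x <= \int[nu]_(y in E) tent c d y.
Proof.
move=> cd xc; rewrite -lee_fin cdfEE EFin_Mf_integral; last exact: continuous_tent.
have mE := @measurable_Eset R; have mx := @measurable_0r R x.
rewrite [leLHS](_ : _ = nu ([set y | (0 <= y <= x)%E] `&` E)); last first.
  by congr (_ _); apply/seteqP; split => [y /= /andP[y0 yx]|y []//]; rewrite y0.
rewrite -integral_indic//; apply: ge0_le_integral => //.
- by apply/measurable_EFinP; exact: measurable_indic.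
- apply/measurable_EFinP; exact/Eset_measurable/continuous_tent.
- move=> y y0; rewrite lee_fin indicE; case: (boolP (_ \in _)); last by rewrite tent_ge0.
  rewrite inE/= => /andP[_ yx]; rewrite tent1//.
  by rewrite (le_trans _ xc)// le_contract.
Qed.

Lemma tent_le_cdfE (nu : Mf R) c d x : c < d -> d <= contract x ->
  \int[nu]_(y in E) tent c d y <= cdfE nu x.
Proof.
move=> cd dx; rewrite -lee_fin cdfEE EFin_Mf_integral; last exact: continuous_tent.
have mE := @measurable_Eset R; have mx := @measurable_0r R x.
rewrite [leRHS](_ : _ = nu ([set y | (0 <= y <= x)%E] `&` E)); last first.
  by congr (_ _); apply/seteqP; split => [y /= /andP[y0 yx]|y []//]; rewrite y0.
rewrite -integral_indic//; apply: ge0_le_integral => //.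
- by move=> y _; rewrite lee_fin tent_ge0.
- apply/measurable_EFinP; exact/Eset_measurable/continuous_tent.
- by apply/measurable_EFinP; exact: measurable_indic.
- move=> y y0; rewrite lee_fin indicE; case: (boolP (_ \in _)); first by rewrite tent_le1.
  rewrite notin_setE/= (y0 : is_true (0 <= y)%E)/= => /negP; rewrite -ltNge => xy.
  by rewrite tent0// (le_trans dx)// le_contract ltW.
Qed.

(** A tent inserted between two levels compares the distribution functions of [mu_ n] and mu, and
    the Galois connection turns this into a comparison of quantiles. The lower bound comes from
    levels below the limit quantile; right continuity enters in the upper bound, where it supplies v
    > u with quantile still close. Rational tents suffice, which keeps the test functions
    countable. *)
Lemma quantile_cvg {T : Type} (F : set_system T) (FF : Filter F)
    (mu_ : T -> Mf R) mu (u_ : T -> R) u :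
  (forall c d : rat,
    \int[mu_ n]_(y in E) tent (ratr c) (ratr d) y @[n --> F] -->
    \int[mu]_(y in E) tent (ratr c) (ratr d) y) ->
  u_ n @[n --> F] --> u -> right_continuity_pt (quantile mu) u ->
  quantile (mu_ n) (u_ n) @[n --> F] --> quantile mu u.
Proof.
move=> tcv ucv rc; apply/(cvg_contractP _ _)/cvgrPdist_lt => e e0.
set l := contract (quantile mu u).
have l0 : 0 <= l by rewrite contract_ge0 quantile_ge0.
have upper : \forall n \near F, contract (quantile (mu_ n) (u_ n)) < l + e.
  have [le1|le1] := ltP 1 (l + e).
    by apply: nearW => n; rewrite (le_lt_trans _ le1)// (le_trans (ler_norm _))// contract_le1.
  have lep : l + e \in [pred r | `|r| <= 1] by rewrite inE ger0_norm// addr_ge0// ltW.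
  have [|v uv vQ] := rc (expand (l + e)); first by rewrite lt_expandRL// ltrDl.
  move: vQ; rewrite lt_expandRL// => /rat_in_itvoo[c]; rewrite in_itv/= => /andP[vc].
  move=> /rat_in_itvoo[d]; rewrite in_itv/= => /andP[cd de].
  have Qv0 : 0 <= contract (quantile mu v) by rewrite contract_ge0 quantile_ge0.
  have d01 : ratr d \in [pred r : R | `|r| <= 1].
    rewrite inE ger0_norm ?(le_trans (ltW de))//.
    by rewrite (le_trans Qv0)// ltW// (lt_trans vc).
  have v_lt : v <= \int[mu]_(y in E) tent (ratr c) (ratr d) y.
    apply: (le_trans _ (@cdfE_le_tent mu _ _ (quantile mu v) cd (ltW vc))).
    have Qvf : quantile mu v \is a fin_num.
      rewrite ge0_fin_numE ?quantile_ge0// -lt_contract/=.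
      by rewrite (lt_trans vc)// (lt_trans cd)// (lt_le_trans de).
    by rewrite -[X in cdfE _ X](fineK Qvf) -quantile_le_fin ?fineK// fine_ge0// quantile_ge0.
  have h := cvgB (tcv c d) ucv.
  have gap : 0 < \int[mu]_(y in E) tent (ratr c) (ratr d) y - u.
    by rewrite subr_gt0 (lt_le_trans uv).
  apply: filterS (cvgr_gt _ (h FF) _ gap) => n; rewrite /= subr_gt0 => un.
  apply: (le_lt_trans _ de); rewrite -(@expandK R (ratr d))// le_contract.
  apply: quantile_lbound.
    by rewrite expand_ge0// (le_trans Qv0)// ltW// (lt_trans vc).
  by apply: (le_trans (ltW un)); apply: tent_le_cdfE => //; rewrite expandK.
have lower : \forall n \near F, l - e < contract (quantile (mu_ n) (u_ n)).
  have [le0|le0] := ltP (l - e) 0.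
    by apply: nearW => n; rewrite (lt_le_trans le0)// contract_ge0 quantile_ge0.
  have lel : l - e < l by rewrite ltrBlDr ltrDl.
  move: lel => /rat_in_itvoo[c]; rewrite in_itv/= => /andP[ec].
  move=> /rat_in_itvoo[d]; rewrite in_itv/= => /andP[cd dl].
  have c0 : 0 <= ratr c :> R by rewrite (le_trans le0)// ltW.
  have l1 : l <= 1 by rewrite (le_trans (ler_norm _))// contract_le1.
  have d01 : ratr d \in [pred r : R | `|r| <= 1].
    by rewrite inE ger0_norm ?(le_trans (ltW dl))// (le_trans c0)// ltW.
  have c01 : ratr c \in [pred r : R | `|r| <= 1].
    by rewrite inE ger0_norm// (le_trans (ltW cd))// (le_trans (ltW dl)).
  have lt_u : \int[mu]_(y in E) tent (ratr c) (ratr d) y < u.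
    apply: (@le_lt_trans _ _ (cdfE mu (expand (ratr d)))).
      by apply: tent_le_cdfE => //; rewrite expandK.
    rewrite ltNge; apply/negP => /quantile_lbound => /(_ (expand_ge0 _)).
    rewrite (le_trans c0 (ltW cd)) => /(_ isT); rewrite leNgt.
    by rewrite lt_expandLR// dl.
  have h := cvgB ucv (tcv c d).
  have gap : 0 < u - \int[mu]_(y in E) tent (ratr c) (ratr d) y.
    by rewrite subr_gt0.
  apply: filterS (cvgr_gt _ (h FF) _ gap) => n; rewrite /= subr_gt0 => un.
  apply: (lt_trans ec); rewrite -lt_expandLR// ltNge; apply/negP => Qc.
  move: un; rewrite ltNge => /negP; apply.
  have ecf : (expand (ratr c) : \bar R) \is a fin_num.
    rewrite ge0_fin_numE ?expand_ge0// -lt_contract expandK//=.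
    by rewrite (lt_trans cd)// (lt_le_trans dl).
  apply: (@le_trans _ _ (cdfE (mu_ n) (expand (ratr c)))).
    rewrite -[X in cdfE _ X](fineK ecf) -quantile_le_fin ?fineK//.
    by rewrite fine_ge0// expand_ge0.
  by apply: cdfE_le_tent => //; rewrite expandK.
near=> n; rewrite ltr_distlC; apply/andP; split; near: n; [exact: lower|exact: upper].
Unshelve. all: by end_near. Qed.
End quantile_convergence.

(** * Weak convergence, concatenation and erasure *)

Lemma dominated_cvg_ae d (T : measurableType d) (R : realType)
    (mu : {measure set T -> \bar R}) (f_ : (T -> \bar R)^nat) (f g : T -> \bar R) :
  (forall n, measurable_fun setT (f_ n)) -> measurable_fun setT f ->
  {ae mu, forall x, f_ ^~ x @ \oo --> f x} -> mu.-integrable setT g ->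
  {ae mu, forall x n, (`|f_ n x| <= g x)%E} ->
  (\int[mu]_x f_ n x @[n --> \oo] --> \int[mu]_x f x)%E.
Proof.
move=> mf_ mf cf ig fg.
have [||//] := @dominated_convergence _ _ _ mu setT measurableT f_ f g mf_ mf _ ig.
  by apply: filterS cf => x ? _.
by apply: filterS fg => x ? n _.
Qed.

Section weak_convergence.
Context {R : realType}.
Implicit Type mu : Mf R.
Local Notation E := (@Eset R).
Local Notation leb := (@lebesgue_measure R).

Lemma measurable_Eset_comp d (T : measurableType d) (f : \bar R -> R) (Q : T -> \bar R) :
  {within E, continuous f} -> measurable_fun setT Q -> (forall u, 0 <= Q u)%E ->
  measurable_fun setT (fun u => (f (Q u))%:E).
Proof.
move=> cf mQ Q0; apply/measurable_EFinP.
apply: (measurable_comp (@measurable_Eset R)) mQ; last exact: Eset_measurable.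
by move=> _ [u _ <-]; exact: Q0.
Qed.

Lemma ae_notin_countable (D : set R) : countable D -> {ae leb, forall u, ~ D u}.
Proof.
move=> cD; exists D; split; first exact: countable_measurable.
  exact: countable_lebesgue_measure0.
by move=> u /= /contrapT.
Qed.

(** Extending the integrands by 0 turns the moving endpoint [c_ n] into pointwise convergence off u
    = c, and the countable set D is Lebesgue null. The dominating function is a bound of f on ]0,
    C], with C a bound of the [c_ n]. *)
Lemma quantile_integral_cvg (f : \bar R -> R) (Q_ : nat -> R -> \bar R)
    (Q : R -> \bar R) (D : set R) (c_ : nat -> R) c :
  {within E, continuous f} -> (forall x, (0 <= x)%E -> 0 <= f x) ->
  (forall n, measurable_fun setT (Q_ n)) -> measurable_fun setT Q ->
  (forall n u, 0 <= Q_ n u)%E -> (forall u, 0 <= Q u)%E ->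
  countable D -> c_ n @[n --> \oo] --> c ->
  (forall u, 0 < u < c -> ~ D u -> Q_ n u @[n --> \oo] --> Q u) ->
  (\int[leb]_(u in `]0%R, c_ n]) (f (Q_ n u))%:E @[n --> \oo] -->
   \int[leb]_(u in `]0%R, c]) (f (Q u))%:E)%E.
Proof.
move=> cf f0 mQ_ mQ Q_0 Q0 cD ccv Qcv.
have [M M0 fM] := Eset_bounded cf.
have [C cC] : exists C, forall n, c_ n <= C.
  have /cvg_seq_bounded[C [_ CP]] : cvgn c_ by apply: cvgP ccv.
  by exists (C + 1) => n; rewrite (le_trans (ler_norm _))// CP// ltrDl.
under eq_fun do rewrite integral_mkcond.
rewrite integral_mkcond.
have mitv (a : R) : measurable (`]0, a]%classic : set R) by exact: measurable_itv.
apply: (@dominated_cvg_ae _ _ _ leb _ _ ((cst M%:E) \_ `]0, C]%classic)).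
- move=> n; apply/(measurable_restrictT _ (mitv _)).
  by apply: measurable_funTS; exact: measurable_Eset_comp.
- apply/(measurable_restrictT _ (mitv _)).
  by apply: measurable_funTS; exact: measurable_Eset_comp.
- apply: (@filterS2 _ _ (ae_filter_ringOfSetsType leb) _ _ _ _
    (ae_notin_countable (countable1 c)) (ae_notin_countable cD)) => u /= uc Du.
  have rin (g : R -> \bar R) a : 0 < u <= a -> (g \_ `]0, a]) u = g u.
    by move=> ua; rewrite patchE mem_set//= in_itv.
  have rout (g : R -> \bar R) a : ~ 0 < u <= a -> (g \_ `]0, a]) u = 0%E.
    by move=> ua; rewrite patchE memNset//= in_itv.
  have [u0|u0] := leP u 0.
    rewrite rout; last by rewrite ltNge u0.
    under eq_fun do (rewrite rout; last by rewrite ltNge u0).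
    exact: cvg_cst.
  have [{}uc|cu|//] := ltgtP u c.
    rewrite rin ?u0 ?ltW//.
    have : (f (Q_ n u))%:E @[n --> \oo] --> (f (Q u))%:E.
      apply: cvg_EFin; first exact: nearW.
      by apply: (Eset_cvg cf) => //; apply: Qcv => //; rewrite u0.
    apply: cvg_trans; apply: near_eq_cvg.
    apply: filterS (cvgr_gt _ ccv _ uc) => n ucn.
    by rewrite rin// u0 ltW.
  rewrite rout; last by rewrite u0/= leNgt cu.
  apply: cvg_near_cst.
  apply: filterS (cvgr_lt _ ccv _ cu) => n ucn.
  by rewrite rout// u0/= leNgt ucn.
- apply: (iffLR (integrable_mkcond (mu := leb) (cst M%:E) (mitv C))).
  apply/integrableP; split; first exact: measurable_cst.
  under eq_integral do rewrite /= ger0_norm//.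
  rewrite [ltLHS](integral_cst leb (mitv C) M%:E).
  by rewrite -[X in (_ * X)%E]/(leb `]0, C]%classic) leb_itv0 -EFinM ltry.
- apply: aeW => u n; rewrite !patchE.
  case: ifPn => [|_]; last first.
    by rewrite abse0; case: ifPn => // _; rewrite lee_fin.
  rewrite inE/= in_itv/= => /andP[u0 ucn]; rewrite mem_set/=.
    by rewrite lee_fin fM.
  by rewrite in_itv/= u0 (le_trans ucn).
Qed.

(** If M bounds f, then f is the difference of f + M and M, both non-negative; the integral formulas
    for quantiles and concatenations are stated for non-negative functions. *)
Lemma Mf_cvg_ge0 {T : Type} (F : set_system T) (FF : Filter F)
    (mu_ : T -> Mf R) mu :
  (forall f : \bar R -> R, {within E, continuous f} ->
    (forall x, (0 <= x)%E -> 0 <= f x) ->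
    (\int[mu_ n]_(x in E) (f x)%:E @[n --> F] --> \int[mu]_(x in E) (f x)%:E)%E) ->
  mu_ n @[n --> F] --> mu.
Proof.
move=> h; apply/Mf_cvgP => f cf.
have [M M0 fM] := Eset_bounded cf.
have cM (r : R) : {within E, continuous (fun=> r : R)}.
  by apply: continuous_subspaceT => x; exact: cvg_cst.
have h' (g : \bar R -> R) : {within E, continuous g} ->
    (forall x, (0 <= x)%E -> 0 <= g x) ->
    (\int[mu_ n]_(x in E) g x @[n --> F] --> \int[mu]_(x in E) g x)%R.
  move=> cg g0; have := h g cg g0.
  under eq_fun do rewrite -EFin_Mf_integral//.
  by rewrite -EFin_Mf_integral// => /fine_cvg.
have cfM : {within E, continuous (fun x => f x + M)}.
  by move=> x; apply: cvgD; [exact: cf|exact: cvg_cst].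
have fE (nu : Mf R) : \int[nu]_(x in E) f x =
    \int[nu]_(x in E) (f x + M) - \int[nu]_(x in E) M.
  rewrite RintegralD ?addrK//; first exact: measurable_Eset.
    exact: Mf_integrable.
  exact: (Mf_integrable nu (cM M)).
suff : \int[mu_ n]_(x in E) f x @[n --> F] --> \int[mu]_(x in E) f x by [].
rewrite fE; under eq_fun do rewrite fE.
apply: cvgB; apply: h' => //.
by move=> x /fM; rewrite ler_norml => /andP[fx _]; rewrite -lerBlDr sub0r.
Qed.

Lemma quantile_cvg_Mf (mu_ : nat -> Mf R) mu (D : set R) :
  countable D -> mass (mu_ n) @[n --> \oo] --> mass mu ->
  (forall u, 0 < u < mass mu -> ~ D u ->
    quantile (mu_ n) u @[n --> \oo] --> quantile mu u) ->
  mu_ n @[n --> \oo] --> mu.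
Proof.
move=> cD mcv Qcv; apply: Mf_cvg_ge0 => f cf f0.
have mf : measurable_fun E (fun x => (f x)%:E).
  by apply/measurable_EFinP; exact: Eset_measurable.
under eq_fun do rewrite ge0_integral_Mf//.
rewrite ge0_integral_Mf//; apply: quantile_integral_cvg cD mcv Qcv => //.
- by move=> n; exact: measurable_quantile.
- exact: measurable_quantile.
- by move=> n u; exact: quantile_ge0.
- by move=> u; exact: quantile_ge0.
Qed.

(** The constant 1 followed by an enumeration of the rational tents. A code that decodes to nothing
    gives [tent 0 0], the null function. *)
Definition test_seq (j : nat) : \bar R -> R :=
  if j is j'.+1 then
    let cd : rat * rat := odflt (0, 0) (unpickle j') in
    tent (ratr cd.1) (ratr cd.2)
  else fun=> 1.

Lemma test_seq_tent (c d : rat) : exists j, test_seq j = tent (ratr c) (ratr d).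
Proof. by exists (pickle (c, d)).+1; rewrite /test_seq pickleK. Qed.

Lemma continuous_test_seq j : {within E, continuous (test_seq j)}.
Proof.
case: j => [|j]; last exact: continuous_tent.
by apply: continuous_subspaceT => x; exact: cvg_cst.
Qed.

Lemma test_seq_ge0 j x : 0 <= test_seq j x.
Proof. by case: j => [|j] /=; rewrite ?ler01 ?tent_ge0. Qed.

(** The constant 1 controls the masses, and the tents control the quantiles off the countably many
    jumps of the limit. *)
Lemma test_seq_cvg (mu_ : nat -> Mf R) mu :
  (forall j, \int[mu_ n]_(x in E) test_seq j x @[n --> \oo] -->
    \int[mu]_(x in E) test_seq j x) ->
  mu_ n @[n --> \oo] --> mu.
Proof.
move=> h; apply: (quantile_cvg_Mf (countable_jumps (@quantile_nd _ mu))).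
  have := h 0%N; rewrite /= Mf_integral_cst mul1r.
  by under eq_fun do rewrite Mf_integral_cst mul1r.
move=> u _ /contrapT; apply: quantile_cvg; last exact: cvg_cst.
by move=> c d; have [j <-] := test_seq_tent c d; exact: h.
Qed.

Lemma Mf_cvg_quantile (mu_ : nat -> Mf R) mu (u_ : nat -> R) u :
  mu_ n @[n --> \oo] --> mu -> u_ n @[n --> \oo] --> u ->
  right_continuity_pt (quantile mu) u ->
  quantile (mu_ n) (u_ n) @[n --> \oo] --> quantile mu u.
Proof.
move=> /Mf_cvgP h; apply: quantile_cvg => c d.
exact/h/continuous_tent.
Qed.

Lemma Mf_cvg_mass (mu_ : nat -> Mf R) mu :
  mu_ n @[n --> \oo] --> mu -> mass (mu_ n) @[n --> \oo] --> mass mu.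
Proof.
move=> /Mf_cvgP/(_ (fun=> 1)) h; rewrite -[mass mu]mul1r -Mf_integral_cst.
under eq_fun do rewrite -[mass _]mul1r -Mf_integral_cst.
by apply: h; apply: continuous_subspaceT => x; exact: cvg_cst.
Qed.

(** Otherwise one could choose for each n a measure outside A satisfying the n-th condition, and
    these would converge to mu. Hence mu has a countable base of neighbourhoods. *)
Lemma Mf_nbhs_base mu (A : set (Mf R)) : nbhs mu A ->
  exists n, forall nu : Mf R,
    (forall j, (j < n)%N -> `|\int[mu]_(x in E) test_seq j x -
       \int[nu]_(x in E) test_seq j x| < n.+1%:R^-1) -> A nu.
Proof.
move=> Amu; apply: contrapT => /forallNP h.
have /choice[nu_ nuP] : forall n, exists nu : Mf R,
    (forall j, (j < n)%N -> `|\int[mu]_(x in E) test_seq j x -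
       \int[nu]_(x in E) test_seq j x| < n.+1%:R^-1) /\ ~ A nu.
  by move=> n; have /existsNP[nu /not_implyP[? ?]] := h n; exists nu.
have : nu_ n @[n --> \oo] --> mu.
  apply: test_seq_cvg => j; apply/cvgrPdist_lt => e e0.
  near=> n; apply: lt_trans ((nuP n).1 j _) _; first by near: n; exact: nbhs_infty_gt.
  by near: n; exact: (near_infty_natSinv_lt (PosNum e0)).
move=> /(_ _ Amu) [N _ /(_ N (leqnn N))]; exact: (nuP N).2.
Unshelve. all: by end_near. Qed.

End weak_convergence.

Section concat_erase.
Context {R : realType}.
Implicit Types mu rho : Mf R.
Local Notation E := (@Eset R).
Local Notation leb := (@lebesgue_measure R).

Lemma measurable_shift_Eset (h : \bar R) (f : \bar R -> \bar R) : (0 <= h)%E ->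
  measurable_fun E f -> measurable_fun E (fun x => f (h + x)%E).
Proof.
move=> h0 mf; apply: (measurable_comp (@measurable_Eset R)) mf _.
  by move=> _ [x x0 <-]; exact: adde_ge0.
by apply: emeasurable_funD; [exact: measurable_cst|exact: measurable_id].
Qed.

Lemma ge0_integral_shift rho (h : \bar R) (f : \bar R -> \bar R) : (0 <= h)%E ->
  measurable_fun E f -> (forall x, 0 <= x -> 0 <= f x)%E ->
  (\int[rho]_(x in E) f (h + x) =
   \int[leb]_(u in `]0%R, mass rho]) f (h + quantile rho u))%E.
Proof.
move=> h0 mf f0; rewrite (ge0_integral_Mf rho (f := fun x => f (h + x)%E))//.
  exact: measurable_shift_Eset.
by move=> x x0; rewrite f0// adde_ge0.
Qed.

(** Here mu and a enter only through the quantile function of mu and the level mass mu - a, so that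
    continuity in (mu, a) becomes convergence of quantiles. *)
Lemma ge0_integral_concat_erase mu a rho (f : \bar R -> \bar R) : 0 <= a ->
  measurable_fun E f -> (forall x, 0 <= x -> 0 <= f x)%E ->
  (\int[concat (erase a mu) rho]_(x in E) f x =
   \int[leb]_(u in `]0%R, (mass mu - a)%R]) f (quantile mu u) +
   \int[leb]_(u in `]0%R, mass rho]) f (quantile mu (mass mu - a)%R + quantile rho u))%E.
Proof.
move=> a0 mf f0; rewrite concat_integral// ge0_integral_erase// height_erase//.
by congr (_ + _)%E; exact: (ge0_integral_shift rho (quantile_ge0 _ _) mf f0).
Qed.

Lemma Eset_measurable_EFin (f : \bar R -> R) : {within E, continuous f} ->
  measurable_fun E (EFin \o f).
Proof. by move=> cf; apply/measurable_EFinP; exact: Eset_measurable. Qed.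

(** Convergence of the grafting heights is left as a hypothesis because it has two sources: a
    right-continuity point when the measures vary, and left continuity when mu is fixed and the
    levels increase. *)
Lemma concat_erase_cvg (mu_ : nat -> Mf R) mu rho (a_ : nat -> R) (a : R) :
  (forall n, 0 <= a_ n) -> 0 <= a ->
  mu_ n @[n --> \oo] --> mu -> a_ n @[n --> \oo] --> a ->
  quantile (mu_ n) (mass (mu_ n) - a_ n) @[n --> \oo] -->
    quantile mu (mass mu - a) ->
  concat (erase (a_ n) (mu_ n)) rho @[n --> \oo] --> concat (erase a mu) rho.
Proof.
move=> a_0 a0 mucv acv hcv; apply: Mf_cvg_ge0 => f cf f0.
have mf := Eset_measurable_EFin cf.
have f0' x : (0 <= x -> 0 <= (f x)%:E)%E by move/f0; rewrite lee_fin.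
under eq_fun do rewrite (ge0_integral_concat_erase _ _ _ mf)//.
rewrite (ge0_integral_concat_erase _ _ _ mf)//.
have mcv : mass (mu_ n) - a_ n @[n --> \oo] --> mass mu - a.
  by apply: cvgB => //; exact: Mf_cvg_mass.
apply: cvgeD.
- by rewrite ge0_adde_def// inE integral_ge0// => x _;
    rewrite f0' ?quantile_ge0// adde_ge0 ?quantile_ge0.
- apply: (quantile_integral_cvg cf f0 _ _ _ _ (countable_jumps (@quantile_nd _ mu)) mcv) => //.
  + by move=> n; exact: measurable_quantile.
  + exact: measurable_quantile.
  + by move=> n u; exact: quantile_ge0.
  + by move=> u; exact: quantile_ge0.
  + move=> u _ /contrapT; apply: Mf_cvg_quantile => //; exact: cvg_cst.
have mshift h : measurable_fun setT (fun u => h + quantile rho u)%E.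
  by apply: emeasurable_funD; [exact: measurable_cst|exact: measurable_quantile].
apply: (@quantile_integral_cvg _ f
  (fun n u => quantile (mu_ n) (mass (mu_ n) - a_ n) + quantile rho u)%E
  (fun u => quantile mu (mass mu - a) + quantile rho u)%E set0 (fun=> mass rho)) => //.
- by move=> n u; rewrite adde_ge0 ?quantile_ge0.
- by move=> u; rewrite adde_ge0 ?quantile_ge0.
- exact: cvg_cst.
- move=> u _ _; apply: cvgeD => //; last exact: cvg_cst.
  by rewrite ge0_adde_def// inE quantile_ge0.
Qed.

(** Where the second measure is grafted does not matter, since its contribution is at most M times
    its vanishing mass; the truncation level of the first tends to mass mu. *)
Lemma concat_erase_cvg_start mu (rho_ : nat -> Mf R) (a_ : nat -> R) :
  (forall n, 0 <= a_ n) -> a_ n @[n --> \oo] --> 0 ->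
  mass (rho_ n) @[n --> \oo] --> 0 ->
  concat (erase (a_ n) mu) (rho_ n) @[n --> \oo] --> mu.
Proof.
move=> a_0 acv rcv; apply: Mf_cvg_ge0 => f cf f0.
have mf := Eset_measurable_EFin cf.
have f0' x : (0 <= x -> 0 <= (f x)%:E)%E by move/f0; rewrite lee_fin.
under eq_fun do rewrite (ge0_integral_concat_erase _ _ _ mf)//.
have -> : (\int[mu]_(x in E) (f x)%:E =
    \int[leb]_(u in `]0%R, mass mu]) (EFin \o f) (quantile mu u) + 0)%E.
  by rewrite adde0; exact: ge0_integral_Mf.
have mcv : mass mu - a_ n @[n --> \oo] --> mass mu.
  by rewrite -[X in _ --> X]subr0; apply: cvgB => //; exact: cvg_cst.
apply: cvgeD.
- by rewrite fin_num_adde_defl.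
- apply: (quantile_integral_cvg cf f0 _ _ _ _ (countable0 R) mcv) => //.
  + by move=> n; exact: measurable_quantile.
  + exact: measurable_quantile.
  + by move=> n u; exact: quantile_ge0.
  + by move=> u; exact: quantile_ge0.
  + by move=> u _ _; exact: cvg_cst.
have [M M0 fM] := Eset_bounded cf.
apply: (@squeeze_cvge _ _ _ _ (cst 0%E) _ (fun n => (M * mass (rho_ n))%:E)).
- apply: nearW => n; apply/andP; split.
    by apply: integral_ge0 => u _; rewrite f0'// adde_ge0 ?quantile_ge0.
  have mitv : measurable (`]0%R, mass (rho_ n)]%classic : set R) by exact: measurable_itv.
  have -> : (M * mass (rho_ n))%:E = (\int[leb]_(u in `]0%R, mass (rho_ n)]) (cst M%:E u))%E.
    rewrite (integral_cst leb mitv) -[X in (_ = _ * X)%E]/(leb `]0, mass (rho_ n)]%classic).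
    by rewrite leb_itv0 EFinM max_l// mass_ge0.
  apply: ge0_le_integral => //.
  + by move=> u _; rewrite f0'// adde_ge0 ?quantile_ge0.
  + apply: measurable_funTS; apply: measurable_Eset_comp => //.
      by apply: emeasurable_funD; [exact: measurable_cst|exact: measurable_quantile].
    by move=> u; rewrite adde_ge0 ?quantile_ge0.
  + move=> u _; rewrite lee_fin (le_trans (ler_norm _))// fM// adde_ge0//;
    exact: quantile_ge0.
- exact: cvg_cst.
- apply: cvg_EFin; first exact: nearW.
  by rewrite -(mulr0 M); apply: cvgMr.
Qed.

Lemma mass_concat_erase mu a rho : 0 <= a ->
  mass mu - a <= mass (concat (erase a mu) rho).
Proof.
move=> a0; rewrite -lee_fin massE.
apply: (@le_trans _ _ (erase a mu setT)); last first.
  by rewrite -[leRHS]/(erase a mu setT + rho setT)%E leeDl.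
rewrite eraseE// quantile_measureE preimage_setT setTI leb_itv0.
by rewrite lee_fin le_max lexx.
Qed.

End concat_erase.

(** * Compactness of the sets of measures of bounded mass *)

(** Tychonoff in place of a diagonal extraction: l is a cluster point in the product of segments,
    and k n >= n is chosen so that the first n coordinates are within 1 / (n + 1) of those of l. *)
Lemma bounded_diagonal {R : realType} (x : nat -> nat -> R) (a b : R) :
  (forall n j, a <= x n j <= b) ->
  exists (k : nat -> nat) (l : nat -> R), (forall n, (n <= k n)%N) /\
    forall j, x (k n) j @[n --> \oo] --> l j.
Proof.
move=> xab.
pose T : topologicalType := prod_topology (fun _ : nat => R).
pose K : set T := [set f : nat -> R | forall j, `[a, b]%classic (f j)].
have cK : compact K.
  by apply: (@tychonoff nat (fun=> R) (fun=> `[a, b]%classic)) => j; exact: segment_compact.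
pose xT : nat -> T := x.
have [|l [_ lcl]] := cK (xT @ \oo) _.
  by exists 0%N => // n _ j; rewrite /= in_itv/= xab.
have near_l n (e : R) : 0 < e ->
    nbhs l [set f : T | forall j, (j < n)%N -> `|(l : nat -> R) j - (f : nat -> R) j| < e].
  move=> e0; elim: n => [|n IHn]; first by apply: filterS filterT => f _ j.
  have := @proj_continuous nat (fun=> R) n l (ball ((l : nat -> R) n) e)
    (nbhsx_ballx _ _ e0).
  apply: filterS2 IHn => f fn fe j.
  by rewrite ltnS leq_eqVlt => /orP[/eqP ->|/fn//].
have /choice[k kP] n : exists k, (n <= k)%N /\ forall j, (j < n)%N ->
    `|(l : nat -> R) j - x k j| < n.+1%:R^-1.
  have xr : (xT @ \oo) [set f | exists2 m, (n <= m)%N & f = xT m].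
    by exists n => // m /= nm; exists m.
  have n0 : 0 < n.+1%:R^-1 :> R by rewrite invr_gt0.
  by have [_ [[m nm ->] xm]] := lcl _ _ xr (near_l n _ n0); exists m.
exists k, l; split=> [n|j]; first exact: (kP n).1.
apply/cvgrPdist_lt => e e0.
near=> n; apply: lt_trans ((kP n).2 j _) _; first by near: n; exact: nbhs_infty_gt.
by near: n; exact: (near_infty_natSinv_lt (PosNum e0)).
Unshelve. all: by end_near. Qed.

Section compactness.
Context {R : realType}.
Implicit Types mu rho : Mf R.
Local Notation E := (@Eset R).
Local Notation leb := (@lebesgue_measure R).

(* Helly's selection theorem applied to the quantile functions. *)
Lemma Mf_seq_compact (mu_ : nat -> Mf R) C : (forall n, mass (mu_ n) <= C) ->
  exists (k : nat -> nat) mu, (forall n, (n <= k n)%N) /\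
    mu_ (k n) @[n --> \oo] --> mu.
Proof.
move=> muC.
(* Coordinate 0 is the mass; the others are the quantiles at rational levels, read through
   [contract] to be bounded. *)
pose x n j : R := if j is j'.+1 then
  contract (quantile (mu_ n) (ratr (odflt 0%Q (unpickle j')))) else mass (mu_ n).
have q1 n u : 0 <= contract (quantile (mu_ n) u) <= 1.
  rewrite contract_ge0 quantile_ge0/=.
  by have := contract_le1 (quantile (mu_ n) u); rewrite ler_norml => /andP[].
have [|k [l [kn kl]]] := @bounded_diagonal _ x 0 (Num.max C 1).
  move=> n [|j]; rewrite /x le_max; first by rewrite mass_ge0 muC.
  by have /andP[-> ->] := q1 n (ratr (odflt 0%Q (unpickle j))); rewrite orbT.
have /choice[L LP] : forall q : rat, exists r : R,
    contract (quantile (mu_ (k n)) (ratr q)) @[n --> \oo] --> r.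
  move=> q; exists (l (pickle q).+1); have := kl (pickle q).+1.
  by rewrite /x pickleK.
have mcv : mass (mu_ (k n)) @[n --> \oo] --> l 0%N by exact: (kl 0%N).
have L_nd q q' : ratr q <= ratr q' :> R -> L q <= L q'.
  move=> qq'; apply: (ler_cvg_to (LP q) (LP q')); apply: nearW => n.
  by rewrite le_contract quantile_nd.
have L0 q : 0 <= L q.
  by apply: (ler_cvg_to (cvg_cst 0) (LP q)); apply: nearW => n; have /andP[] := q1 (k n) (ratr q).
have L1 q : L q <= 1.
  rewrite -(cvg_lim (@Rhausdorff R) (LP q)); apply: limr_le; first exact: cvgP (LP q).
  by apply: nearW => n; have /andP[] := q1 (k n) (ratr q).
(* The limits at rational levels are extended to all levels as a nondecreasing left-continuous
   function. *)
pose S (u : R) := [set L q | q in [set q : rat | ratr q < u]].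
have S0 u : S u !=set0.
  have [|q] := @rat_in_itvoo R (u - 1) u; first by rewrite gtrBl.
  by rewrite in_itv/= => /andP[_ qu]; exists (L q); exists q.
have Sub u : has_ubound (S u) by exists 1 => _ [q _ <-].
pose g u := sup (S u).
have g_ub q u : ratr q < u -> L q <= g u.
  by move=> qu; apply: ub_le_sup => //; exists q.
have g1 u : g u <= 1 by apply: ge_sup => // _ [q _ <-].
have g0 u : 0 <= g u.
  by have [_ [q qu _]] := S0 u; apply: (le_trans (L0 q)); exact: g_ub.
have g_in u : g u \in [pred r | `|r| <= 1] by rewrite inE ger0_norm.
have g_nd u v : u <= v -> g u <= g v.
  by move=> uv; apply: ge_sup => // _ [q qu <-]; apply: g_ub; exact: lt_le_trans uv.
pose Q u := expand (g u).
have Q0 u : (0 <= Q u)%E by exact: expand_ge0.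
have ndQ : {homo Q : u v / u <= v >-> (u <= v)%E}.
  by move=> u v uv; rewrite -le_contract !expandK// g_nd.
have mQ := nondecreasing_measurable_ereal ndQ.
(* The total mass is the limit of the masses: nothing is lost at infinity, as +oo belongs to E. *)
have [nu nuE] := itv_pushforward_Mf mQ Q0 (l 0%N).
exists k, nu; split => //; apply: Mf_cvg_ge0 => f cf f0.
have mf := Eset_measurable_EFin cf.
have f0' y : (0 <= y -> 0 <= (f y)%:E)%E by move/f0; rewrite lee_fin.
under eq_fun do rewrite (ge0_integral_Mf _ mf)//.
have -> : (\int[nu]_(x in E) (f x)%:E =
    \int[leb]_(u in `]0%R, l 0%N]) (EFin \o f) (Q u))%E.
  rewrite -(ge0_integral_itv_pushforward mQ Q0)//.
  by apply: eq_measure_integral => A mA _; exact: nuE.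
apply: (quantile_integral_cvg cf f0 _ mQ _ Q0 (countable_jumps ndQ) mcv) => //.
- by move=> n; exact: measurable_quantile.
- by move=> n u; exact: quantile_ge0.
move=> u _ /contrapT rc; apply/(cvg_contractP _ _)/cvgrPdist_lt => e e0.
rewrite /Q expandK//.
have upper : \forall n \near \oo, contract (quantile (mu_ (k n)) u) < g u + e.
  have [le1|le1] := ltP 1 (g u + e).
    by apply: nearW => n; rewrite (le_lt_trans _ le1)//; have /andP[] := q1 (k n) u.
  have lep : g u + e \in [pred r | `|r| <= 1] by rewrite inE ger0_norm// addr_ge0// ltW.
  have [|v uv vQ] := rc (expand (g u + e)).
    by rewrite lt_expandRL// /Q expandK// ltrDl.
  move: vQ; rewrite lt_expandRL// /Q expandK// => gv.
  move: uv => /rat_in_itvoo[q]; rewrite in_itv/= => /andP[uq qv].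
  have Lq : L q < g u + e by rewrite (le_lt_trans (g_ub _ _ qv)).
  apply: filterS (cvgr_lt _ (LP q) _ Lq) => n; apply: le_lt_trans.
  by rewrite le_contract quantile_nd// ltW.
have lower : \forall n \near \oo, g u - e < contract (quantile (mu_ (k n)) u).
  have [_ [q qu <-] Lq] : exists2 r, S u r & g u - e < r.
    by apply: sup_adherent => //; split.
  apply: filterS (cvgr_gt _ (LP q) _ Lq) => n /lt_le_trans; apply.
  by rewrite le_contract quantile_nd// ltW.
near=> n; rewrite ltr_distlC; apply/andP; split; near: n; [exact: lower|exact: upper].
Unshelve. all: by end_near. Qed.

(** F is small on measures of large mass, and the others are sequentially relatively compact. Both
    halves go by contradiction, since vanishing at infinity is expressed with sequences. *)
Lemma C0_Mf_bounded (F : Mf R -> R) : C0_Mf F ->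
  exists2 M, 0 <= M & forall mu, `|F mu| <= M.
Proof.
move=> [cF F0].
have [C CP] : exists C, forall mu, C < mass mu -> `|F mu| <= 1.
  apply: contrapT => /forallNP h.
  have /choice[mu_ muP] (n : nat) : exists mu : Mf R, n%:R < mass mu /\ 1 < `|F mu|.
    have /existsNP[mu /not_implyP[nm Fm]] := h n%:R; exists mu; split => //.
    by rewrite ltNge; exact/negP.
  have /F0 : mass (mu_ n) @[n --> \oo] --> +oo.
    apply/cvgryPge => A; near=> n; apply/ltW/(le_lt_trans _ (muP n).1).
    by near: n; exact: nbhs_infty_ger.
  move=> /cvgrPdist_lt/(_ 1 ltr01)[n _ /(_ n (leqnn n))].
  by rewrite /= sub0r normrN ltNge ltW// (muP n).2.
have [M MP] : exists M, forall mu, mass mu <= C -> `|F mu| <= M.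
  apply: contrapT => /forallNP h.
  have /choice[mu_ muP] (n : nat) : exists mu : Mf R, mass mu <= C /\ n%:R < `|F mu|.
    have /existsNP[mu /not_implyP[nm Fm]] := h n%:R; exists mu; split => //.
    by rewrite ltNge; exact/negP.
  have [k [mu [kn kmu]]] := Mf_seq_compact (fun n => (muP n).1).
  have : F (mu_ (k n)) @[n --> \oo] --> F mu.
    by apply: (@cvg_comp _ _ _ (mu_ \o k) F); [exact: kmu|exact: cF].
  move=> /cvgrPdist_lt/(_ 1 ltr01) h1.
  have h2 : \forall n \near \oo, `|F mu| + 1 <= n%:R by exact: nbhs_infty_ger.
  have [n [/= d1 d2]] : exists n, `|F mu - F (mu_ (k n))| < 1 /\ `|F mu| + 1 <= n%:R.
    by have [n] := @filter_ex _ _ _ _ (filterI h1 h2); exists n.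
  have := (muP (k n)).2; apply/negP; rewrite -leNgt.
  apply: (@le_trans _ _ n%:R); last by rewrite ler_nat.
  apply: le_trans d2; rewrite -lerBlDl (le_trans _ (ltW d1))// distrC.
  exact: lerB_dist.
exists (Num.max 1 M); first by rewrite le_max ler01.
move=> mu; rewrite le_max; have [mC|Cm] := leP (mass mu) C.
  by rewrite MP// orbT.
by rewrite CP.
Unshelve. all: by end_near. Qed.

End compactness.

Lemma quantile_cvg_left {R : realType} (mu : Mf R) (c_ : nat -> R) (c : R) :
  (forall n, c_ n <= c) -> c_ n @[n --> \oo] --> c ->
  quantile mu (c_ n) @[n --> \oo] --> quantile mu c.
Proof.
move=> cc ccv; have [c0|c0] := leP c 0.
  rewrite quantile_le0//; apply: cvg_near_cst; apply: nearW => j.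
  by rewrite quantile_le0// (le_trans (cc j)).
apply/(cvg_contractP _ _)/cvgrPdist_lt => e e0.
have lower : \forall n \near \oo, contract (quantile mu c) - e < contract (quantile mu (c_ n)).
  have [le0|le0] := ltP (contract (quantile mu c) - e) 0.
    by apply: nearW => n; rewrite (lt_le_trans le0)// contract_ge0 quantile_ge0.
  have cin : contract (quantile mu c) - e \in [pred r | `|r| <= 1].
    rewrite inE ger0_norm// (le_trans (_ : _ <= contract (quantile mu c)))//.
      by rewrite gerBl ltW.
    by rewrite (le_trans (ler_norm _))// contract_le1.
  have [|v /andP[_ vc] vP] := @quantile_left_cont _ mu c
      (expand (contract (quantile mu c) - e)) c0.
    by rewrite lt_expandLR// ltrBlDr ltrDl.
  apply: filterS (cvgr_gt _ ccv _ vc) => n vcn.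
  by rewrite -lt_expandLR// vP.
apply: filterS lower => n; rewrite ltr_distlC => ->/=.
by rewrite (@le_lt_trans _ _ (contract (quantile mu c)))// ?ltrDl// le_contract quantile_nd.
Qed.

(** * Measurability of functionals of random measures *)

Section random_measures.
Context {R : realType} d (Omega : measurableType d).
Local Notation E := (@Eset R).

Lemma measurable_countable_family (I : countType) (v : Omega -> I)
    (G : I -> Omega -> R) :
  (forall i, measurable (v @^-1` [set i])) -> (forall i, measurable_fun setT (G i)) ->
  measurable_fun setT (fun w => G (v w) w).
Proof.
move=> mv mG _ B mB; rewrite setTI.
rewrite (_ : _ @^-1` B = \bigcup_i (v @^-1` [set i] `&` G i @^-1` B)).
  apply: countable_bigcupT_measurable => [|i]; first exact: countableP.
  by apply: measurableI => //; rewrite -[X in measurable X]setTI; exact: mG.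
by apply/seteqP; split => [w Bw|w [i _ [/= <-]]//]; exists (v w).
Qed.

Variable nu : Omega -> Mf R.
Hypothesis mnu : forall A, measurable A -> measurable_fun setT (fun w => nu w A).

Lemma measurable_Mf_integral (f : \bar R -> R) :
  {within E, continuous f} -> (forall x, (0 <= x)%E -> 0 <= f x) ->
  measurable_fun setT (fun w => \int[nu w]_(x in E) f x).
Proof.
move=> cf f0; apply/measurable_EFinP.
apply: (eq_measurable_fun (fun w => \int[nu w]_x ((EFin \o f) \_ E) x)%E).
  by move=> w _; rewrite /= EFin_Mf_integral// -integral_mkcond.
apply: (@measurable_fun_integral_kernel _ _ _ _ _ (fun w => nu w)).
- exact: mnu.
- by move=> x; rewrite patchE; case: ifPn => //; rewrite inE => /f0; rewrite lee_fin.
- apply/(measurable_restrictT _ (@measurable_Eset R)).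
  exact: Eset_measurable_EFin.
Qed.

(** A countable family, indexed by a number of test functions and rational centres. The radius is
    half that of [Mf_nbhs_base], so that two members of one set satisfy the condition there by the
    triangle inequality. *)
Let basic (i : nat * seq rat) : set (Mf R) :=
  [set m : Mf R | forall j, (j < i.1)%N ->
    `|\int[m]_(x in E) test_seq j x - ratr (nth 0%Q i.2 j)| < (2 * i.1.+1%:R)^-1].

Let basicP (m : Mf R) (A : set (Mf R)) : nbhs m A ->
  exists i, basic i m /\ basic i `<=` A.
Proof.
move=> /Mf_nbhs_base[n nA].
have n0 : 0 < (2 * n.+1%:R)^-1 :> R by rewrite invr_gt0 mulr_gt0.
have /choice[c cP] (j : nat) : exists c : rat,
    `|\int[m]_(x in E) test_seq j x - ratr c| < (2 * n.+1%:R)^-1.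
  have [|c] := @rat_in_itvoo R (\int[m]_(x in E) test_seq j x)
    (\int[m]_(x in E) test_seq j x + (2 * n.+1%:R)^-1); first by rewrite ltrDl.
  rewrite in_itv/= => /andP[c1 c2]; exists c.
  by rewrite distrC gtr0_norm ?subr_gt0// ltrBlDl.
exists (n, mkseq c n); split => [j /= jn|m' /= m'P]; first by rewrite nth_mkseq.
apply: nA => j jn; have := m'P j jn; rewrite nth_mkseq// distrC => h.
rewrite -(subrKA (ratr (c j))) (le_lt_trans (ler_normD _ _))//.
rewrite (_ : n.+1%:R^-1 = (2 * n.+1%:R)^-1 + (2 * n.+1%:R)^-1) ?ltrD//.
by rewrite invfM -mulrDl -[2^-1]mul1r -splitr mul1r.
Qed.

(** Measurability of [nu] is known only setwise. The preimage of a ray by F \o nu is a countable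
    union of preimages of [basic] sets, each given by finitely many integrals against nu. *)
Lemma measurable_continuous_Mf (F : Mf R -> R) : continuous F ->
  measurable_fun setT (F \o nu).
Proof.
move=> cF.
apply: (measurability _ (RGenOInfty.measurableE R)) => _ /= -[_ [r ->] <-].
rewrite setTI.
have -> : (F \o nu) @^-1` `]r, +oo[ =
    \bigcup_(i in [set i | basic i `<=` [set m | r < F m]]) (nu @^-1` basic i).
  apply/seteqP; split => w /=; last first.
    by case=> i /= iF /iF /=; rewrite in_itv/= andbT.
  rewrite in_itv/= andbT => rF.
  have /basicP[i [iw iF]] : nbhs (nu w) [set m | r < F m].
    exact: (cvgr_gt _ (cF (nu w)) _ rF).
  by exists i.
have mb i : measurable (nu @^-1` basic i).
  rewrite (_ : _ @^-1` _ = \bigcap_j (if (j < i.1)%N then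
      [set w | `|\int[nu w]_(x in E) test_seq j x - ratr (nth 0%Q i.2 j)|
         < (2 * i.1.+1%:R)^-1] else setT)); last first.
    apply/seteqP; split=> [w iw j _|w iw j ji]; first by case: ifPn => // /iw.
    by have := iw j Logic.I; rewrite ji.
  apply: bigcapT_measurable => j; case: ifPn => // _.
  have mI : measurable_fun setT (fun w =>
      `|\int[nu w]_(x in E) test_seq j x - ratr (nth 0%Q i.2 j)|).
    apply: measurableT_comp => //; apply: measurable_funB => //.
    apply: measurable_Mf_integral; first exact: continuous_test_seq.
    by move=> x _; exact: test_seq_ge0.
  rewrite [X in measurable X](_ : _ = setT `&` (fun w =>
      `|\int[nu w]_(x in E) test_seq j x - ratr (nth 0%Q i.2 j)|) @^-1`
      `]-oo, (2 * i.1.+1%:R)^-1[%classic); first exact: mI.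
  by rewrite setTI; apply/seteqP; split=> w; rewrite /= in_itv.
rewrite (_ : \bigcup_(i in _) _ = \bigcup_i (if `[< basic i `<=` [set m | r < F m] >]
    then nu @^-1` basic i else set0)); last first.
  apply/seteqP; split=> w [i].
    by move=> /= iF iw; exists i => //; rewrite (asboolT iF).
  by move=> _; case: ifPn => // /asboolP iF iw; exists i.
apply: countable_bigcupT_measurable => [|i]; first exact: countableP.
by case: ifPn.
Qed.

End random_measures.

Section exploration_measurability.
Context {R : realType} d (Omega : measurableType d).
Variables (rho : Omega -> Mf R) (a : Omega -> R) (mu : Mf R) (F : Mf R -> R).
Hypothesis mrho : forall A, measurable A -> measurable_fun setT (fun w => rho w A).
Hypotheses (ma : measurable_fun setT a) (a0 : forall w, 0 <= a w) (cF : continuous F).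

Let measurable_concat_fixed (nu : Mf R) :
  measurable_fun setT (fun w => F (concat nu (rho w))).
Proof.
apply: (measurable_continuous_Mf (nu := fun w => concat nu (rho w))) => // A mA.
apply: emeasurable_funD; first exact: measurable_cst.
apply: mrho; rewrite -[X in measurable X]setTI.
have mshift : measurable_fun setT (fun x : \bar R => height nu + x)%E.
  by apply: emeasurable_funD => //; exact: measurable_cst.
exact: mshift.
Qed.

(* The values a_j = (floor (j a) + 1) / j decrease to a from above, and
   quantiles are left-continuous, so no continuity point is needed. *)
Lemma measurable_concat_erase :
  measurable_fun setT (fun w => F (concat (erase (a w) mu) (rho w))).
Proof.
pose g (j : nat) (i : int) : R := Num.max 0 ((i + 1)%:~R / j.+1%:R).
pose v (j : nat) w : int := Num.floor (j.+1%:R * a w).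
have gP j w : a w <= g j (v j w) <= a w + j.+1%:R^-1.
  have j0 : 0 < j.+1%:R :> R by [].
  rewrite /g max_r; last first.
    by rewrite divr_ge0// ler0z addr_ge0// floor_ge0 mulr_ge0// ltW.
  apply/andP; split.
    by rewrite ler_pdivlMr// mulrC ltW// floorD1_gt.
  by rewrite ler_pdivrMr// mulrDl mulVf ?gt_eqF// intrD lerD2r mulrC floor_le_tmp.
have acv w : g j (v j w) @[j --> \oo] --> a w.
  apply: (@squeeze_cvgr _ _ _ _ (fun=> a w) (fun j => a w + j.+1%:R^-1)).
  - by apply: nearW => j; exact: gP.
  - exact: cvg_cst.
  - rewrite -[X in _ --> X]addr0; apply: cvgD; [exact: cvg_cst|exact: cvg_harmonic].
apply: (@measurable_fun_cvg _ _ _ setT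
  (fun j w => F (concat (erase (g j (v j w)) mu) (rho w)))).
- move=> j; apply: (@measurable_countable_family _ _ _ int (v j)
    (fun i w => F (concat (erase (g j i) mu) (rho w)))).
  + move=> i; have mja : measurable_fun setT (fun w => j.+1%:R * a w).
      exact: measurable_funM.
    rewrite [X in measurable X](_ : _ = setT `&` (fun w => j.+1%:R * a w) @^-1`
      `[i%:~R, (i + 1)%:~R[%classic); first exact: mja.
    rewrite setTI; apply/seteqP; split=> w /=; rewrite in_itv/= /v.
      by move=> <-; exact: floor_itv.
    exact: floor_def.
  + by move=> i; exact: measurable_concat_fixed.
- move=> w _; apply: (@cvg_comp _ _ _ (fun j => concat (erase (g j (v j w)) mu) (rho w)) F);
    last exact: cF.
  apply: concat_erase_cvg => //.
  + by move=> j; rewrite le_max lexx.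
  + exact: cvg_cst.
  + apply: quantile_cvg_left.
      by move=> j; rewrite lerB//; have /andP[] := gP j w.
    by apply: cvgB; [exact: cvg_cst|exact: acv].
Qed.

End exploration_measurability.

(** * Cadlag paths *)

Section paths.
Context {R : realType}.
Implicit Types x : R -> R.

Lemma dyadic_between (s u v : R) (m : nat) : 0 < s -> 0 <= u -> u < v -> v <= s ->
  exists n k, [/\ (m <= n)%N, (0 < k)%N, (k <= 2 ^ n)%N &
    u < s * (k%:R / 2 ^+ n) < v].
Proof.
move=> s0 u0 uv vs.
have vu0 : 0 < v - u by rewrite subr_gt0.
have [n mn sn] : exists2 n, (m <= n)%N & s / 2 ^+ n < v - u.
  have [n0 /= n0P] : exists n : nat, s / (v - u) < n%:R.
    by eexists; apply: archi_boundP; rewrite divr_ge0// ltW.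
  exists (maxn m n0); first exact: leq_maxl.
  rewrite ltr_pdivrMr ?exprn_gt0// mulrC -ltr_pdivrMr// (lt_le_trans n0P)//.
  rewrite -natrX ler_nat (leq_trans (leq_maxr m n0))//.
  by rewrite ltnW// ltn_expl.
have p0 : 0 < 2 ^+ n :> R by rewrite exprn_gt0.
have y0 : 0 <= u / s * 2 ^+ n by rewrite mulr_ge0 ?(ltW p0)// divr_ge0// ltW.
pose k := (Num.truncn (u / s * 2 ^+ n)).+1.
have /andP[k1 k2] := truncn_itv y0; rewrite -/k in k2.
have uk : u < s * (k%:R / 2 ^+ n).
  by rewrite mulrC -ltr_pdivrMr// ltr_pdivlMr.
have kv : s * (k%:R / 2 ^+ n) < v.
  have : s * (k%:R / 2 ^+ n) <= u + s / 2 ^+ n.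
    rewrite /k -natr1 mulrDl mul1r mulrDr lerD2r.
    by rewrite mulrA ler_pdivrMr//; move: k1; rewrite mulrAC ler_pdivlMr// mulrC.
  by move/le_lt_trans; apply; rewrite -ltrBrDl.
exists n, k; split => //; last by rewrite uk.
have : s * (k%:R / 2 ^+ n) < s * 1 by rewrite mulr1 (lt_le_trans kv).
by rewrite ltr_pM2l// ltr_pdivrMr// mul1r -natrX ltr_nat => /ltnW.
Qed.

Lemma cadlag_right x t e : cadlag x -> 0 <= t -> 0 < e ->
  exists2 v, t < v & forall r, t <= r -> r < v -> `|x t - x r| < e.
Proof.
move=> [xr _] t0 e0; have /cvgrPdist_lt/(_ e e0) := xr t t0.
rewrite near_withinE => /nbhs_ballP[v /= v0 vP].
exists (t + v); first by rewrite ltrDl.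
move=> r; rewrite le_eqVlt => /predU1P[<- _|tr rv]; first by rewrite subrr normr0.
by apply: vP => //; rewrite /ball /= ltr0_norm ?subr_lt0// opprB ltrBlDl.
Qed.

Lemma cadlag_left x t e : cadlag x -> 0 < t -> 0 < e ->
  exists2 v, v < t & forall r, v < r -> r < t -> `|left_lim x t - x r| < e.
Proof.
move=> [_ xl] t0 e0; have /cvgrPdist_lt/(_ e e0) := xl t t0.
rewrite near_withinE => /nbhs_ballP[v /= v0 vP].
exists (t - v); first by rewrite gtrBl.
move=> r vr rt.
by apply: vP => //; rewrite /ball /= gtr0_norm ?subr_gt0// ltrBlDl -ltrBlDr.
Qed.

(** Around each r the path is bounded below by x r - 1 on the right and by its left limit minus 1 on
    the left; compactness of [0, t] concludes. This makes [path_inf] the infimum of a set bounded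
    below, which the real-valued [inf] requires to be meaningful. *)
Lemma cadlag_lbounded x t : cadlag x -> exists M, forall r, 0 <= r <= t -> M <= x r.
Proof.
move=> cx.
have /compact_near_coveringP/(_ R +oo (fun M r => 0 <= r -> - M <= x r)) :=
  @segment_compact R 0 t.
case=> [r /=|M [_ MP]]; last first.
  exists (- (M + 1)) => r rt; apply: (MP (M + 1)); first by rewrite ltrDl.
    by rewrite /= in_itv.
  by case/andP: rt.
rewrite in_itv/= => /andP[r0 rt].
have [v rv vP] := cadlag_right cx r0 ltr01.
have [v' v'r v'P] : exists2 v', v' < r & forall q, 0 <= q -> v' < q -> q < r ->
    left_lim x r - 1 <= x q.
  move: r0; rewrite le_eqVlt => /predU1P[<-|r0].
    exists (-1) => // q q0 _ /(le_lt_trans q0); rewrite ltxx//.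
  have [v' v'r v'P] := cadlag_left cx r0 ltr01.
  exists v' => // q _ vq qr; have := v'P q vq qr.
  by rewrite ltr_distlC => /andP[/ltW].
exists ([set q | v' < q < v], [set M | Num.max `|x r - 1| `|left_lim x r - 1| < M]).
  split => /=; last first.
    by exists (Num.max `|x r - 1| `|left_lim x r - 1|); split => //; exact: num_real.
  have := @near_in_itvoo R v' v r; apply; by rewrite in_itv/= v'r.
move=> [q M] /= [/andP[v'q qv]]; rewrite gt_max => /andP[M1 M2] q0.
have [rq|qr] := leP r q.
  have := vP q rq qv; rewrite ltr_distlC => /andP[/ltW h _].
  by apply: le_trans h; rewrite lerNl (le_trans _ (ltW M1))// -normrN ler_norm.
apply: le_trans (v'P q q0 v'q qr); rewrite lerNl (le_trans _ (ltW M2))//.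
by rewrite -normrN ler_norm.
Qed.

Lemma path_inf_geP x (s t c : R) : cadlag x -> 0 <= s <= t ->
  c <= path_inf x s t <-> forall r, s <= r <= t -> c <= x r.
Proof.
move=> cx /andP[s0 st]; have [M MP] := cadlag_lbounded t cx.
have lb : has_lbound [set x r | r in `[s, t]].
  exists M => _ [r /= + <-]; rewrite in_itv/= => /andP[sr rt].
  by rewrite MP// (le_trans s0 sr).
split=> [cI r rst|h].
  by apply: (le_trans cI); apply: inf_lbound => //; exists r; rewrite //= in_itv.
apply: lb_le_inf; first by exists (x s), s; rewrite //= in_itv/= lexx.
by move=> _ [r /= + <-]; rewrite in_itv/= => rst; exact: h.
Qed.

Lemma path_inf_le x (s t r : R) : cadlag x -> 0 <= s -> s <= r <= t ->
  path_inf x s t <= x r.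
Proof.
move=> cx s0 /andP[sr rt].
have h : 0 <= s <= t by rewrite s0 (le_trans sr).
by have /(path_inf_geP _ cx h) := lexx (path_inf x s t); apply; rewrite sr.
Qed.

(** If x r < c with r < t, right continuity gives an interval to the right of r where x stays below
    c, and it contains a grid point; t itself is the last grid point. *)
Lemma path_ge_dyadic x (s t c : R) : cadlag x -> 0 <= s <= t ->
  (forall n k, (k <= 2 ^ n)%N -> c <= x (s + (t - s) * (k%:R / 2 ^+ n))) ->
  forall r, s <= r <= t -> c <= x r.
Proof.
move=> cx /andP[s0 st] h r /andP[sr rt].
move: rt; rewrite le_eqVlt => /predU1P[->|rt].
  by have := h 0%N 1%N isT; rewrite expr0 divr1 mulr1 subrKC.
rewrite leNgt; apply/negP => xc.
have e0 : 0 < c - x r by rewrite subr_gt0.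
have [v rv vP] := cadlag_right cx (le_trans s0 sr) e0.
have [||||n [k [_ _ kn /andP[k1 k2]]]] := @dyadic_between (t - s) (r - s) (Num.min v t - s) 0.
- by rewrite subr_gt0 (le_lt_trans sr).
- by rewrite subr_ge0.
- by rewrite ltrD2r lt_min rv.
- by rewrite lerD2r ge_min lexx orbT.
set q := s + (t - s) * (k%:R / 2 ^+ n).
have rq : r < q by rewrite -ltrBlDl.
have qv : q < v by move: k2; rewrite ltrBrDl lt_min => /andP[].
have := vP q (ltW rq) qv; rewrite ltr_distlC => /andP[_].
by rewrite addrC subrK ltNge h.
Qed.

(** The first j in 1, ..., k with S j < 0, capped at k; index 0 is not tested. The recursion is on
    the cap, as required by the induction for optional stopping. *)
Fixpoint stop_index (S : nat -> R) (k : nat) : nat :=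
  if k is k'.+1 then
    if all (fun j => 0 <= S j) (iota 1 k') then k'.+1 else stop_index S k'
  else 0%N.

Lemma stop_index_le S k : (stop_index S k <= k)%N.
Proof. by elim: k => //= k IHk; case: ifP => // _; exact: leqW. Qed.

Lemma stop_index_all S k : all (fun j => 0 <= S j) (iota 1 k.-1) ->
  stop_index S k = k.
Proof. by case: k => //= k ->. Qed.

Lemma stop_index_gt0 S k : (0 < k)%N -> (0 < stop_index S k)%N.
Proof.
elim: k => // k IHk _ /=; case: ifP => // h.
by case: k IHk h => // k IHk _; exact: IHk.
Qed.

Lemma stop_index_ge0 S k j : (0 < j < stop_index S k)%N -> 0 <= S j.
Proof.
elim: k => [|k IHk] /=; first by rewrite ltn0 andbF.
case: ifP => [/allP h|_ /IHk//] jk.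
by apply: h; rewrite mem_iota add1n.
Qed.

Lemma stop_index_lt0 S k : (stop_index S k < k)%N -> S (stop_index S k) < 0.
Proof.
elim: k => // k IHk /=; case: ifPn => [|/allPn[j]]; first by rewrite ltnn.
rewrite mem_iota add1n ltnS => /andP[j0 jk] Sj _.
have := stop_index_le S k; rewrite leq_eqVlt => /predU1P[kE|]; last exact: IHk.
rewrite kE ltNge; apply/negP => Sk; move: Sj; apply/negP; rewrite negbK.
move: jk; rewrite leq_eqVlt => /predU1P[->//|jk].
by apply: (@stop_index_ge0 S k); rewrite kE j0.
Qed.

Definition stop_time (y : R -> R) (s : R) (n : nat) : R :=
  s * ((stop_index (fun k => y (s * (k%:R / 2 ^+ n))) (2 ^ n))%:R / 2 ^+ n).

Lemma stop_time_itv y s n : 0 < s -> 0 < stop_time y s n <= s.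
Proof.
move=> s0; have p0 : 0 < 2 ^+ n :> R by rewrite exprn_gt0.
apply/andP; split.
  by rewrite mulr_gt0// divr_gt0// ltr0n stop_index_gt0// expn_gt0.
by rewrite ler_piMr ?(ltW s0)// ler_pdivrMr// mul1r -natrX ler_nat stop_index_le.
Qed.

Lemma stop_time_before y s n m k : 0 < s -> (n <= m)%N -> (0 < k)%N -> (k <= 2 ^ n)%N ->
  s * (k%:R / 2 ^+ n) < stop_time y s m -> 0 <= y (s * (k%:R / 2 ^+ n)).
Proof.
move=> s0 nm k0 kn.
have -> : k%:R / 2 ^+ n = (k * 2 ^ (m - n))%:R / 2 ^+ m :> R.
  by rewrite natrM natrX -{2}(subnKC nm) exprD -mulf_div divff ?mulr1.
rewrite /stop_time ltr_pM2l// ltr_pM2r ?invr_gt0 ?exprn_gt0// ltr_nat => h.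
apply: (@stop_index_ge0 (fun k => y (s * (k%:R / 2 ^+ m))) (2 ^ m)).
by rewrite h andbT muln_gt0 k0 expn_gt0.
Qed.

(** A finer grid can only detect a negative value earlier. *)
Lemma stop_time_noninc y s n m : 0 < s -> (n <= m)%N ->
  stop_time y s m <= stop_time y s n.
Proof.
move=> s0 nm; have := stop_index_le (fun k => y (s * (k%:R / 2 ^+ n))) (2 ^ n).
rewrite leq_eqVlt => /predU1P[h|h].
  have /andP[_ /le_trans] := stop_time_itv y m s0; apply.
  by rewrite [leRHS]/stop_time h natrX divff ?mulr1.
rewrite leNgt; apply/negP => lt_nm.
have := stop_index_lt0 h; apply/negP; rewrite -leNgt.
apply: (stop_time_before s0 nm _ _ lt_nm); last exact: ltnW.
by rewrite stop_index_gt0// expn_gt0.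
Qed.

(* The stopping times decrease to some T; on [0, T) the path is nonnegative
   on the dyadic grid, so its value at T is nonnegative too when it cannot
   jump downwards, and right continuity does the rest. *)
Lemma stop_time_ge y s e : cadlag y -> (forall t, 0 < t -> left_lim y t <= y t) ->
  y 0 = 0 -> 0 < s -> 0 < e ->
  exists n0, forall n, (n0 <= n)%N -> - e < y (stop_time y s n).
Proof.
move=> cy jy y0 s0 e0.
pose S := range (stop_time y s); pose T := inf S.
have S0 : S !=set0 by exists (stop_time y s 0); exists 0%N.
have Slb : has_lbound S.
  by exists 0 => _ [n _ <-]; have /andP[/ltW] := stop_time_itv y n s0.
have TS n : T <= stop_time y s n by apply: inf_lbound => //; exists n.
have T0 : 0 <= T.
  by apply: lb_le_inf => // _ [n _ <-]; have /andP[/ltW] := stop_time_itv y n s0.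
have Ts : T <= s by apply: (le_trans (TS 0%N)); have /andP[] := stop_time_itv y 0 s0.
have yT : 0 <= y T.
  move: T0; rewrite le_eqVlt => /predU1P[<-|T0]; first by rewrite y0.
  apply: le_trans (jy _ T0); rewrite leNgt; apply/negP => lT.
  have e1 : 0 < - left_lim y T by rewrite oppr_gt0.
  have [v vT vP] := cadlag_left cy T0 e1.
  have [||||n [k [_ k0 kn /andP[k1 k2]]]] := @dyadic_between s (Num.max v 0) T 0 => //.
  - by rewrite le_max lexx orbT.
  - by rewrite gt_max vT.
  have := stop_time_before s0 (leqnn n) k0 kn (lt_le_trans k2 (TS n)).
  move: k1; rewrite gt_max => /andP[/vP/(_ k2) + _].
  by rewrite ltr_distlC subrr => /andP[_ h]; rewrite leNgt h.
have [v Tv vP] := cadlag_right cy T0 e0.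
have [_ [n0 _ <-] n0v] : exists2 t, S t & t < v by exact: inf_lt.
exists n0 => n nn; have := vP _ (TS n) (le_lt_trans (stop_time_noninc y s0 nn) n0v).
by rewrite ltr_distlC => /andP[+ _]; apply: le_lt_trans; rewrite -[leLHS]add0r lerD2r.
Qed.

Lemma cadlag_drift (y : R -> R) (b : R) : cadlag y -> cadlag (fun t => y t - b * t).
Proof.
have cb t : b * r @[r --> t] --> b * t by apply: cvgMr.
move=> [cr cl]; split => t t0.
  apply: cvgB; first exact: cr.
  by apply: cvg_trans (cb t); apply: cvg_app; exact: cvg_within.
apply: is_cvgB; first exact: cl.
apply: cvgP; apply: cvg_trans (cb t); apply: cvg_app; exact: cvg_within.
Qed.

Lemma left_lim_drift (y : R -> R) (b t : R) : cadlag y -> 0 < t ->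
  left_lim (fun t => y t - b * t) t = left_lim y t - b * t.
Proof.
move=> [_ cl] t0; apply: cvg_lim => //; apply: cvgB; first exact: cl.
have cb : b * r @[r --> t] --> b * t by apply: cvgMr.
by apply: cvg_trans cb; apply: cvg_app; exact: cvg_within.
Qed.

End paths.

(** * Independence and optional stopping *)

Section independence.
Context {R : realType} d (Omega : measurableType d) (P : probability Omega R).
Local Open Scope ereal_scope.

Definition indep_rv (U V : Omega -> R) := forall B C : set R,
  measurable B -> measurable C ->
  P (U @^-1` B `&` V @^-1` C) = P (U @^-1` B) * P (V @^-1` C).

Lemma indep_rv_sym (U V : Omega -> R) : indep_rv U V -> indep_rv V U.
Proof. by move=> UV B C mB mC; rewrite setIC UV// muleC. Qed.

(** Both A |-> P (A [&] C) and A |-> P A * P C are finite measures, and they agree on the pi-system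
    G. *)
Let indep_generated (G : set (set Omega)) (C : set Omega) :
  setI_closed G -> G setT -> (forall A, G A -> measurable A) -> measurable C ->
  (forall A, G A -> P (A `&` C) = P A * P C) ->
  forall A, <<s G >> A -> P (A `&` C) = P A * P C.
Proof.
move=> GI GT Gm mC GC A sA.
(* The identity, read as a map to Omega with the sigma-algebra generated by G; the two measures are
   transported along it. *)
pose idG : Omega -> g_sigma_algebraType G := id.
have mid : measurable_fun setT idG.
  move=> _ B sB; rewrite setTI preimage_id.
  by move: B sB; apply: smallest_sub => //; exact: sigma_algebra_measurable.
have PC0 : (0 <= fine (P C))%R by apply: fine_ge0.
have PCf : (fine (P C))%:E = P C by rewrite fineK// fin_num_measure.
pose m1 : {measure set (g_sigma_algebraType G) -> \bar R} :=
  pushforward (mrestr P mC) idG.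
pose m2 : {measure set (g_sigma_algebraType G) -> \bar R} :=
  pushforward (mscale (NngNum PC0) P) idG.
have : m1 mid A = m2 mid A.
  apply: (@measure_unique _ _ (g_sigma_algebraType G) G (fun=> setT)) => //.
  - by rewrite bigcup_const.
  - move=> B GB; rewrite /m1 /m2 /= /pushforward /= /mrestr /mscale /= PCf muleC.
    exact: GC.
  - move=> _; rewrite /m1 /= /pushforward /= /mrestr /= setTI.
    by rewrite (le_lt_trans (probability_le1 _ _))// ltry.
by rewrite /m1 /m2 /= /pushforward /= /mrestr /mscale /= PCf muleC.
Qed.

Lemma indep_rv_generated (G1 G2 : set (set Omega)) (U V : Omega -> R) :
  setI_closed G1 -> G1 setT -> (forall A, G1 A -> measurable A) ->
  setI_closed G2 -> G2 setT -> (forall A, G2 A -> measurable A) ->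
  (forall A C, G1 A -> G2 C -> P (A `&` C) = P A * P C) ->
  measurable_fun (setT : set (g_sigma_algebraType G1)) U ->
  measurable_fun (setT : set (g_sigma_algebraType G2)) V ->
  indep_rv U V.
Proof.
move=> I1 T1 m1 I2 T2 m2 G12 mU mV B C mB mC.
have sG2 A : <<s G2 >> A -> measurable A.
  by move: A; apply: smallest_sub => //; exact: sigma_algebra_measurable.
have sU : <<s G1 >> (U @^-1` B) by have := mU measurableT _ mB; rewrite setTI.
have sV : <<s G2 >> (V @^-1` C) by have := mV measurableT _ mC; rewrite setTI.
apply: (indep_generated I1 T1 m1 (sG2 _ sV) _ sU) => A GA.
rewrite setIC muleC; apply: (indep_generated I2 T2 m2 (m1 _ GA) _ sV) => A' GA'.
by rewrite setIC muleC G12.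
Qed.

Lemma indep_rv_integral (U V : Omega -> R) (f : R * R -> \bar R) :
  measurable_fun setT U -> measurable_fun setT V -> indep_rv U V ->
  measurable_fun setT f -> (forall x, 0 <= f x) ->
  \int[P]_w f (U w, V w) = \int[P]_w \int[P]_v f (U w, V v).
Proof.
move=> mU mV UV mf f0.
have mUV : measurable_fun setT (fun w => (U w, V w)) by exact/measurable_fun_pair.
pose mUV' : {measure set (R * R) -> \bar R} := pushforward P (fun w => (U w, V w)).
pose XU : {RV P >-> R} := HB.pack U (@isMeasurableFun.Build _ _ _ _ U mU).
pose XV : {RV P >-> R} := HB.pack V (@isMeasurableFun.Build _ _ _ _ V mV).
have E : forall S, measurable S -> (distribution P XU \x distribution P XV) S = mUV' mUV S.
  apply: product_measure_unique => A B mA mB.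
  by rewrite /mUV' /= /pushforward /=; exact: UV.
transitivity (\int[mUV' mUV]_x f x).
  by rewrite ge0_integral_pushforward.
transitivity (\int[(distribution P XU \x distribution P XV)%E]_x f x).
  by apply: eq_measure_integral => S mS _; exact/esym/E.
rewrite fubini_tonelli1//= ge0_integral_pushforward//; last 2 first.
- exact: measurable_fun_fubini_tonelli_F.
- by move=> x _; apply: integral_ge0.
apply: eq_integral => w _ /=; rewrite /fubini_F ge0_integral_pushforward//.
exact: measurableT_comp.
Qed.

Lemma indep_rv_expectation (U V : Omega -> R) :
  measurable_fun setT U -> measurable_fun setT V -> indep_rv U V ->
  (forall w, 0 <= U w)%R -> (forall w, 0 <= V w)%R ->
  \int[P]_w (U w * V w)%:E = \int[P]_w (U w)%:E * \int[P]_w (V w)%:E.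
Proof.
move=> mU mV UV U0 V0.
(* The absolute value makes the integrand non-negative on all of R x R, as [indep_rv_integral]
   demands. *)
transitivity (\int[P]_w `|U w * V w|%:E).
  by apply: eq_integral => w _; rewrite ger0_norm// mulr_ge0.
rewrite (indep_rv_integral (f := fun x => `|x.1 * x.2|%:E))//; last first.
  by apply/measurable_EFinP; apply: measurableT_comp => //; exact: measurable_funM.
have mEU : measurable_fun setT (EFin \o U) by exact/measurable_EFinP.
have mEV : measurable_fun setT (EFin \o V) by exact/measurable_EFinP.
rewrite -ge0_integralZr//; last 2 first.
- by move=> w _; rewrite lee_fin.
- by apply: integral_ge0 => w _; rewrite lee_fin.
apply: eq_integral => w _ /=; rewrite -ge0_integralZl//.
- by apply: eq_integral => v _; rewrite ger0_norm// mulr_ge0.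
- by move=> v _; rewrite lee_fin.
- by rewrite lee_fin.
Qed.

Lemma indep_rv_sum (U V : Omega -> R) (B : set R) (z : R) :
  measurable_fun setT U -> measurable_fun setT V -> indep_rv U V -> measurable B ->
  P [set w | B (U w) /\ (U w + V w)%R = z] =
  \int[P]_w ((\1_B (U w))%:E * P [set v | V v = (z - U w)%R]).
Proof.
move=> mU mV UV mB.
pose S : set (R * R) := [set x | B x.1] `&` [set x | (x.1 + x.2)%R = z].
have mS : measurable S.
  apply: measurableI.
    rewrite -[X in measurable X]setTI.
    exact: (@measurable_fst _ _ R R measurableT _ mB).
  rewrite [X in measurable X](_ : _ = setT `&`
      (fun x : R * R => (x.1 + x.2)%R) @^-1` [set z]); last by rewrite setTI.
  by apply: measurable_funD.
transitivity (\int[P]_w (\1_S (U w, V w))%:E).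
  have mP : measurable [set w | B (U w) /\ (U w + V w)%R = z].
    have mUV : measurable_fun setT (fun w => (U w, V w)) by exact/measurable_fun_pair.
    by have := mUV measurableT _ mS; rewrite setTI.
  by rewrite -[X in P X]setIT -integral_indic//; apply: eq_integral => w _; rewrite !indicE.
rewrite (indep_rv_integral (f := fun x => (\1_S x)%:E))//; last first.
  by apply/measurable_EFinP; exact: measurable_indic.
apply: eq_integral => w _.
have mV' : measurable [set v | V v = (z - U w)%R].
  by rewrite -[X in measurable X]setTI; exact: (mV measurableT _ (measurable_set1 _)).
rewrite -[X in P X]setIT -integral_indic// -ge0_integralZl//; last first.
  by apply/measurable_EFinP; exact: measurable_indic.
apply: eq_integral => v _; rewrite -EFinM !indicE; congr (_%:E).
rewrite -natrM mulnb; congr (_%:R); congr nat_of_bool.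
apply/idP/andP; rewrite !inE /S /=.
  by move=> [BU UVz]; split => //; rewrite -UVz addrC addKr.
by move=> [BU ->]; split => //; rewrite subrKC.
Qed.

End independence.

Section past_and_future.
Context {R : realType} d (Omega : measurableType d) (P : probability Omega R).
Local Open Scope ereal_scope.
Variables (D : nat -> Omega -> R) (n : nat).
Hypothesis mD : forall i, measurable_fun setT (D i).
Hypothesis indD : forall B : nat -> set R, (forall i, measurable (B i)) ->
  P (\bigcap_(i < n) (D i @^-1` B i)) = \prod_(i < n) P (D i @^-1` B i).

Definition cylinders (I : set nat) : set (set Omega) :=
  [set A | exists B : nat -> set R, (forall i, measurable (B i)) /\
    A = \bigcap_(i in I) (D i @^-1` B i)].

Let mpre i B : measurable B -> measurable (D i @^-1` B).
Proof. by move=> mB; rewrite -[X in measurable X]setTI; exact: mD. Qed.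

Lemma cylindersI I : setI_closed (cylinders I).
Proof.
move=> _ _ [B [mB ->]] [C [mC ->]]; exists (fun i => B i `&` C i); split.
  by move=> i; exact: measurableI.
by rewrite -bigcapI; apply: eq_bigcapr => i _; rewrite preimage_setI.
Qed.

Lemma cylindersT I : cylinders I setT.
Proof.
exists (fun=> setT); split => //.
by apply/seteqP; split.
Qed.

Lemma measurable_cylinders I A : cylinders I A -> measurable A.
Proof.
move=> [B [mB ->]].
rewrite bigcap_mkcond; apply: bigcapT_measurable => i.
by case: ifPn => // _; exact: mpre.
Qed.

Lemma measurable_cylinders_coord (I : set nat) i : I i ->
  measurable_fun (setT : set (g_sigma_algebraType (cylinders I))) (D i).
Proof.
move=> Ii _ B mB; rewrite setTI; apply: sub_sigma_algebra.
exists (fun j => if j == i then B else setT); split.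
  by move=> j; case: ifP.
apply/seteqP; split=> [w Bw j _ /=|w /(_ i Ii)/=]; last by rewrite eqxx.
by case: eqP => // ->.
Qed.

(** Padding with [setT] turns events before k and events from k on into instances of the product
    formula over all i < n; both families are pi-systems. *)
Lemma indep_rv_past_future k (U V : Omega -> R) : (k <= n)%N ->
  measurable_fun (setT : set (g_sigma_algebraType (cylinders [set i | (i < k)%N]))) U ->
  measurable_fun (setT : set (g_sigma_algebraType (cylinders [set i | (k <= i < n)%N]))) V ->
  indep_rv P U V.
Proof.
move=> kn; apply: indep_rv_generated.
- exact: cylindersI.
- exact: cylindersT.
- exact: measurable_cylinders.
- exact: cylindersI.
- exact: cylindersT.
- exact: measurable_cylinders.
move=> _ _ [B [mB ->]] [C [mC ->]].
pose B' i := if (i < k)%N then B i else setT.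
pose C' i := if (i < k)%N then setT else C i.
have mB' i : measurable (B' i) by rewrite /B'; case: ifP.
have mC' i : measurable (C' i) by rewrite /C'; case: ifP.
have -> : \bigcap_(i in [set i | (i < k)%N]) (D i @^-1` B i) =
    \bigcap_(i < n) (D i @^-1` B' i).
  apply/seteqP; split=> [w h i /= _|w h i /= ik].
    by rewrite /B'; case: ifP => // /h.
  by have := h i (leq_trans ik kn); rewrite /= /B' ik.
have -> : \bigcap_(i in [set i | (k <= i < n)%N]) (D i @^-1` C i) =
    \bigcap_(i < n) (D i @^-1` C' i).
  apply/seteqP; split=> [w h i /= i_n|w h i /= /andP[ki i_n]].
    by rewrite /C'; case: ltnP => // ki; apply: h; rewrite /= ki.
  by have := h i i_n; rewrite /= /C' ltnNge ki.
rewrite -bigcapI; under eq_bigcapr do rewrite -preimage_setI.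
rewrite !indD//; last by move=> i; exact: measurableI.
rewrite -big_split; apply: eq_bigr => i _ /=.
rewrite /B' /C'; case: ltnP => _.
  by rewrite setIT preimage_setT probability_setT mule1.
by rewrite setTI preimage_setT probability_setT mul1e.
Qed.

End past_and_future.

(** * Growth of the Laplace exponent *)

Section laplace_exponent_growth.
Context {R : realType}.

Let g (x : R) : R := expR (- x) - 1 + x.

Let g_ge0 x : 0 <= g x.
Proof. by rewrite /g; have := expR_ge1Dx (- x); lra. Qed.

Let g_lex x : 0 <= x -> g x <= x.
Proof.
move=> x0; rewrite /g gerDr subr_le0 -expR0 ler_expR.
by rewrite oppr_le0.
Qed.

Let g_lesq x : 0 <= x -> g x <= x ^+ 2.
Proof.
move=> x0; have x1 : 0 < 1 + x by rewrite ltr_pwDl.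
have h : expR (- x) * (1 + x) <= 1.
  have := ler_wpM2l (expR_ge0 (- x)) (expR_ge1Dx x).
  by rewrite [leRHS]mulrC expRxMexpNx_1.
have e : expR (- x) <= 1 - x + x ^+ 2.
  rewrite -(ler_pM2r x1) (le_trans h)//.
  have -> : (1 - x + x ^+ 2) * (1 + x) = 1 + x ^+ 3 by ring.
  by rewrite lerDl exprn_ge0.
by rewrite /g; lra.
Qed.

Let g_ge x : 2 <= x -> x / 2 <= g x.
Proof. by move=> x2; rewrite /g; have := expR_gt0 (- x); lra. Qed.

(** As g x >= x / 2 for x >= 2, the integral in psi lam is at least lam / 2 times the integral of l
    over [2 / lam, 1[, which is unbounded in lam by infinite variation. The level 2 (|b| + 1) for
    the latter leaves (|b| + 1) lam, which beats - b lam. *)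
Lemma psi_drift_gt0 (alpha0 b : R) (Pi : {sigma_finite_measure set R -> \bar R}) :
  0 <= alpha0 -> jump_measure Pi ->
  exists2 lam, 0 < lam & 0 < psi alpha0 Pi lam + b * lam.
Proof.
move=> a0 [_ Pmom Pvar].
have mp : measurable (`]0%R, +oo[%classic : set R) by exact: measurable_itv.
have m1 : measurable (`]0%R, 1%R[%classic : set R) by exact: measurable_itv.
pose f n (l : R) : \bar R := ((l%:E) * (\1_(`[2 / n.+1%:R, +oo[%classic) l)%:E)%E.
have f0 n l : 0 < l -> (0 <= f n l)%E.
  by move=> l0; rewrite /f -EFinM lee_fin mulr_ge0// ltW.
have mf n (D : set R) : measurable_fun D (f n).
  apply/measurable_EFinP/measurable_funM; first exact: measurable_id.
  exact: measurable_indic.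
have cvf : (\int[Pi]_(l in `]0%R, 1%R[) f n l @[n --> \oo] --> +oo)%E.
  rewrite -Pvar.
  rewrite (_ : \int[Pi]_(l in _) _ = \int[Pi]_(l in `]0%R, 1%R[) limn (f ^~ l))%E.
    apply: cvg_monotone_convergence => //.
    - by move=> n l /=; rewrite in_itv/= => /andP[l0 _]; exact: f0.
    - move=> l /=; rewrite in_itv/= => /andP[l0 _] m n mn.
      rewrite /f -!EFinM lee_fin; apply: ler_wpM2l; first exact: ltW.
      rewrite !indicE ler_nat.
      case: (boolP (l \in `[2 / m.+1%:R, +oo[%classic)) => //; rewrite inE/= in_itv/= andbT => ml.
      rewrite mem_set//= in_itv/= andbT (le_trans _ ml)//.
      by rewrite ler_pM2l// lef_pV2 ?posrE// ler_nat ltnS.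
  apply: eq_integral => l; rewrite inE/= in_itv/= => /andP[l0 _].
  apply/esym/cvg_lim => //; apply: cvg_near_cst.
  have [N _ NP] : \forall n \near \oo, 2 / l <= n%:R by exact: nbhs_infty_ger.
  exists N => // n /= Nn; rewrite /f indicE mem_set ?mule1//= in_itv/= andbT.
  rewrite ler_pdivrMr// mulrC -ler_pdivrMr//.
  by rewrite (le_trans (NP n Nn))// ler_nat.
have [n nP] : exists n, ((2 * (`|b| + 1))%:E <= \int[Pi]_(l in `]0%R, 1%R[) f n l)%E.
  have /cvgeyPge/(_ (2 * (`|b| + 1)))[n _ nP] := cvf.
  by exists n; exact: (nP n (leqnn n)).
pose lam : R := n.+1%:R; have lam1 : 1 <= lam by rewrite /lam ler1n.
have lam0 : 0 < lam by rewrite (lt_le_trans ltr01).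
exists lam => //.
have mg D : measurable_fun D (fun l : R => (g (lam * l))%:E).
  apply/measurable_EFinP; rewrite /g; apply: measurable_funD; last exact: measurable_funM.
  apply: measurable_funB => //; apply: measurableT_comp; first exact: measurable_expR.
  by apply: measurableT_comp => //; exact: measurable_funM.
(* Were this integral infinite, the real-valued integral in [psi] would take the default value 0.
   The bound lam ^ 2 min l (l ^ 2) uses lam >= 1. *)
have gfin : (\int[Pi]_(l in `]0%R, +oo[) (g (lam * l))%:E < +oo)%E.
  apply: (@le_lt_trans _ _
    (\int[Pi]_(l in `]0%R, +oo[) ((lam ^+ 2)%:E * (Num.min l (l ^+ 2))%:E))%E).
    apply: ge0_le_integral => //.
    - by move=> l _; rewrite lee_fin g_ge0.
    - apply/measurable_EFinP/measurable_funM => //.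
      apply: measurable_minr => //; exact: measurable_funX.
    - move=> l /=; rewrite in_itv/= andbT => l0; rewrite -EFinM lee_fin.
      have ll : 0 <= lam * l by rewrite mulr_ge0// ltW.
      rewrite /Num.min; case: ifPn => _.
        rewrite (le_trans (g_lex ll))//; apply: ler_wpM2r; first exact: ltW.
        by rewrite expr2 ler_peMl// ltW.
      by rewrite (le_trans (g_lesq ll))// exprMn.
  rewrite ge0_integralZl//.
  - by rewrite lte_mul_pinfty// lee_fin exprn_ge0// ltW.
  - by apply/measurable_EFinP; apply: measurable_minr => //; exact: measurable_funX.
  - move=> l /=; rewrite in_itv/= andbT => l0.
    by rewrite lee_fin le_min exprn_ge0 ltW.
  - by rewrite lee_fin exprn_ge0// ltW.
have gge : (((lam / 2) * (2 * (`|b| + 1)))%:E <= \int[Pi]_(l in `]0%R, +oo[) (g (lam * l))%:E)%E.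
  apply: (@le_trans _ _ (\int[Pi]_(l in `]0%R, 1%R[) ((lam / 2)%:E * f n l))%E).
    rewrite ge0_integralZl//; last 2 first.
    - by move=> l /=; rewrite in_itv/= => /andP[l0 _]; exact: f0.
    - by rewrite lee_fin divr_ge0// ltW.
    by rewrite EFinM lee_wpmul2l// lee_fin divr_ge0// ltW.
  apply: (@le_trans _ _ (\int[Pi]_(l in `]0%R, 1%R[) (g (lam * l))%:E)%E).
    apply: ge0_le_integral => //.
    - move=> l /=; rewrite in_itv/= => /andP[l0 _].
      by rewrite mule_ge0 ?f0// lee_fin divr_ge0// ltW.
    - by apply: measurable_funeM; exact: mf.
    - move=> l /=; rewrite in_itv/= => /andP[l0 _]; rewrite /f -!EFinM lee_fin indicE.
      case: (boolP (_ \in _)) => [|_]; last by rewrite mulr0 mulr0.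
      rewrite inE/= in_itv/= andbT ler_pdivrMr// mulrC -/lam => /g_ge.
      by apply: le_trans; rewrite mulr1 mulrAC mulrC lexx.
  apply: ge0_subset_integral => //.
  - by move=> l _; rewrite lee_fin g_ge0.
  - by move=> l /=; rewrite !in_itv/= andbT => /andP[].
have psiE : (psi alpha0 Pi lam - alpha0 * lam)%:E =
    (\int[Pi]_(l in `]0%R, +oo[) (g (lam * l))%:E)%E.
  rewrite /psi addrC addKr /Rintegral fineK// ge0_fin_numE//.
  by apply: integral_ge0 => l _; rewrite lee_fin g_ge0.
move: gge; rewrite -psiE lee_fin.
have al : 0 <= alpha0 * lam by rewrite mulr_ge0// ltW.
have bl : - b * lam <= `|b| * lam.
  by rewrite ler_wpM2r ?(ltW lam0)// -normrN ler_norm.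
have -> : lam / 2 * (2 * (`|b| + 1)) = `|b| * lam + lam by field.
by move: bl al lam0; rewrite mulNr; lra.
Qed.

End laplace_exponent_growth.

(** * Stopped exponentials *)

Section stopped_exponential.
Context {R : realType} d (T : measurableType d).
Variables (S : nat -> T -> R).

Lemma measurable_all_ge0 (r : seq nat) :
  (forall j, j \in r -> measurable_fun setT (S j)) ->
  measurable_fun setT (fun w => all (fun j => 0 <= S j w) r).
Proof.
elim: r => [_|i r IHr mS] /=; first exact: measurable_cst.
apply: measurable_and; last by apply: IHr => j jr; apply: mS; rewrite inE jr orbT.
apply: measurable_fun_ler; first exact: measurable_cst.
by apply: mS; rewrite inE eqxx.
Qed.

Definition stopped_exp (lam kappa : R) (t : nat -> R) (k : nat) (w : T) : R :=
  let tau := stop_index (S ^~ w) k in expR (- (lam * S tau w) - kappa * t tau).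

(** The part of the exponential not yet frozen after step k; it depends on the first k increments
    only. *)
Definition running_exp (lam kappa : R) (t : nat -> R) (k : nat) (w : T) : R :=
  if all (fun j => 0 <= S j w) (iota 1 k) then
    expR (- (lam * S k w) - kappa * t k) else 0.

Lemma stopped_expS lam kappa t k w :
  stopped_exp lam kappa t k.+1 w =
  if all (fun j => 0 <= S j w) (iota 1 k) then
    expR (- (lam * S k.+1 w) - kappa * t k.+1) else stopped_exp lam kappa t k w.
Proof. by rewrite /stopped_exp /=; case: ifP. Qed.

Lemma measurable_exp_val lam c k : measurable_fun setT (S k) ->
  measurable_fun setT (fun w => expR (- (lam * S k w) - c)).
Proof.
move=> mSk; apply: measurableT_comp; first exact: measurable_expR.
apply: measurable_funB => //; apply: measurableT_comp => //.
exact: measurable_funM.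
Qed.

Lemma measurable_stopped_exp lam kappa t k :
  (forall j, measurable_fun setT (S j)) ->
  measurable_fun setT (stopped_exp lam kappa t k).
Proof.
move=> mS; elim: k => [|k IHk].
  exact: (@measurable_exp_val lam (kappa * t 0%N) 0%N (mS 0%N)).
rewrite (_ : stopped_exp lam kappa t k.+1 = fun w => if all (fun j => 0 <= S j w) (iota 1 k) then
    expR (- (lam * S k.+1 w) - kappa * t k.+1) else stopped_exp lam kappa t k w).
  apply: measurable_fun_ifT => //; first exact: measurable_all_ge0.
  exact: (@measurable_exp_val lam (kappa * t k.+1) k.+1 (mS k.+1)).
by apply/funext => w; rewrite stopped_expS.
Qed.

Lemma measurable_running_exp lam kappa t k :
  (forall j, (j <= k)%N -> measurable_fun setT (S j)) ->
  measurable_fun setT (running_exp lam kappa t k).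
Proof.
move=> mS; apply: measurable_fun_ifT => //; last first.
  exact: (@measurable_exp_val lam (kappa * t k) k (mS k (leqnn k))).
apply: measurable_all_ge0 => j; rewrite mem_iota add1n ltnS => /andP[_ jk].
exact: mS.
Qed.

Lemma running_exp_ge0 lam kappa t k w : 0 <= running_exp lam kappa t k w.
Proof. by rewrite /running_exp; case: ifP => // _; exact: expR_ge0. Qed.

(** Together with [stopped_exp_runningS], this writes the stopped exponentials at k and k.+1 with
    the same frozen part, while the running part gets multiplied by a function of the next
    increment. That factor is independent of it and has mean 1, so the expectation is constant in
    k. *)
Lemma stopped_exp_running lam kappa t k w :
  stopped_exp lam kappa t k w = running_exp lam kappa t k w +
    if all (fun j => 0 <= S j w) (iota 1 k) then 0 else stopped_exp lam kappa t k w.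
Proof.
rewrite /running_exp /stopped_exp; case: ifP => [h|_]; last by rewrite add0r.
rewrite addr0 stop_index_all//.
apply/allP => j; rewrite mem_iota add1n => /andP[j0 jk].
by move/allP : h; apply; rewrite mem_iota add1n j0 (leq_trans jk)// ltnS leq_pred.
Qed.

Lemma stopped_exp_runningS lam kappa t k w :
  stopped_exp lam kappa t k.+1 w =
  running_exp lam kappa t k w *
    expR (- (lam * (S k.+1 w - S k w)) - kappa * (t k.+1 - t k)) +
    if all (fun j => 0 <= S j w) (iota 1 k) then 0 else stopped_exp lam kappa t k w.
Proof.
rewrite stopped_expS /running_exp; case: ifP => _; last by rewrite mul0r add0r.
by rewrite addr0 -expRD; congr expR; ring.
Qed.

End stopped_exponential.

Section eq_law.
Context {R : realType} d (Omega : measurableType d) (P : probability Omega R).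

Lemma eq_law_integral (U V : Omega -> R) (g : R -> \bar R) :
  measurable_fun setT U -> measurable_fun setT V ->
  (forall B, measurable B -> P (U @^-1` B) = P (V @^-1` B)) ->
  measurable_fun setT g -> (forall x, 0 <= g x)%E ->
  (\int[P]_w g (U w) = \int[P]_w g (V w))%E.
Proof.
move=> mU mV UV mg g0.
pose pU : {measure set R -> \bar R} := pushforward P U.
pose pV : {measure set R -> \bar R} := pushforward P V.
transitivity (\int[pU mU]_x g x)%E; first by rewrite ge0_integral_pushforward.
transitivity (\int[pV mV]_x g x)%E; last by rewrite ge0_integral_pushforward.
by apply: eq_measure_integral => B mB _; exact: UV.
Qed.

End eq_law.

Section optional_stopping.
Context {R : realType} d (Omega : measurableType d) (P : probability Omega R).
Variables (X : R -> {RV P >-> R}) (f : R -> R).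
Hypotheses (HX : levy_process X) (Hf : laplace_exponent X f).
Variables (b s : R) (n : nat).
Hypothesis s0 : 0 < s.

Let t (k : nat) : R := s * (k%:R / 2 ^+ n).
Let S (k : nat) (w : Omega) : R := X (t k) w - b * t k.
Let D (k : nat) (w : Omega) : R := X (t k.+1) w - X (t k) w.

Let p0 : 0 < 2 ^+ n :> R. Proof. by rewrite exprn_gt0. Qed.

Let t_ge0 k : 0 <= t k.
Proof. by rewrite mulr_ge0 ?(ltW s0)// divr_ge0// ltW. Qed.

Let t0 : t 0%N = 0. Proof. by rewrite /t mul0r mulr0. Qed.

Let h : R := s / 2 ^+ n.

Let h_ge0 : 0 <= h. Proof. by rewrite divr_ge0 ?ltW. Qed.

Let tS k : t k.+1 = t k + h.
Proof. by rewrite /t /h -natr1; field; rewrite gt_eqF. Qed.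

Let mS k : measurable_fun setT (S k).
Proof. by apply: measurable_funB => //; exact: measurable_funPT. Qed.

Let mD k : measurable_fun setT (D k).
Proof. by apply: measurable_funB => //; exact: measurable_funPT. Qed.

Let indD N (B : nat -> set R) : (forall i, measurable (B i)) ->
  (P (\bigcap_(i < N) (D i @^-1` B i)) = \prod_(i < N) P (D i @^-1` B i))%E.
Proof.
move=> mB; apply: (levy_indep HX (t := t)) => // i _.
by rewrite tS lerDl.
Qed.

Let S_sum k w : S k w = \sum_(i < k) D i w - b * t k.
Proof.
rewrite /S; congr (_ - _); elim: k => [|k IHk].
  by rewrite t0 (levy_start HX) big_ord0.
by rewrite big_ord_recr/= -IHk /D addrC subrK.
Qed.

Let indep_running lam kappa k :
  indep_rv P (running_exp S lam kappa t k)
    (fun w => expR (- (lam * (S k.+1 w - S k w)) - kappa * (t k.+1 - t k))).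
Proof.
apply: (indep_rv_past_future mD (@indD k.+1) (leqnSn k)).
  apply: measurable_running_exp => j jk.
  rewrite (_ : S j = fun w => \sum_(i < j) D i w - b * t j); last exact/funext/S_sum.
  apply: measurable_funB => //; apply: measurable_sum => i.
  by apply: measurable_cylinders_coord; rewrite /= (leq_trans (ltn_ord i)).
rewrite (_ : (fun w => _) = fun w =>
    expR (- (lam * (D k w - b * (t k.+1 - t k))) - kappa * (t k.+1 - t k))); last first.
  by apply/funext => w; congr expR; rewrite /S /D; ring.
apply: measurableT_comp; first exact: measurable_expR.
apply: measurable_funB => //; apply: measurableT_comp => //.
apply: measurable_funM => //; apply: measurable_funB => //.
by apply: measurable_cylinders_coord; rewrite /= !leqnn.
Qed.

(** [kappa] is the exponent of the drifted process: exp (- lam (X h - b h)) has mean exp (h (f lam +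
    lam b)). *)
Let increment_exp lam kappa k : 0 <= lam -> kappa = f lam + lam * b ->
  (\int[P]_w (expR (- (lam * (S k.+1 w - S k w)) - kappa * (t k.+1 - t k)))%:E = 1)%E.
Proof.
move=> lam0 ->; have tk : t k.+1 - t k = h by rewrite tS addrC addKr.
have mXh : measurable_fun setT (X h : Omega -> R) by exact: measurable_funPT.
pose g (x : R) : \bar R := (expR (- (lam * x)) * expR (- (h * f lam)))%:E.
have mg : measurable_fun setT g.
  apply/measurable_EFinP/measurable_funM => //.
  apply: measurableT_comp; first exact: measurable_expR.
  by apply: measurableT_comp => //; exact: measurable_funM.
transitivity (\int[P]_w g (D k w))%E.
  apply: eq_integral => w _; rewrite /g -expRD tk; congr (expR _)%:E.
  by rewrite /S tS /D tS; ring.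
rewrite (eq_law_integral (V := X h) _ _ _ mg)//.
- rewrite /g; under eq_integral do rewrite EFinM.
  rewrite ge0_integralZr//; last first.
  + apply/measurable_EFinP; apply: measurableT_comp; first exact: measurable_expR.
    by apply: measurableT_comp => //; exact: measurable_funM.
  have := Hf h_ge0 lam0; rewrite unlock => ->.
  by rewrite -EFinM -expRD subrr expR0.
- move=> B mB; have := levy_stationary HX (t_ge0 k) h_ge0 mB.
  by rewrite -tS.
- by move=> x; rewrite lee_fin mulr_ge0// expR_ge0.
Qed.

Lemma stopped_exp_expectation lam kappa k : 0 <= lam -> kappa = f lam + lam * b ->
  (\int[P]_w (stopped_exp S lam kappa t k w)%:E = 1)%E.
Proof.
move=> lam0 kE.
pose rest k w := if all (fun j => 0 <= S j w) (iota 1 k) then 0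
  else stopped_exp S lam kappa t k w.
have mrest j : measurable_fun setT (fun w => (rest j w)%:E).
  apply/measurable_EFinP/measurable_fun_ifT => //; last exact: measurable_stopped_exp.
  by apply: measurable_all_ge0.
have rest0 j w : (0 <= (rest j w)%:E)%E.
  by rewrite lee_fin /rest; case: ifP => // _; exact: expR_ge0.
have mrun j : measurable_fun setT (running_exp S lam kappa t j) by exact: measurable_running_exp.
have minc j : measurable_fun setT
    (fun w => expR (- (lam * (S j.+1 w - S j w)) - kappa * (t j.+1 - t j))).
  apply: measurableT_comp; first exact: measurable_expR.
  apply: measurable_funB => //; apply: measurableT_comp => //.
  by apply: measurable_funM => //; exact: measurable_funB.
elim: k => [|k IHk].
  rewrite (eq_integral (cst 1%E)) => [|w _].
    by rewrite integral_cst// mul1e; exact: probability_setT.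
  by rewrite /stopped_exp/= t0 /S t0 (levy_start HX) !(mulr0, subr0, oppr0, expR0).
transitivity (\int[P]_w ((running_exp S lam kappa t k w *
    expR (- (lam * (S k.+1 w - S k w)) - kappa * (t k.+1 - t k)))%:E + (rest k w)%:E))%E.
  by apply: eq_integral => w _; rewrite stopped_exp_runningS EFinD.
have mprod : measurable_fun setT (fun w => (running_exp S lam kappa t k w *
    expR (- (lam * (S k.+1 w - S k w)) - kappa * (t k.+1 - t k)))%:E).
  by apply/measurable_EFinP/measurable_funM.
rewrite ge0_integralD//; last first.
  by move=> w _; rewrite lee_fin mulr_ge0 ?expR_ge0// running_exp_ge0.
rewrite indep_rv_expectation//; last by move=> w; exact: running_exp_ge0.
rewrite (increment_exp k lam0 kE) mule1 -IHk.
transitivity (\int[P]_w ((running_exp S lam kappa t k w)%:E + (rest k w)%:E))%E.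
  have mrun' : measurable_fun setT (fun w => (running_exp S lam kappa t k w)%:E).
    exact/measurable_EFinP.
  by rewrite ge0_integralD// => w _; rewrite lee_fin running_exp_ge0.
by apply: eq_integral => w _; rewrite [in RHS]stopped_exp_running EFinD.
Qed.

End optional_stopping.

(** * Paths staying above a line *)

Section above_line.
Context {R : realType} d (Omega : measurableType d) (P : probability Omega R).
Variables (X : R -> {RV P >-> R}) (f : R -> R).
Hypotheses (HX : levy_process X) (Hf : laplace_exponent X f).
Hypothesis Hjump : no_negative_jumps X.

Definition above_line (b s : R) : set Omega := [set w | forall n k, (k <= 2 ^ n)%N ->
  0 <= X (s * (k%:R / 2 ^+ n)) w - b * (s * (k%:R / 2 ^+ n))].

Lemma measurable_above_line b s : measurable (above_line b s).
Proof.
rewrite (_ : above_line b s = \bigcap_n \bigcap_k (if (k <= 2 ^ n)%N then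
    [set w | 0 <= X (s * (k%:R / 2 ^+ n)) w - b * (s * (k%:R / 2 ^+ n))] else setT)).
  apply: bigcapT_measurable => n; apply: bigcapT_measurable => k.
  case: ifP => // _.
  have mS : measurable_fun setT (fun w => X (s * (k%:R / 2 ^+ n)) w - b * (s * (k%:R / 2 ^+ n))).
    by apply: measurable_funB => //; exact: measurable_funPT.
  rewrite [X in measurable X](_ : _ = setT `&` (fun w =>
    X (s * (k%:R / 2 ^+ n)) w - b * (s * (k%:R / 2 ^+ n))) @^-1` `[0, +oo[%classic).
    exact: mS.
  by rewrite setTI; apply/seteqP; split=> w; rewrite /= in_itv/= andbT.
apply/seteqP; split=> [w h n _ k _|w h n k kn]; first by case: ifP => // /h.
by have := h n Logic.I k Logic.I; rewrite kn.
Qed.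

Let P_ae_sub (E_ : nat -> set Omega) : (forall n, measurable (E_ n)) ->
  {ae P, forall w, exists n0, forall n, (n0 <= n)%N -> ~ E_ n w} ->
  fine (P (E_ n)) @[n --> \oo] --> 0.
Proof.
move=> mE aE; apply: fine_cvg.
rewrite -[X in _ --> X](@integral0 _ _ _ P setT).
rewrite (_ : (fun n => P (E_ n)) = fun n => \int[P]_w (\1_(E_ n) w)%:E)%E; last first.
  by apply/funext => n; rewrite integral_indic// setIT.
apply: (@dominated_cvg_ae _ _ _ P _ _ (cst 1%E)).
- by move=> n; apply/measurable_EFinP; exact: measurable_indic.
- exact: measurable_cst.
- apply: filterS aE => w [n0 n0P]; apply: cvg_near_cst; exists n0 => // n /= n0n.
  by rewrite indicE memNset//; exact: n0P.
- exact: (finite_measure_integrable_cst P 1).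
- by apply: aeW => w n; rewrite lee_fin ger0_norm// indicE; case: (_ \in _).
Qed.

(* Stop exp (- lam Y - kap t), with Y t = X t - b t and kap = f lam + lam b > 0,
   when Y first turns negative on the dyadic grid. On the event the stopped value
   is at most exp (- kap s) < 1, elsewhere it is asymptotically at most 1 as Y has
   no negative jumps, and its mean is 1. The exponential with 2 lam bounds the
   second moment, which controls the exceptional sets. *)
Lemma above_line_null b s : 0 < s ->
  (exists2 lam, 0 < lam & 0 < f lam + b * lam) -> P (above_line b s) = 0%E.
Proof.
move=> s0 [lam lam0 kap0]; set A := above_line b s.
pose kap := f lam + lam * b; pose kap2 := f (2 * lam) + (2 * lam) * b.
have {}kap0 : 0 < kap by rewrite /kap (mulrC lam).
pose t n (k : nat) : R := s * (k%:R / 2 ^+ n).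
pose S n (k : nat) (w : Omega) : R := X (t n k) w - b * t n k.
have mS n k : measurable_fun setT (S n k).
  by apply: measurable_funB => //; exact: measurable_funPT.
pose tau n w := stop_index (fun k => S n k w) (2 ^ n).
pose Z n w := stopped_exp (S n) lam kap (t n) (2 ^ n) w.
pose Z2 n w := stopped_exp (S n) (2 * lam) kap2 (t n) (2 ^ n) w.
have ttau n w : 0 < t n (tau n w) <= s.
  exact: (stop_time_itv (fun r => X r w - b * r) n s0).
(* At the stopping time T, Z ^ 2 is Z2 times exp ((kap2 - 2 kap) T), which is at most C since kap >
   0 and T <= s; the sign of kap2 is unknown. *)
pose C := expR (`|kap2| * s); have C0 : 0 < C by exact: expR_gt0.
have ZZ2 n w : Z n w ^+ 2 <= C * Z2 n w.
  rewrite /Z /Z2 /stopped_exp -/(tau n w) /C -expRD -expRM_natl ler_expR.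
  have /andP[T0 Ts] := ttau n w.
  have h1 : 0 <= kap * t n (tau n w) by rewrite mulr_ge0// ltW.
  have h2 : kap2 * t n (tau n w) <= `|kap2| * s.
    by rewrite (le_trans (ler_norm _))// normrM ler_wpM2l// ger0_norm// ltW.
  by move: h1 h2; rewrite -!mulrA; lra.
pose theta := expR (- (kap * s)).
have theta1 : theta < 1 by rewrite /theta -expR0 ltr_expR oppr_lt0 mulr_gt0.
have ZA n w : A w -> Z n w <= theta.
  move=> Aw; have tauE : tau n w = (2 ^ n)%N.
    apply: stop_index_all; apply/allP => j; rewrite mem_iota add1n => /andP[_ jn].
    apply: Aw; rewrite (leq_trans (ltnW jn))// prednK// expn_gt0//.
  rewrite /Z /stopped_exp -/(tau n w) tauE ler_expR -[leRHS]add0r lerD//; last first.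
    by rewrite lerN2 ler_wpM2l ?(ltW kap0)// /t natrX divff ?mulr1// expf_neq0.
  by rewrite oppr_le0 mulr_ge0 ?(ltW lam0)//; exact: Aw.
set p := fine (P A).
have mA : measurable A := measurable_above_line b s.
have PAE : P A = p%:E by rewrite /p fineK// fin_num_measure.
have p0 : 0 <= p by exact: fine_ge0.
have main e : 0 < e -> p * (1 - theta) <= e.
  (* Each of the two errors, dl (1 - p) and eta C, is then at most e / 2. *)
  move=> e0; pose dl := e / 2; pose eta := e / (2 * C).
  have dl0 : 0 < dl by rewrite divr_gt0.
  have eta0 : 0 < eta by rewrite divr_gt0// mulr_gt0.
  pose E_ n := [set w | 1 + dl < Z n w].
  have mZ n : measurable_fun setT (Z n) by exact: measurable_stopped_exp.
  have mZ2 n : measurable_fun setT (Z2 n) by exact: measurable_stopped_exp.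
  have mE n : measurable (E_ n).
    rewrite [X in measurable X](_ : _ = setT `&` Z n @^-1` `]1 + dl, +oo[%classic).
      exact: mZ.
    by rewrite setTI; apply/seteqP; split=> w; rewrite /= in_itv/= andbT.
  have Ecv : fine (P (E_ n)) @[n --> \oo] --> 0.
    apply: P_ae_sub => //; apply: filterS Hjump => w jw.
    have cy := cadlag_drift b (levy_cadlag HX w).
    have jy r : 0 < r -> left_lim (fun r => X r w - b * r) r <= X r w - b * r.
      move=> r0; rewrite left_lim_drift//; last exact: levy_cadlag.
      by rewrite lerD2r jw.
    (* If Y > - ln (1 + dl) / lam at the stopping time, then exp (- lam Y) < 1 + dl. *)
    have e1 : 0 < ln (1 + dl) / lam by rewrite divr_gt0// ln_gt0// ltrDl.
    have [|n0 n0P] := stop_time_ge cy jy _ s0 e1.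
      by rewrite (levy_start HX) mulr0 subr0.
    exists n0 => n /n0P; rewrite /E_ /=.
    rewrite -/(t n (tau n w)) => h; apply/negP; rewrite -leNgt.
    rewrite -[leRHS]lnK ?posrE ?addr_gt0// ler_expR -/(tau n w).
    have /andP[T0 Ts] := ttau n w.
    have kt : 0 <= kap * t n (tau n w) by apply: mulr_ge0; exact: ltW.
    rewrite -[leRHS]subr0 lerB//.
    by rewrite lerNl mulrC -ler_pdivrMr// mulNr ltW.
  (* Pointwise, Z is at most theta on A, at most 1 + dl off A and E_n, and at most eta Z ^ 2 + 1 /
     eta on E_n, whichever side of 1 / eta it lies on. Integrate, using that Z and Z2 have mean
     1. *)
  have bound n : 1 <= theta * p + (1 + dl) * (1 - p) + eta * C + eta^-1 * fine (P (E_ n)).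
    have PEE : P (E_ n) = (fine (P (E_ n)))%:E by rewrite fineK// fin_num_measure.
    have PAC : P (~` A) = (1 - p)%:E by rewrite probability_setC// PAE.
    pose g1 w : \bar R := (theta%:E * (\1_A w)%:E)%E.
    pose g2 w : \bar R := ((1 + dl)%:E * (\1_(~` A) w)%:E)%E.
    pose g3 w : \bar R := ((eta * C)%:E * (Z2 n w)%:E)%E.
    pose g4 w : \bar R := ((eta^-1)%:E * (\1_(E_ n) w)%:E)%E.
    have g10 w : (0 <= g1 w)%E by rewrite mule_ge0 ?lee_fin ?expR_ge0.
    have g20 w : (0 <= g2 w)%E by rewrite mule_ge0 ?lee_fin ?addr_ge0// ltW.
    have etaC0 : 0 <= eta * C by apply: mulr_ge0; exact: ltW.
    have Z20 w : 0 <= Z2 n w by exact: expR_ge0.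
    have g30 w : (0 <= g3 w)%E by rewrite mule_ge0 ?lee_fin.
    have g40 w : (0 <= g4 w)%E by rewrite mule_ge0 ?lee_fin// invr_ge0 ltW.
    have mAC : measurable (~` A) by exact: measurableC.
    have mind B : measurable B -> measurable_fun setT (fun w : Omega => (\1_B w)%:E : \bar R).
      by move=> mB; apply/measurable_EFinP; exact: measurable_indic.
    have mg1 : measurable_fun setT g1 by apply: measurable_funeM; exact: mind.
    have mg2 : measurable_fun setT g2 by apply: measurable_funeM; exact: mind.
    have mEZ2 : measurable_fun setT (fun w => (Z2 n w)%:E : \bar R) by exact/measurable_EFinP.
    have mg3 : measurable_fun setT g3 by apply: measurable_funeM.
    have mg4 : measurable_fun setT g4 by apply: measurable_funeM; exact: mind.
    have i1 : (\int[P]_w g1 w = (theta * p)%:E)%E.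
      rewrite ge0_integralZl//; [|exact: mind|by rewrite lee_fin expR_ge0].
      by rewrite integral_indic// setIT EFinM -PAE.
    have i2 : (\int[P]_w g2 w = ((1 + dl) * (1 - p))%:E)%E.
      rewrite ge0_integralZl//; [|exact: mind|by rewrite lee_fin addr_ge0// ltW].
      by rewrite integral_indic// setIT EFinM -PAC.
    have i3 : (\int[P]_w g3 w = (eta * C)%:E)%E.
      rewrite ge0_integralZl//; [|by move=> w _; rewrite lee_fin].
      rewrite (stopped_exp_expectation HX Hf (b := b) n s0 (2 ^ n)
        (lam := 2 * lam) (kappa := kap2)) ?mule1//.
      by rewrite mulr_ge0// ltW.
    have i4 : (\int[P]_w g4 w = (eta^-1 * fine (P (E_ n)))%:E)%E.
      rewrite ge0_integralZl//; [|exact: mind|by rewrite lee_fin invr_ge0 ltW].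
      by rewrite integral_indic// setIT EFinM -PEE.
    rewrite -lee_fin !EFinD -i1 -i2 -i3 -i4.
    rewrite -(stopped_exp_expectation HX Hf (b := b) n s0 (2 ^ n) (ltW lam0) (kappa := kap))//.
    rewrite -ge0_integralD//.
    have g120 w : (0 <= g1 w + g2 w)%E by rewrite adde_ge0.
    have mg12 : measurable_fun setT (fun w => g1 w + g2 w)%E by exact: emeasurable_funD.
    rewrite -ge0_integralD//.
    have g1230 w : (0 <= g1 w + g2 w + g3 w)%E by rewrite adde_ge0.
    have mg123 : measurable_fun setT (fun w => g1 w + g2 w + g3 w)%E by exact: emeasurable_funD.
    rewrite -ge0_integralD//.
    apply: ge0_le_integral => //.
    - by move=> w _; rewrite lee_fin expR_ge0.
    - by apply/measurable_EFinP; exact: mZ.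
    - exact: emeasurable_funD.
    move=> w _; rewrite -/(Z n w).
    have [Aw|nAw] := pselect (A w).
      apply: (@le_trans _ _ (g1 w)); first by rewrite /g1 indicE mem_set//= mule1 lee_fin ZA.
      by rewrite -!addeA leeDl// !adde_ge0.
    have [Zd|dZ] := leP (Z n w) (1 + dl).
      apply: (@le_trans _ _ (g2 w)); first by rewrite /g2 indicE mem_set//= mule1 lee_fin.
      by rewrite (addeC (g1 w)) -!addeA leeDl// !adde_ge0.
    apply: (@le_trans _ _ (g3 w + g4 w)%E); last by rewrite -addeA leeDr// adde_ge0.
    rewrite /g3 /g4 indicE mem_set//= mule1 -EFinM -EFinD lee_fin.
    apply: (@le_trans _ _ (eta * Z n w ^+ 2 + eta^-1)); last first.
      by rewrite lerD2r -(mulrA eta); apply: ler_wpM2l; [exact: ltW|exact: ZZ2].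
    have Z0 : 0 <= Z n w by exact: expR_ge0.
    have [Ze|eZ] := leP (Z n w) eta^-1.
      by rewrite (le_trans Ze)// lerDr mulr_ge0 ?(ltW eta0)// sqr_ge0.
    rewrite -[leLHS]addr0 lerD// ?invr_ge0 ?(ltW eta0)//.
    have h1 : 1 <= eta * Z n w by rewrite ltW// -ltr_pdivrMl// mulr1.
    by rewrite expr2 mulrA ler_peMl.
  have lim : theta * p + (1 + dl) * (1 - p) + eta * C + eta^-1 * fine (P (E_ n))
      @[n --> \oo] --> theta * p + (1 + dl) * (1 - p) + eta * C + eta^-1 * 0.
    by apply: cvgD; [exact: cvg_cst|apply: cvgMr].
  have : 1 <= theta * p + (1 + dl) * (1 - p) + eta * C + eta^-1 * 0.
    rewrite -(cvg_lim (@Rhausdorff R) lim); apply: limr_ge; first exact: cvgP lim.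
    exact: nearW.
  have -> : eta * C = e / 2 by rewrite /eta; field; rewrite gt_eqF.
  have : p * dl >= 0 by rewrite mulr_ge0// ltW.
  by rewrite /dl mulr0 addr0; lra.
have p00 : p = 0.
  apply/eqP; rewrite eq_le p0 andbT leNgt; apply/negP => pp.
  have th : 0 < p * (1 - theta) by rewrite mulr_gt0// subr_gt0.
  have /main : 0 < p * (1 - theta) / 2 by rewrite divr_gt0.
  by lra.
by rewrite PAE p00.
Qed.

End above_line.

(** * Diffuseness of the marginals *)

Section sum_of_independent.
Context {R : realType} d (Omega : measurableType d) (P : probability Omega R).
Variables (U V : Omega -> R).
Hypotheses (mU : measurable_fun setT U) (mV : measurable_fun setT V).
Hypothesis UV : indep_rv P U V.

Lemma measurable_atom_shift (z : R) :
  measurable_fun setT (fun x : R => P [set v | V v = z - x]).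
Proof.
pose XV : {RV P >-> R} := HB.pack V (@isMeasurableFun.Build _ _ _ _ V mV).
pose S : set (R * R) := [set x | x.1 + x.2 = z].
have mS : measurable S.
  rewrite [X in measurable X](_ : _ = setT `&`
      (fun x : R * R => (x.1 + x.2)%R) @^-1` [set z]); last by rewrite setTI.
  by apply: measurable_funD.
rewrite (_ : (fun x => _) = distribution P XV \o xsection S).
  exact: measurable_fun_xsection.
apply/funext => x; rewrite /= /distribution /pushforward; congr (P _).
apply/seteqP; split=> v /=; rewrite /xsection /= inE /S /=.
  by move=> ->; rewrite subrKC.
by move=> <-; rewrite addrC addKr.
Qed.

(** Conditionally on U = x with x in B, the event has probability at most c. *)
Lemma sum_atom_le (B : set R) (z c : R) : measurable B -> 0 <= c ->
  (forall x, B x -> (P [set v | V v = (z - x)%R] <= c%:E)%E) ->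
  (P [set w | B (U w) /\ (U w + V w)%R = z] <= c%:E * P (U @^-1` B))%E.
Proof.
move=> mB c0 h; rewrite indep_rv_sum//.
have mUB : measurable (U @^-1` B) by rewrite -[X in measurable X]setTI; exact: mU.
have mI : measurable_fun setT (fun w => (\1_B (U w))%:E : \bar R).
  by apply/measurable_EFinP; apply: measurableT_comp => //; exact: measurable_indic.
apply: (@le_trans _ _ (\int[P]_w (c%:E * (\1_(U @^-1` B) w)%:E))%E).
  apply: ge0_le_integral => //.
  - by move=> w _; rewrite mule_ge0// lee_fin.
  - apply: emeasurable_funM => //.
    by apply: (measurableT_comp (measurable_atom_shift z)).
  - by apply: measurable_funeM; apply/measurable_EFinP; exact: measurable_indic.
  move=> w _; rewrite !indicE (_ : (w \in U @^-1` B) = (U w \in B))//.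
  case: (boolP (U w \in B)); rewrite ?mul0e ?mule0// inE => BU.
  by rewrite mul1e mule1 h.
by rewrite ge0_integralZl// integral_indic// setIT.
Qed.

End sum_of_independent.

Section atoms.
Context {R : realType} d (Omega : measurableType d) (P : probability Omega R).
Variables (X : R -> {RV P >-> R}).
Hypotheses (HX : levy_process X).

Definition atom (t x : R) : R := fine (P (X t @^-1` [set x])).

Let mX t : measurable_fun setT (X t : Omega -> R). Proof. exact: measurable_funPT. Qed.

Let mpre t B : measurable B -> measurable (X t @^-1` B).
Proof. by move=> mB; rewrite -[X in measurable X]setTI; exact: mX. Qed.

Lemma atomE t x : P (X t @^-1` [set x]) = (atom t x)%:E.
Proof. by rewrite /atom fineK// fin_num_measure//; exact: mpre. Qed.

Lemma atom_ge0 t x : 0 <= atom t x. Proof. exact: fine_ge0. Qed.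

Lemma atom_le1 t x : atom t x <= 1.
Proof. by rewrite -lee_fin -atomE probability_le1//; exact: mpre. Qed.

Lemma levy_increment_indep s t : 0 <= s -> 0 <= t ->
  indep_rv P (X s) (fun w => X (s + t) w - X s w).
Proof.
move=> s0 t0 B C mB mC.
pose T (i : nat) : R := if i is i'.+1 then if i' is _.+1 then s + t else s else 0.
pose D (i : nat) : set R := if i is 0%N then B else C.
have := levy_indep HX (n := 2) (t := T) (B := D) (lexx 0).
rewrite !big_ord_recl big_ord0 mule1 /=.
have -> : \bigcap_(i < 2) [set w | D i (X (T i.+1) w - X (T i) w)] =
    X s @^-1` B `&` (fun w => X (s + t) w - X s w) @^-1` C.
  apply/seteqP; split=> w.
    move=> h; have := h 0%N isT; have := h 1%N isT; rewrite /= (levy_start HX) subr0.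
    by split.
  by move=> [BX CX] [|[|//]] _ /=; rewrite ?(levy_start HX) ?subr0.
move=> -> //; first last.
- by case.
- by case=> [|[|//]] _ /=; rewrite ?lerDl.
congr (_ * _)%E; congr (P _).
by apply/funext => w; rewrite /= (levy_start HX) subr0.
Qed.

Lemma levy_increment_atom s t x : 0 <= s -> 0 <= t ->
  P [set w | X (s + t) w - X s w = x] = (atom t x)%:E.
Proof.
move=> s0 t0; rewrite -atomE.
exact: (levy_stationary HX s0 t0 (measurable_set1 x)).
Qed.

Let mD s t : measurable_fun setT (fun w => X (s + t) w - X s w).
Proof. exact: measurable_funB. Qed.

Lemma atom_past_le s t (B : set R) (z c : R) : 0 <= s -> 0 <= t -> measurable B -> 0 <= c ->
  (forall x, B x -> atom t (z - x) <= c) ->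
  (P [set w | B (X s w) /\ X (s + t) w = z] <= c%:E * P (X s @^-1` B))%E.
Proof.
move=> s0 t0 mB c0 h.
have := sum_atom_le (mX s) (mD s t) (levy_increment_indep s0 t0) (z := z) mB c0.
under eq_set do rewrite subrKC; apply.
by move=> x Bx; rewrite levy_increment_atom// lee_fin h.
Qed.

Lemma atom_future_le s t (B : set R) (z c : R) : 0 <= s -> 0 <= t -> measurable B -> 0 <= c ->
  (forall x, B x -> atom s (z - x) <= c) ->
  (P [set w | B (X (s + t) w - X s w)%R /\ X (s + t) w = z] <= c%:E)%E.
Proof.
move=> s0 t0 mB c0 h.
have := sum_atom_le (mD s t) (mX s) (indep_rv_sym (levy_increment_indep s0 t0)) (z := z) mB c0.
under eq_set do rewrite subrK; move=> /(_ _)/le_trans; apply.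
  by move=> x Bx; have := atomE s (z - x); rewrite /preimage /= => ->; rewrite lee_fin h.
rewrite -[leRHS]mule1 lee_wpmul2l ?lee_fin// probability_le1//.
by rewrite -[X in measurable X]setTI; exact: mD.
Qed.

(** Adding an independent increment cannot increase the mass of the heaviest atom. *)
Lemma atom_noninc s t c z : 0 <= s -> 0 <= t ->
  (forall y, atom t y <= c) -> atom (s + t) z <= c.
Proof.
move=> s0 t0 h; have c0 : 0 <= c by apply: le_trans (h 0); exact: atom_ge0.
have := @atom_past_le s t setT z c s0 t0 measurableT c0 (fun x _ => h _).
rewrite preimage_setT probability_setT mule1 -lee_fin -atomE.
apply: le_trans; rewrite le_eqVlt; apply/orP; left; apply/eqP; congr (P _).
by apply/seteqP; split=> // w [].
Qed.

Lemma atomM_le s t x y : 0 <= s -> 0 <= t -> atom s x * atom t y <= atom (s + t) (x + y).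
Proof.
move=> s0 t0; rewrite -lee_fin EFinM -!atomE.
have -> : P (X t @^-1` [set y]) = P ((fun w => X (s + t) w - X s w) @^-1` [set y]).
  by rewrite atomE -(levy_increment_atom y s0 t0).
rewrite -levy_increment_indep//; apply: le_measure; rewrite ?inE.
- apply: measurableI; first exact: mpre.
  by rewrite -[X in measurable X]setTI; exact: mD.
- exact: mpre.
- by move=> w /= [<- <-]; rewrite subrKC.
Qed.

(** There are finitely many atoms of mass at least eta: each move to such an atom further right
    takes eta off P (X t >= y), initially at most k eta. The proof is by induction on k. *)
Lemma largest_atom t eta y : 0 < eta -> eta <= atom t y ->
  exists2 M, eta <= atom t M & forall x, M < x -> atom t x < eta.
Proof.
move=> eta0; have [k kP] : exists k : nat, eta^-1 < k%:R.
  by eexists; apply: archi_boundP; rewrite invr_ge0 ltW.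
have m_ge x : measurable [set w | x <= X t w].
  rewrite [X in measurable X](_ : _ = X t @^-1` `[x, +oo[%classic); first exact: mpre.
  by apply/seteqP; split=> w; rewrite /= in_itv/= andbT.
have : (P [set w | (y <= X t w)%R] <= (k%:R * eta)%:E)%E.
  rewrite (le_trans (probability_le1 _ _))// lee_fin -ler_pdivrMr// mul1r ltW//.
elim: k y {kP} => [|k IHk] y Py yeta.
  have : ((atom t y)%:E <= 0)%E.
    move: Py; rewrite mul0r -atomE; apply: le_trans; apply: le_measure; rewrite ?inE//.
    by move=> w /= ->.
  by rewrite lee_fin leNgt (lt_le_trans eta0).
have [h|/existsNP[x /not_implyP[yx /negP]]] := pselect (forall x, y < x -> atom t x < eta).
  by exists y.
rewrite -leNgt => xeta; apply: (IHk x) => //.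
have sub : (P [set w | (x <= X t w)%R] + P (X t @^-1` [set y]) <= P [set w | (y <= X t w)%R])%E.
  rewrite -measureU//.
  - apply: le_measure; rewrite ?inE//; first by apply: measurableU => //; exact: mpre.
    by move=> w [/=|/= ->//]; apply: le_trans; exact: ltW.
  - by apply/seteqP; split=> // w [/= + wy]; rewrite wy leNgt yx.
have := le_trans sub Py; rewrite atomE -leeBrDr// -EFinB => /le_trans; apply.
by rewrite lee_fin -natr1 mulrDl mul1r; lra.
Qed.

End atoms.

Section diffuse.
Context {R : realType} d (Omega : measurableType d) (P : probability Omega R).
Variables (X : R -> {RV P >-> R}).
Hypotheses (HX : levy_process X).
Local Notation atom := (atom X).

Let mX t : measurable_fun setT (X t : Omega -> R). Proof. exact: measurable_funPT. Qed.

Let mpre t B : measurable B -> measurable (X t @^-1` B).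
Proof. by move=> mB; rewrite -[X in measurable X]setTI; exact: mX. Qed.

(** Write p for the masses of the atoms of X t. Conditioning on X t = y or not, the mass of z for X
    (t + t) is at most p (z - y) p y + q (1 - p y). Being above q - eta ^ 2, it forces p y (q - p (z
    - y)) < eta ^ 2, and p y >= eta. *)
Let atom_complement t eta q y z : 0 <= t -> 0 < eta ->
  (forall x, atom t x <= q) -> q - eta ^+ 2 < atom (t + t) z -> eta <= atom t y ->
  q - eta < atom t (z - y).
Proof.
move=> t0 eta0 fq fz fy.
have q0 : 0 <= q by apply: le_trans (fq 0); exact: atom_ge0.
have h : atom (t + t) z <= atom t (z - y) * atom t y + q * (1 - atom t y).
  have h1 := @atom_past_le _ _ _ _ _ HX t t [set y] z (atom t (z - y)) t0 t0
    (measurable_set1 y) (atom_ge0 _ _ _).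
  have h2 := @atom_past_le _ _ _ _ _ HX t t (~` [set y]) z q t0 t0
    (measurableC (measurable_set1 y)) q0 (fun x _ => fq _).
  have PC : P (X t @^-1` (~` [set y])) = (1 - atom t y)%:E.
    by rewrite -preimage_setC probability_setC ?atomE//; exact: mpre.
  rewrite PC in h2; rewrite atomE in h1.
  rewrite -lee_fin EFinD !EFinM -atomE.
  apply: le_trans (leeD (h1 _) h2); last by move=> x ->.
  have m1 : measurable [set w | [set y] (X t w) /\ X (t + t) w = z].
    exact: (measurableI _ _ (mpre t (measurable_set1 y)) (mpre (t + t) (measurable_set1 z))).
  have m2 : measurable [set w | (~` [set y]) (X t w) /\ X (t + t) w = z].
    exact: (measurableI _ _ (mpre t (measurableC (measurable_set1 y)))
      (mpre (t + t) (measurable_set1 z))).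
  rewrite -measureU//.
  - apply: le_measure; rewrite ?inE; [exact: mpre|exact: measurableU|].
    by move=> w /= ww; have [wy|wy] := pselect (X t w = y); [left|right].
  - by apply/seteqP; split=> // w [[wy _] [nwy _]]; exact: nwy.
rewrite ltNge; apply/negP => le1.
have : eta * eta <= atom t y * (q - atom t (z - y)).
  by apply: ler_pM => //; rewrite ?(ltW eta0)//; lra.
by move: fz h; rewrite expr2; lra.
Qed.

(* Here q bounds the atoms of X t. If X (t + t) has an atom z of mass almost q, then
   an atom y of X t forces z - y to be an atom of mass almost q, and conversely. *)
Lemma atom_dichotomy t eta q y z : 0 <= t -> 0 < eta -> eta *+ 2 <= q ->
  (forall x, atom t x <= q) -> q - eta ^+ 2 < atom (t + t) z -> eta <= atom t y ->
  q - eta < atom t y.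
Proof.
move=> t0 eta0 eq fq fz fy.
have h := atom_complement t0 eta0 fq fz fy.
rewrite -[y](subKr z); apply: (atom_complement t0 eta0 fq fz).
by apply: le_trans (ltW h); move: eq; rewrite mulr2n; lra.
Qed.

(* With M the largest point of mass at least eta, M + M is reached essentially only
   by two increments equal to M. *)
Lemma atom_double t eta M : 0 <= t -> 0 < eta ->
  (forall x, M < x -> atom t x < eta) ->
  atom (t + t) (M + M) <= atom t M ^+ 2 + eta *+ 2.
Proof.
move=> t0 eta0 Mmax.
have mlt : measurable (`]-oo, M[%classic : set R) by exact: measurable_itv.
have hB x : `]-oo, M[%classic x -> atom t (M + M - x) <= eta.
  by rewrite /= in_itv/= => xM; rewrite ltW// Mmax//; lra.
have h1 := @atom_past_le _ _ _ _ _ HX t t _ (M + M) eta t0 t0 mlt (ltW eta0) hB.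
have h2 := @atom_future_le _ _ _ _ _ HX t t _ (M + M) eta t0 t0 mlt (ltW eta0) hB.
pose Dl w := X (t + t) w - X t w.
have h3 : (P (X t @^-1` [set M] `&` Dl @^-1` [set M]) =
    (atom t M ^+ 2)%:E)%E.
  rewrite [LHS](levy_increment_indep HX)// expr2 EFinM -atomE; congr (_ * _)%E.
  by rewrite atomE -(levy_increment_atom HX M t0 t0).
have mDt B : measurable B -> measurable (Dl @^-1` B).
  move=> mB; rewrite -[X in measurable X]setTI.
  by apply: (measurable_funB (mX (t + t)) (mX t)).
rewrite -lee_fin EFinD mulr2n EFinD -h3 -atomE.
have h1' : (P [set w | `]-oo, M[%classic (X t w) /\ X (t + t) w = (M + M)%R] <= eta%:E)%E.
  apply: (le_trans h1); rewrite -[leRHS]mule1 lee_wpmul2l ?lee_fin ?(ltW eta0)//.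
  by rewrite probability_le1//; exact: mpre.
have m1 : measurable [set w | `]-oo, M[%classic (X t w) /\ X (t + t) w = (M + M)%R].
  exact: (measurableI _ _ (mpre t mlt) (mpre (t + t) (measurable_set1 (M + M)))).
have m2 : measurable [set w | `]-oo, M[%classic (Dl w) /\ X (t + t) w = (M + M)%R].
  exact: (measurableI _ _ (mDt _ mlt) (mpre (t + t) (measurable_set1 (M + M)))).
have m3 : measurable (X t @^-1` [set M] `&` Dl @^-1` [set M]).
  exact: (measurableI _ _ (mpre t (measurable_set1 M)) (mDt _ (measurable_set1 M))).
apply: le_trans (leeD (lexx _) (leeD h1' h2)).
apply: (@le_trans _ _ (P ((X t @^-1` [set M] `&` Dl @^-1` [set M]) `|`
  ([set w | `]-oo, M[%classic (X t w) /\ X (t + t) w = (M + M)%R] `|`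
   [set w | `]-oo, M[%classic (Dl w) /\ X (t + t) w = (M + M)%R]))%E)).
  apply: le_measure; rewrite ?inE; first exact: mpre.
    by apply: measurableU => //; exact: measurableU.
  move=> w /= ww; rewrite !in_itv/=.
  have [lt|gt|eqM] := ltgtP (X t w) M.
  - by right; left.
  - by right; right; split=> //; rewrite /Dl ww; lra.
  - by left; split=> //; rewrite /Dl ww eqM; lra.
apply: (le_trans (measureU2 _ _ _)) => //; first exact: measurableU.
by rewrite leeD2l//; exact: measureU2.
Qed.

(* Let q be the limit at 0 of the mass of the heaviest atom. For small t, the largest
   non-negligible atom M of X t has mass almost q by the dichotomy; so has M + M for
   X (t + t), with mass about the square of that of M. Hence q <= q ^ 2 and q = 1. *)
Lemma atom_near1 s x0 e : 0 < s -> 0 < atom s x0 -> 0 < e ->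
  exists2 h, 0 < h & forall t, 0 <= t <= h -> exists y, 1 - e < atom t y.
Proof.
move=> s0 as0.
pose A := [set r | exists n y, r = atom (s / 2 ^+ n) y].
pose q := sup A.
have A0 : A !=set0 by exists (atom (s / 2 ^+ 0) 0), 0%N, 0.
have Aub : has_ubound A by exists 1 => _ [n [y ->]]; exact: atom_le1.
have p0 n : 0 < s / 2 ^+ n by rewrite divr_gt0// exprn_gt0.
have fq0 n y : atom (s / 2 ^+ n) y <= q by apply: ub_le_sup => //; exists n, y.
have q0 : 0 < q.
  by apply: lt_le_trans as0 _; have := fq0 0%N x0; rewrite expr0 divr1.
have q1 : q <= 1 by apply: ge_sup => // _ [n [y ->]]; exact: atom_le1.
have fq n t y : s / 2 ^+ n <= t -> atom t y <= q.
  move=> nt; rewrite -(subrK (s / 2 ^+ n) t); apply: (atom_noninc HX).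
  - by rewrite subr_ge0.
  - exact: ltW.
  - by move=> z; exact: fq0.
have near_q e' : 0 < e' -> exists n, forall t, 0 <= t <= s / 2 ^+ n -> exists y, q - e' < atom t y.
  move=> e0; have [_ [n [y ->]] qy] := sup_adherent e0 (conj A0 Aub).
  exists n => t /andP[t0 tn]; apply: contrapT => /forallNP h.
  move: qy; apply/negP; rewrite -leNgt -(subrK t (s / 2 ^+ n)).
  apply: (atom_noninc HX) => //; first by rewrite subr_ge0.
  by move=> z; rewrite leNgt; apply/negP; exact: h.
have qE : q = 1.
  apply/eqP; rewrite eq_le q1/= leNgt; apply/negP => lt1.
  have qq : 0 < q - q ^+ 2 by rewrite subr_gt0 expr2 gtr_pMr.
  (* The first bound gives eta <= (q - eta) ^ 2, so that M + M is heavy enough for the dichotomy at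
     time t + t. The second contradicts the final q - eta < q ^ 2 + 2 eta. *)
  pose eta := Num.min (q ^+ 2 / 8) ((q - q ^+ 2) / 3).
  have eta0 : 0 < eta.
    by rewrite lt_min; apply/andP; split; rewrite divr_gt0// exprn_gt0.
  have eta8 : eta <= q ^+ 2 / 8 by rewrite ge_min lexx.
  have eta3 : eta <= (q - q ^+ 2) / 3 by rewrite ge_min lexx orbT.
  have q2q : q ^+ 2 <= q by lra.
  have eta1 : eta <= 1 by lra.
  have eta2 : eta ^+ 2 <= eta by rewrite expr2 ler_piMl// ltW.
  have e20 : 0 < eta ^+ 2 by rewrite exprn_gt0.
  have [n nP] := near_q _ e20.
  (* The dichotomy is applied at t and at 2 t, and needs heavy atoms at 2 t and 4 t; all these times
     are at most s / 2 ^ n. *)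
  pose t := s / 2 ^+ n.+2.
  have tn : t + t + (t + t) = s / 2 ^+ n.
    by rewrite /t !exprS; field; rewrite gt_eqF// exprn_gt0.
  have t0 : 0 < t by exact: p0.
  have [y1 y1P] : exists y, q - eta ^+ 2 < atom (t + t) y by apply: nP; lra.
  have [y2 y2P] : exists y, q - eta ^+ 2 < atom (t + t + (t + t)) y by apply: nP; lra.
  have [y0 y0P] : exists y, q - eta ^+ 2 < atom t y by apply: nP; lra.
  have ft x : atom t x <= q by apply: (fq n.+2).
  have ftt x : atom (t + t) x <= q by apply: (fq n.+2); rewrite -/t; lra.
  have eta2q : eta *+ 2 <= q by rewrite mulr2n; lra.
  have [|M MP Mmax] := @largest_atom _ _ _ _ X t eta y0 eta0; first by lra.
  have fM : q - eta < atom t M by apply: (atom_dichotomy (ltW t0) eta0 eta2q ft y1P).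
  have fMM : (q - eta) ^+ 2 <= atom (t + t) (M + M).
    rewrite (le_trans _ (atomM_le HX M M (ltW t0) (ltW t0)))// expr2.
    by apply: ler_pM; lra.
  have h1 : eta <= (q - eta) ^+ 2.
    have : (q / 2) ^+ 2 <= (q - eta) ^+ 2 by rewrite ler_pXn2r// ?nnegrE; lra.
    by rewrite expr_div_n; lra.
  have tt0 : 0 <= t + t by lra.
  have := atom_dichotomy tt0 eta0 eta2q ftt y2P (le_trans h1 fMM).
  have := atom_double (ltW t0) eta0 Mmax.
  have : atom t M ^+ 2 <= q ^+ 2 by rewrite ler_pXn2r ?nnegrE ?atom_ge0// ltW.
  by rewrite mulr2n; lra.
move=> e0; have [n nP] := near_q _ e0; exists (s / 2 ^+ n) => //.
by rewrite qE in nP.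
Qed.

End diffuse.

Section no_atoms.
Context {R : realType} d (Omega : measurableType d) (P : probability Omega R).
Variables (X : R -> {RV P >-> R}) (f : R -> R).
Hypotheses (HX : levy_process X) (Hf : laplace_exponent X f).
Hypothesis Hjump : no_negative_jumps X.
Hypothesis Hgrow : forall b, exists2 lam, 0 < lam & 0 < f lam + b * lam.
Local Notation atom := (atom X).

Let mX t : measurable_fun setT (X t : Omega -> R). Proof. exact: measurable_funPT. Qed.

Let mpre t B : measurable B -> measurable (X t @^-1` B).
Proof. by move=> mB; rewrite -[X in measurable X]setTI; exact: mX. Qed.

Lemma atom_unique t y z : 1 < atom t y + atom t z -> y = z.
Proof.
move=> h; apply: contrapT => yz; move: h; apply/negP; rewrite -leNgt.
rewrite -lee_fin EFinD -!atomE -measureU.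
- by rewrite probability_le1//; apply: measurableU; exact: mpre.
- exact: mpre.
- exact: mpre.
- by apply/seteqP; split=> // w [/= -> ].
Qed.

Let measurable_on_line (t : nat -> R) (b : R) N :
  measurable [set w | forall k, (k <= N)%N -> X (t k) w = b * t k].
Proof.
rewrite (_ : [set w | _] = \bigcap_k (if (k <= N)%N then
    X (t k) @^-1` [set b * t k] else setT)).
  by apply: bigcapT_measurable => k; case: ifP => // _; exact: mpre.
apply/seteqP; split=> [w H k _|w H k kn]; first by case: ifP => // /H.
by have := H k Logic.I; rewrite kn.
Qed.

Section grid.
Variables (h0 b : R) (n : nat).
Hypothesis h00 : 0 < h0.
Let t (k : nat) : R := h0 * (k%:R / 2 ^+ n).
Hypothesis big_atom : forall k, (k <= 2 ^ n)%N -> 7 / 8 < atom (t k) (b * t k).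

Let h : R := h0 / 2 ^+ n.
Let hn0 : 0 <= h. Proof. by rewrite divr_ge0 ?ltW// exprn_gt0. Qed.
Let tS k : t k.+1 = t k + h.
Proof. by rewrite /t /h -natr1; field; rewrite gt_eqF// exprn_gt0. Qed.
Let t_ge0 k : 0 <= t k.
Proof. by rewrite mulr_ge0 ?(ltW h00)// divr_ge0// ltW// exprn_gt0. Qed.
Let t0 : t 0 = 0. Proof. by rewrite /t mul0r mulr0. Qed.
Let tN : t (2 ^ n) = h0.
Proof. by rewrite /t natrX divff ?mulr1// expf_neq0. Qed.

Let D (k : nat) (w : Omega) : R := X (t k.+1) w - X (t k) w.
Let mD k : measurable_fun setT (D k).
Proof. by apply: measurable_funB; exact: mX. Qed.
Let indD N (B : nat -> set R) : (forall i, measurable (B i)) ->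
  (P (\bigcap_(i < N) (D i @^-1` B i)) = \prod_(i < N) P (D i @^-1` B i))%E.
Proof.
move=> mB; apply: (levy_indep HX (t := t)) => // i _.
by rewrite tS lerDl.
Qed.

Let linear_until (j : nat) : set Omega := [set w | forall i, (i < j)%N -> D i w = b * h].
Let first_break (j : nat) : set Omega := linear_until j `&` [set w | D j w <> b * h].

Let X_linear j w : linear_until j w -> forall k, (k <= j)%N -> X (t k) w = b * t k.
Proof.
move=> lw; elim=> [_|k IHk kj]; first by rewrite t0 (levy_start HX) mulr0.
have := lw k kj; rewrite /D IHk ?(ltnW kj)// => /eqP.
by rewrite subr_eq => /eqP ->; rewrite tS; ring.
Qed.

Let mlinear j : measurable (linear_until j).
Proof.
rewrite (_ : linear_until j = \bigcap_(i < j) (D i @^-1` [set b * h]))//.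
apply: (measurable_cylinders mD (I := [set i | (i < j)%N])).
by exists (fun=> [set b * h]).
Qed.

Let cyl_break j : cylinders D [set i | (i < j.+1)%N] (first_break j).
Proof.
exists (fun i => if i == j then ~` [set b * h] else [set b * h]); split.
  by move=> i; case: ifP => // _; exact: measurableC.
apply/seteqP; split=> w.
  move=> [lw nw] i /=; rewrite ltnS leq_eqVlt; case: eqP => [->//|_ /= ij].
  exact: lw.
move=> H; split; last by have := H j (ltnSn j); rewrite /= eqxx.
by move=> i ij; have := H i (ltnW ij); rewrite /= ltn_eqF.
Qed.

Let mbreak j : measurable (first_break j).
Proof. exact: (measurable_cylinders mD (cyl_break j)). Qed.

Let W : set Omega := [set w | X h0 w <> b * h0].
Let mW : measurable W.
Proof. by apply: (@mpre h0 (~` [set b * h0])); exact: measurableC. Qed.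

(* After the first increment off the line, the rest of the path stays on a
   parallel line with probability at least 7/8, hence misses b h0 at time h0. *)
Let break_off j : (j < 2 ^ n)%N ->
  ((7 / 8)%:E * P (first_break j) <= P (first_break j `&` W))%E.
Proof.
move=> jn; pose V w := X h0 w - X (t j.+1) w.
pose U : Omega -> R := \1_(first_break j).
have UV : indep_rv P U V.
  apply: (indep_rv_past_future mD (@indD (2 ^ n)%N) jn).
    by apply: measurable_indic; apply: sub_sigma_algebra; exact: cyl_break.
  (* Terms outside the window are replaced by 0, because each term of the sum must be measurable for
     the future increments. *)
  pose Q i w : R := if (j < i < 2 ^ n)%N then D i w else 0.
  have -> : V = fun w => \sum_(i <- index_iota j.+1 (2 ^ n)) Q i w.
    apply/funext => w; transitivity (\sum_(j.+1 <= i < 2 ^ n) D i w).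
      by rewrite (telescope_sumr (fun i => X (t i) w))// tN.
    by rewrite big_nat big_mkcond.
  apply: measurable_sum => i; rewrite /Q; case: (boolP (j < i < 2 ^ n)%N) => //= ij.
  exact: measurable_cylinders_coord.
have tj : h0 - t j.+1 = t (2 ^ n - j.+1)%N.
  by rewrite -tN /t natrB//; ring.
have tj0 : 0 <= h0 - t j.+1 by rewrite tj.
pose v := b * (h0 - t j.+1).
have PV : (P (V @^-1` [set v]) = (atom (h0 - t j.+1) v)%:E)%E.
  rewrite -(levy_increment_atom HX v (t_ge0 j.+1) tj0).
  by rewrite (addrC (t j.+1)) subrK.
have UB : U @^-1` [set 1] = first_break j.
  apply/seteqP; split=> w; rewrite /U /= indicE.
    by case: (boolP (_ \in _)); rewrite ?inE// => _ /eqP; rewrite eq_sym oner_eq0.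
  by move=> ?; rewrite mem_set.
apply: (@le_trans _ _ (P (first_break j `&` V @^-1` [set v]))).
  rewrite -UB UV//= PV muleC; apply: lee_wpmul2l => //.
  by rewrite lee_fin /v tj ltW// big_atom// leq_subr.
apply: le_measure; rewrite ?inE.
- apply: measurableI => //; rewrite -[X in measurable X]setTI.
  by apply: (measurable_funB (mX h0) (mX (t j.+1))).
- exact: measurableI.
- move=> w [fb /= Vv]; split=> //= Xh0; case: fb => lw; apply; rewrite /D.
  rewrite (X_linear lw (leqnn j)); move: Vv; rewrite /V /v Xh0 => Vv.
  have -> : X (t j.+1) w = b * t j.+1 by lra.
  by rewrite tS; ring.
Qed.

(** Decomposing at the first break gives P W >= 7/8 (1 - P L), with L the event of staying on the
    line. Since P W < 1/8, this yields 1 - P L < 1/7, a bound independent of n, whereas a union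
    bound over the grid would degrade with n. *)
Lemma linear_grid_prob : 6 / 7 <=
  fine (P [set w | forall k, (k <= 2 ^ n)%N -> X (t k) w = b * t k]).
Proof.
have claim j : (j <= 2 ^ n)%N ->
    ((7 / 8)%:E * P (~` linear_until j) <= P (~` linear_until j `&` W))%E.
  elim: j => [_|j IHj jn].
    rewrite (_ : linear_until 0 = setT) ?setCT ?measure0 ?mule0//.
    by apply/seteqP; split.
  have -> : ~` linear_until j.+1 = ~` linear_until j `|` first_break j.
    apply/seteqP; split=> w; last first.
      move=> [nl|[lw Dj]] l1; first by apply: nl => i ij; apply: l1; exact: ltnW.
      by apply: Dj; exact: l1.
    move=> nl; have [lw|] := pselect (linear_until j w); last by left.
    right; split=> // Dj; apply: nl => i; rewrite ltnS leq_eqVlt => /predU1P[->//|].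
    exact: lw.
  rewrite setIUl !measureU//.
  - by rewrite ge0_muleDr// leeD// ?IHj ?(ltnW jn)// break_off.
  - by apply: measurableI => //; exact: measurableC.
  - exact: measurableI.
  - apply/seteqP; split=> // w [[nl _] [[lw _] _]]; exact: nl.
  - exact: measurableC.
  - by apply/seteqP; split=> // w [nl [lw _]]; exact: nl.
have mL := mlinear (2 ^ n)%N.
have PW : P W = (1 - atom h0 (b * h0))%:E.
  have -> : W = ~` (X h0 @^-1` [set b * h0]) by [].
  by rewrite probability_setC ?atomE//; exact: mpre.
have PL : P (~` linear_until (2 ^ n)) = (1 - fine (P (linear_until (2 ^ n))))%:E.
  by rewrite probability_setC// EFinB fineK// fin_num_measure.
have le1 : 7 / 8 * (1 - fine (P (linear_until (2 ^ n)))) <= 1 - atom h0 (b * h0).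
  rewrite -lee_fin EFinM -PW -PL; apply: (le_trans (claim _ (leqnn _))).
  apply: le_measure; rewrite ?inE//.
  by apply: measurableI => //; exact: measurableC.
have := big_atom (leqnn _); rewrite tN => big.
have h6 : 6 / 7 <= fine (P (linear_until (2 ^ n))) by lra.
apply: (le_trans h6); have mlin := @measurable_on_line t b (2 ^ n).
apply: fine_le; rewrite ?fin_num_measure//.
apply: le_measure; rewrite ?inE//.
by move=> w; exact: X_linear.
Qed.

End grid.

Lemma levy_diffuse s x : 0 < s -> atom s x = 0.
Proof.
move=> s0; apply/eqP; rewrite eq_le (atom_ge0 X) andbT leNgt; apply/negP => sx.
have e8 : (0 : R) < 1 / 8 by lra.
have [h0 h00 near1] := atom_near1 HX s0 sx e8.
have big r : 0 <= r <= h0 -> exists y, 7 / 8 < atom r y.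
  by move=> /near1[y hy]; exists y; apply: le_lt_trans hy; lra.
have /choice[a aP] r : exists y : R, 0 <= r <= h0 -> 7 / 8 < atom r y.
  by have [/big[y hy]|] := boolP (0 <= r <= h0); [exists y|exists 0].
(* Both a r1 + a r2, of mass above 49/64, and a (r1 + r2), of mass above 7/8, are atoms of X (r1 +
   r2); as 49/64 + 7/8 > 1 they coincide. *)
have aD r1 r2 : 0 <= r1 -> 0 <= r2 -> r1 + r2 <= h0 -> a (r1 + r2) = a r1 + a r2.
  move=> r10 r20 r12; apply: (@atom_unique (r1 + r2)).
  have l1 : 7 / 8 < atom r1 (a r1) by apply: aP; lra.
  have l2 : 7 / 8 < atom r2 (a r2) by apply: aP; lra.
  have l3 : 7 / 8 < atom (r1 + r2) (a (r1 + r2)) by apply: aP; lra.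
  have := atomM_le HX (a r1) (a r2) r10 r20; nra.
(* Additivity alone makes a linear on the dyadic fractions of h0, which are the only times used. *)
pose b := a h0 / h0.
have a_lin n k : (k <= 2 ^ n)%N ->
    a (h0 * (k%:R / 2 ^+ n)) = b * (h0 * (k%:R / 2 ^+ n)).
  move=> kn; pose h := h0 / 2 ^+ n.
  have n0 : (0 : R) < 2 ^+ n by rewrite exprn_gt0.
  have hh : h * 2 ^+ n = h0 by rewrite divfK// gt_eqF.
  have hp : 0 <= h by rewrite divr_ge0 ?ltW.
  have le2 j : (j <= 2 ^ n)%N -> h * j%:R <= h0.
    by move=> jn; rewrite -hh ler_wpM2l// -natrX ler_nat.
  have a0 : a 0 = 0 by have := aD 0 0; rewrite addr0 => /(_ _ _ _); lra.
  have aN j : (j <= 2 ^ n)%N -> a (h * j%:R) = j%:R * a h.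
    elim: j => [_|j IHj jn]; first by rewrite mulr0 mul0r a0.
    have := le2 _ jn; rewrite -natr1 mulrDr mulr1 => le.
    have hj : 0 <= h * j%:R by rewrite mulr_ge0.
    by rewrite aD// IHj ?(ltnW jn)//; ring.
  have ah : 2 ^+ n * a h = a h0.
    by rewrite -hh -natrX aN.
  rewrite (_ : h0 * _ = h * k%:R); last by rewrite /h; field; rewrite gt_eqF.
  have hN0 : h != 0 by rewrite gt_eqF// divr_gt0.
  rewrite aN// /b -ah -[in _ / h0]hh.
  by field; rewrite hN0 gt_eqF.
pose C n := [set w | forall k, (k <= 2 ^ n)%N ->
  X (h0 * (k%:R / 2 ^+ n)) w = b * (h0 * (k%:R / 2 ^+ n))].
have mC n : measurable (C n) by exact: measurable_on_line.
have PC n : ((6 / 7)%:E <= P (C n))%E.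
  rewrite -(fineK (fin_num_measure P _ (mC n))) lee_fin.
  apply: linear_grid_prob => // k kn; rewrite -a_lin//; apply: aP.
  have n0 : (0 : R) < 2 ^+ n by rewrite exprn_gt0.
  rewrite mulr_ge0 ?(ltW h00) ?divr_ge0 ?(ltW n0)//=.
  by rewrite ler_piMr ?(ltW h00)// ler_pdivrMr// mul1r -natrX ler_nat.
have Cni : nonincreasing_seq C.
  apply/nonincreasing_seqP => n; apply/subsetPset => w H k kn.
  have := H (2 * k)%N; rewrite expnS leq_mul2l kn => /(_ isT).
  rewrite natrM exprS (_ : 2 * _ / _ = k%:R / 2 ^+ n)//.
  by field; rewrite expf_neq0.
have : P \o C @ \oo --> P (\bigcap_n C n).
  apply: nonincreasing_cvg_mu => //; last exact: bigcapT_measurable.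
  by rewrite -ge0_fin_numE// fin_num_measure.
have C0 : P (\bigcap_n C n) = 0%E.
  apply/eqP; rewrite eq_le measure_ge0 andbT.
  rewrite -(above_line_null HX Hf Hjump h00 (Hgrow b)).
  apply: le_measure; rewrite ?inE; first exact: bigcapT_measurable.
    exact: measurable_above_line.
  by move=> w H n k kn; rewrite (H n Logic.I k kn) subrr.
rewrite C0 => cv.
have : ((6 / 7)%:E <= lim ((P \o C) n @[n --> \oo]))%E.
  by apply: lime_ge; [exact: cvgP cv|exact: nearW].
by rewrite (cvg_lim _ cv)// lee_fin; lra.
Qed.

End no_atoms.

(** * The running infimum *)

Section infimum.
Context {R : realType} d (Omega : measurableType d) (P : probability Omega R).
Variables (X : R -> {RV P >-> R}).
Hypothesis HX : levy_process X.

Let mX t : measurable_fun setT (X t : Omega -> R). Proof. exact: measurable_funPT. Qed.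

Let cX w : cadlag (X ^~ w). Proof. exact: levy_cadlag. Qed.

Lemma path_inf_dyadicP x (s t c : R) : cadlag x -> 0 <= s <= t ->
  c <= path_inf x s t <->
  forall n k, (k <= 2 ^ n)%N -> c <= x (s + (t - s) * (k%:R / 2 ^+ n)).
Proof.
move=> cx st; apply: (iff_trans (path_inf_geP c cx st)); split; last exact: path_ge_dyadic.
move/andP: st => [s0 st] h n k kn; apply: h.
have p0 : 0 < 2 ^+ n :> R by rewrite exprn_gt0.
have st0 : 0 <= t - s by rewrite subr_ge0.
rewrite lerDl mulr_ge0 ?divr_ge0 ?(ltW p0)//= -lerBrDl.
by rewrite ler_piMr// ler_pdivrMr// mul1r -natrX ler_nat.
Qed.

Section fixed_times.
Variables s t : R.
Hypothesis st : 0 <= s <= t.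

Let T n k : R := s + (t - s) * (k%:R / 2 ^+ n).
Let J w : R := path_inf (X ^~ w) s t - X s w.
Let A c n : set Omega := [set w | forall k, (k <= 2 ^ n)%N -> c <= X (T n k) w - X s w].

Let JA c : J @^-1` `[c, +oo[ = \bigcap_n A c n.
Proof.
apply/seteqP; split=> w.
  rewrite /= in_itv/= andbT lerBrDr => h n _ k kn; rewrite lerBrDr.
  by apply: (path_inf_dyadicP _ (cX w) st).1.
move=> h; rewrite /= in_itv/= andbT lerBrDr; apply/(path_inf_dyadicP _ (cX w) st) => n k kn.
by rewrite -lerBrDr; exact: h.
Qed.

Let mA c n : measurable (A c n).
Proof.
rewrite (_ : A c n = \bigcap_k (if (k <= 2 ^ n)%N then
    (fun w => X (T n k) w - X s w) @^-1` `[c, +oo[ else setT)).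
  apply: bigcapT_measurable => k; case: ifP => // _.
  by rewrite -[X in measurable X]setTI; apply: (measurable_funB (mX (T n k)) (mX s)).
apply/seteqP; split=> [w H k _|w H k kn].
  by case: ifP => // /H; rewrite /= in_itv/= andbT.
by have := H k Logic.I; rewrite kn /= in_itv/= andbT.
Qed.

Let A_noninc c : nonincreasing_seq (A c).
Proof.
apply/nonincreasing_seqP => n; apply/subsetPset => w H k kn.
have := H (2 * k)%N; rewrite expnS leq_mul2l kn => /(_ isT).
rewrite /T natrM exprS (_ : 2 * _ / _ = k%:R / 2 ^+ n)//.
by field; rewrite expf_neq0.
Qed.

Let mJ : measurable_fun setT J.
Proof.
apply: (measurability _ (RGenCInfty.measurableE R)) => _ /= [_ [c ->] <-].
by rewrite setTI JA; exact: bigcapT_measurable.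
Qed.

Lemma measurable_path_inf : measurable_fun setT (fun w => path_inf (X ^~ w) s t).
Proof.
rewrite (_ : (fun w => _) = fun w => J w + X s w); first exact: measurable_funD.
by apply/funext => w; rewrite /J subrK.
Qed.

Let indep_grid c n C : measurable C ->
  (P (A c n `&` X s @^-1` C) = P (A c n) * P (X s @^-1` C))%E.
Proof.
(* The times are 0 followed by the grid of [s, t]: X s is increment 0, and A c n is an event on the
   later increments. *)
move=> mC; pose S i : R := if i is i'.+1 then T n i' else 0.
have T0 : T n 0 = s by rewrite /T mul0r mulr0 addr0.
pose D i w := X (S i.+1) w - X (S i) w.
have mD i : measurable_fun setT (D i) by exact: measurable_funB.
have s0 : 0 <= s by case/andP: st.
have ts0 : 0 <= t - s by rewrite subr_ge0; case/andP: st.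
have indD (B : nat -> set R) : (forall i, measurable (B i)) ->
    (P (\bigcap_(i < (2 ^ n).+1) (D i @^-1` B i)) =
     \prod_(i < (2 ^ n).+1) P (D i @^-1` B i))%E.
  move=> mB; apply: (levy_indep HX (t := S)) => // -[_ |i _] /=; first by rewrite T0.
  by rewrite lerD2l ler_wpM2l// ler_wpM2r ?invr_ge0 ?exprn_ge0// ler_nat.
have XsD : X s = D 0%N :> (Omega -> R).
  by apply/funext => w; rewrite /D /= T0 (levy_start HX) subr0.
have DsumE k w : X (T n k) w - X s w = \sum_(i <- index_iota 1 k.+1) D i w.
  by rewrite (telescope_sumr (fun i => X (S i) w))//= T0.
pose N := (2 ^ n).+1.
have UV : indep_rv P (X s) (\1_(A c n)).
  apply: (indep_rv_past_future mD indD (k := 1)) => //.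
    by rewrite XsD; exact: measurable_cylinders_coord.
  apply: measurable_indic.
  pose G := g_sigma_algebraType (cylinders D [set i | (1 <= i < (2 ^ n).+1)%N]).
  rewrite (_ : A c n = \bigcap_k (if (k <= 2 ^ n)%N then
      (fun w => X (T n k) w - X s w) @^-1` `[c, +oo[ else setT)); last first.
    apply/seteqP; split=> [w H k _|w H k kn].
      by case: ifP => // /H; rewrite /= in_itv/= andbT.
    by have := H k Logic.I; rewrite kn /= in_itv/= andbT.
  apply: (@bigcapT_measurable _ G) => k; case: ifP => // kn.
  have mk : measurable_fun (setT : set G) (fun w => X (T n k) w - X s w).
    pose Q i w : R := if (0 < i < k.+1)%N then D i w else 0.
    have -> : (fun w => X (T n k) w - X s w) =
        fun w => \sum_(i <- index_iota 1 k.+1) Q i w.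
      by apply/funext => w; rewrite DsumE big_nat big_mkcond.
    apply: measurable_sum => i; rewrite /Q.
    case: (boolP (0 < i < k.+1)%N) => //= /andP[i0 ik].
    by apply: measurable_cylinders_coord; rewrite /= i0 (leq_trans ik).
  by rewrite -[X in measurable X]setTI; exact: mk.
have UB : \1_(A c n) @^-1` [set 1 : R] = A c n.
  apply/seteqP; split=> w; rewrite /= indicE.
    by case: (boolP (_ \in _)); rewrite ?inE// => _ /eqP; rewrite eq_sym oner_eq0.
  by move=> ?; rewrite mem_set.
by rewrite -{1}UB setIC UV// UB muleC.
Qed.

(** The event that the increment is at least c is a decreasing limit of events on finitely many
    increments after s, each independent of X s. With [setT], these events form a pi-system
    generating the variable. *)
Lemma path_inf_increment_indep :
  indep_rv P (fun w => path_inf (X ^~ w) s t - X s w) (X s).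
Proof.
pose G1 : set (set Omega) := [set B | exists c, B = J @^-1` `[c, +oo[] `|` [set setT].
pose G2 : set (set Omega) := [set B | exists2 C, measurable C & B = X s @^-1` C].
have mXs C : measurable C -> measurable (X s @^-1` C).
  by move=> mC; rewrite -[X in measurable X]setTI; exact: mX.
have mJc c : measurable (J @^-1` `[c, +oo[).
  by rewrite -[X in measurable X]setTI; exact: mJ.
apply: (@indep_rv_generated _ _ _ _ G1 G2).
- move=> _ _ [[c ->]|->] [[c' ->]|->]; rewrite ?setIT ?setTI; [|by left; exists c|
    by left; exists c'|by right].
  left; exists (Num.max c c'); apply/seteqP; split=> w; rewrite /= !in_itv/= !andbT ge_max.
    by move=> [-> ->].
  by move=> /andP.
- by right.
- by move=> _ [[c ->]|->].
- move=> _ _ [C mC ->] [C' mC' ->]; exists (C `&` C'); first exact: measurableI.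
  by rewrite preimage_setI.
- by exists setT; rewrite ?preimage_setT.
- by move=> _ [C mC ->]; exact: mXs.
- move=> _ _ [[c ->]|->] [C mC ->]; last first.
    by rewrite setTI probability_setT mul1e.
  rewrite JA setIC -bigcapIr; last by exists 0%N.
  have cv1 : P \o (fun n => X s @^-1` C `&` A c n) @ \oo -->
      P (\bigcap_n (X s @^-1` C `&` A c n)).
    apply: nonincreasing_cvg_mu => //.
    - by rewrite -ge0_fin_numE// fin_num_measure//; apply: measurableI => //; exact: mXs.
    - by move=> n; apply: measurableI => //; exact: mXs.
    - by apply: bigcapT_measurable => n; apply: measurableI => //; exact: mXs.
    - move=> m n mn; apply/subsetPset; apply: setIS; apply/subsetPset.
      exact: A_noninc.
  have cv2 : P \o A c @ \oo --> P (\bigcap_n A c n).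
    apply: nonincreasing_cvg_mu => //.
    - by rewrite -ge0_fin_numE// fin_num_measure.
    - exact: bigcapT_measurable.
  have cv3 : (fun n => P (A c n) * P (X s @^-1` C))%E @ \oo -->
      (P (\bigcap_n A c n) * P (X s @^-1` C))%E.
    by apply: cvgeZr cv2 => //; rewrite fin_num_measure//; exact: mXs.
  apply: cvg_unique cv1 _ => //.
  rewrite (_ : P \o _ = fun n => P (A c n) * P (X s @^-1` C))%E//.
  by apply/funext => n /=; rewrite setIC indep_grid.
- apply: (measurability _ (RGenCInfty.measurableE R)) => _ /= [_ [c ->] <-].
  by rewrite setTI; apply: sub_sigma_algebra; left; exists c.
- move=> _ C mC; rewrite setTI; apply: sub_sigma_algebra.
  by exists C.
Qed.

End fixed_times.

Variable f : R -> R.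
Hypotheses (Hf : laplace_exponent X f) (Hjump : no_negative_jumps X).
Hypothesis Hgrow : forall b, exists2 lam, 0 < lam & 0 < f lam + b * lam.

Let path_inf_le0 (t : R) w : 0 <= t -> path_inf (X ^~ w) 0 t <= 0.
Proof.
move=> t0; rewrite -[leRHS](levy_start HX w).
by apply: (path_inf_le (cX w)); rewrite ?lexx.
Qed.

Let mI (s t c : R) : 0 <= s <= t ->
  measurable [set w | path_inf (X ^~ w) s t <= c].
Proof.
move=> st; rewrite [X in measurable X](_ : _ = setT `&`
    (fun w => path_inf (X ^~ w) s t) @^-1` `]-oo, c]).
  exact: (measurable_path_inf st).
by rewrite setTI; apply/seteqP; split=> w /=; rewrite in_itv.
Qed.

Let mIeq (s t c : R) : 0 <= s <= t ->
  measurable [set w | path_inf (X ^~ w) s t = c].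
Proof.
move=> st; rewrite [X in measurable X](_ : _ = setT `&`
    (fun w => path_inf (X ^~ w) s t) @^-1` [set c]); last by rewrite setTI.
exact: (measurable_path_inf st).
Qed.

Let path_inf_atom_le (s t a : R) : 0 < s <= t ->
  (P [set w | path_inf (X ^~ w) 0 t = a] <= P [set w | (path_inf (X ^~ w) 0 s <= a)%R])%E.
Proof.
move=> /andP[s0 st]; have st' : 0 <= s <= t by rewrite (ltW s0).
have s00 : 0 <= (0 : R) <= s by rewrite lexx ltW.
have t00 : 0 <= (0 : R) <= t by rewrite lexx (le_trans (ltW s0)).
pose J w := path_inf (X ^~ w) s t - X s w.
have mJ : measurable_fun setT J.
  by apply: measurable_funB => //; exact: measurable_path_inf.
have J0 : P [set w | setT (J w) /\ (J w + X s w)%R = a] = 0%E.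
  apply/eqP; rewrite eq_le measure_ge0 andbT -(mul0e (P (J @^-1` setT))).
  apply: (@sum_atom_le _ _ _ P J (X s) mJ (mX s) (path_inf_increment_indep st')) => // y _.
  by rewrite -[X in P X]/(X s @^-1` [set a - y]) atomE// (levy_diffuse HX Hf Hjump Hgrow).
have JE : [set w | setT (J w) /\ J w + X s w = a] = [set w | path_inf (X ^~ w) s t = a].
  by apply/seteqP; split=> w /=; rewrite /J subrK; [case|].
rewrite JE in J0.
rewrite -[leRHS]adde0 -J0.
apply: (le_trans _ (measureU2 _ _ _)); [|exact: mI|exact: mIeq].
apply: le_measure; rewrite ?inE; [exact: mIeq|apply: measurableU; [exact: mI|exact: mIeq]|].
move=> w /= Ia; have [|lt1] := leP (path_inf (X ^~ w) 0 s) a; [by left|right].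
apply/eqP; rewrite eq_le; apply/andP; split; last first.
  rewrite -Ia; apply/(path_inf_geP _ (cX w) st') => r /andP[sr rt].
  by apply: (path_inf_le (cX w)) => //; rewrite rt (le_trans (ltW s0)).
rewrite leNgt; apply/negP => lt2.
have : Num.min (path_inf (X ^~ w) 0 s) (path_inf (X ^~ w) s t) <= a.
  rewrite -Ia; apply/(path_inf_geP _ (cX w) t00) => r /andP[r0 rt].
  rewrite ge_min; have [rs|sr] := leP r s.
    by rewrite (path_inf_le (cX w))// r0.
  by rewrite (path_inf_le (cX w) (ltW s0))// ?orbT// (ltW sr).
by rewrite ge_min leNgt lt1 leNgt lt2.
Qed.

(* I_t = a < 0 forces, up to a null set, I_s <= a for every s in ]0, t], and
   I_s --> 0 as s decreases to 0. *)
Lemma path_inf_atom (t a : R) : 0 < t -> P [set w | path_inf (X ^~ w) 0 t = a] = 0%E.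
Proof.
move=> t0; have t00 : 0 <= (0 : R) <= t by rewrite lexx ltW.
apply/eqP; rewrite eq_le measure_ge0 andbT.
have [a0|a0|a0] := ltgtP a 0; last 2 first.
- rewrite (_ : [set w | _] = set0) ?measure0//; apply/seteqP; split=> // w /= Ia.
  by have := path_inf_le0 w (ltW t0); rewrite Ia leNgt a0.
- rewrite -(above_line_null HX Hf Hjump t0 (Hgrow 0)).
  apply: le_measure; rewrite ?inE; [exact: mIeq|exact: measurable_above_line|].
  move=> w /= Ia n k kn; rewrite mul0r subr0.
  have /(path_inf_dyadicP _ (cX w) t00)/(_ n k kn) : 0 <= path_inf (X ^~ w) 0 t.
    by rewrite Ia a0.
  by rewrite add0r subr0.
pose s n := t / n.+1%:R.
have s_itv n : 0 < s n <= t.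
  by rewrite divr_gt0//= ler_pdivrMr// ler_peMr ?ler1n// ltW.
have s00 n : 0 <= (0 : R) <= s n by have /andP[/ltW -> _] := s_itv n; rewrite lexx.
pose B n := [set w | path_inf (X ^~ w) 0 (s n) <= a].
have mB n : measurable (B n) by exact: mI.
have B0 : \bigcap_n B n = set0.
  apply/seteqP; split=> // w Bw; have a20 : 0 < - (a / 2) by lra.
  have [v v0 vP] := cadlag_right (cX w) (lexx 0) a20.
  have [n nv] : exists n, s n < v.
    exists (Num.trunc (t / v)); rewrite /s ltr_pdivrMr// mulrC -ltr_pdivrMr//.
    exact: truncnS_gt.
  have : a / 2 <= path_inf (X ^~ w) 0 (s n).
    apply/(path_inf_geP _ (cX w) (s00 n)) => r /andP[r0 rs].
    have := vP r r0 (le_lt_trans rs nv); rewrite (levy_start HX) sub0r normrN ltr_norml.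
    by move=> /andP[/ltW]; rewrite opprK.
  by move/le_trans/(_ (Bw n Logic.I)); lra.
have : P \o B @ \oo --> P (\bigcap_n B n).
  apply: nonincreasing_cvg_mu => //.
  - by rewrite -ge0_fin_numE// fin_num_measure.
  - exact: bigcapT_measurable.
  - move=> m n mn; apply/subsetPset => w; apply: le_trans.
    apply/(path_inf_geP _ (cX w) (s00 n)) => r /andP[r0 rs].
    apply: (path_inf_le (cX w)) => //; rewrite r0 (le_trans rs)// /s.
    by rewrite ler_pM2l// lef_pV2 ?posrE// ler_nat ltnS.
rewrite B0 measure0 => cv; rewrite -(cvg_lim _ cv)//.
apply: lime_ge; first exact: cvgP cv.
by apply: nearW => n; exact: path_inf_atom_le.
Qed.

Lemma path_inf_ae_notin (t : R) (D : set R) : 0 < t -> countable D ->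
  {ae P, forall w, ~ D (path_inf (X ^~ w) 0 t)}.
Proof.
move=> t0 cD; have t00 : 0 <= (0 : R) <= t by rewrite lexx ltW.
have [g g_inj] := countable_injP _ cD.
have : {ae P, forall w, forall n a, D a -> g a = n -> path_inf (X ^~ w) 0 t <> a}.
  apply: ae_foralln => n.
  have [[a Da gan]|noa] := pselect (exists2 a, D a & g a = n).
    exists [set w | path_inf (X ^~ w) 0 t = a]; split.
    - exact: mIeq.
    - exact: path_inf_atom.
    move=> w /= h; apply: contrapT => na; apply: h => b Db gb.
    suff -> : b = a by [].
    by apply: g_inj; rewrite ?inE// gb.
  by apply: aeW => w a Da ga; case: noa; exists a.
by apply: filterS => w h Dw; exact: (h _ _ Dw).
Qed.

End infimum.

(** * The transition semigroup *)

(** The sets A n below are neighbourhoods of mu, and by [Mf_nbhs_base] they form a countable base at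
    mu. *)
Lemma continuous_Mf_seq {R : realType} (G : Mf R -> R) :
  (forall (mu_ : nat -> Mf R) mu, mu_ n @[n --> \oo] --> mu ->
    G (mu_ n) @[n --> \oo] --> G mu) -> continuous G.
Proof.
move=> Gseq mu; have Fmu : Filter (nbhs mu) := nbhs_filter mu.
apply/cvgrPdist_lt => e e0.
pose A n := [set nu : Mf R | forall j, (j < n)%N ->
  `|\int[mu]_(x in @Eset R) test_seq j x -
    \int[nu]_(x in @Eset R) test_seq j x| < n.+1%:R^-1].
have nbhsA n : nbhs mu (A n).
  have test_near j (r : R) : 0 < r -> nbhs mu [set nu : Mf R |
      `|\int[mu]_(x in @Eset R) test_seq j x -
        \int[nu]_(x in @Eset R) test_seq j x| < r].
    move=> r0; have /Mf_cvgP/(_ _ (@continuous_test_seq _ j)) : nbhs mu --> mu by [].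
    by move/cvgrPdist_lt; apply.
  (* The radius is decoupled from the number of test functions, so that it stays fixed in the
     induction. *)
  rewrite /A; elim: n {2}n => [m|N IHN m].
    by apply: filterS (@filterT _ _ Fmu) => nu.
  apply: filterS2 (IHN m) (test_near N m.+1%:R^-1 _) => // nu lt1 lt2 j.
  by rewrite ltnS leq_eqVlt => /predU1P[->//|/lt1].
apply: contrapT => nG.
have /choice[nu_ nuP] : forall n, exists nu : Mf R, A n nu /\ ~ `|G mu - G nu| < e.
  move=> n; apply: contrapT => /forallNP h; apply: nG.
  apply: filterS (nbhsA n) => nu Anu; apply: contrapT => Gnu; exact: (h nu).
have cv : nu_ n @[n --> \oo] --> mu.
  move=> B /Mf_nbhs_base[n nP]; exists n => // m /= nm; apply: nP => j jn.
  apply: lt_le_trans ((nuP m).1 j (leq_trans jn nm)) _.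
  by rewrite lef_pV2 ?posrE// ler_nat ltnS.
have /cvgrPdist_lt/(_ e e0)[N _ /(_ N (leqnn N))] := Gseq _ _ cv.
exact: (nuP N).2.
Qed.

Section feller_property.
Context {R : realType} d (Omega : measurableType d) (P : probability Omega R).

Lemma expectation_cvg (G_ : nat -> Omega -> R) (G : Omega -> R) (M : R) :
  (forall n, measurable_fun setT (G_ n)) -> measurable_fun setT G ->
  (forall n w, `|G_ n w| <= M) -> (forall w, `|G w| <= M) ->
  {ae P, forall w, G_ n w @[n --> \oo] --> G w} ->
  fine 'E_P[G_ n] @[n --> \oo] --> fine 'E_P[G].
Proof.
move=> mG_ mG G_M GM cG; rewrite unlock.
have icst : P.-integrable setT (cst M%:E) by exact: finite_measure_integrable_cst.
have iG : P.-integrable setT (EFin \o G).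
  apply: le_integrable icst => //; first exact/measurable_EFinP.
  by move=> w _; rewrite lee_fin (le_trans (GM w))// ler_norm.
apply: fine_cvg; rewrite fineK; last exact: integrable_fin_num.
apply: (@dominated_cvg_ae _ _ _ P (fun n => EFin \o G_ n) (EFin \o G) (cst M%:E)) => //.
- by move=> n; apply/measurable_EFinP.
- exact/measurable_EFinP.
- by apply: filterS cG => w cw; apply: cvg_EFin => //; exact: nearW.
- by apply: aeW => w n; rewrite lee_fin.
Qed.

Variables (X : R -> {RV P >-> R}) (f : R -> R) (eps : nat -> R) (rho0 : R -> Omega -> Mf R).
Hypotheses (HX : levy_process X) (Hf : laplace_exponent X f).
Hypothesis Hjump : no_negative_jumps X.
Hypothesis Hgrow : forall b, exists2 lam, 0 < lam & 0 < f lam + b * lam.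
Hypothesis Hrho : exploration0 eps X rho0.

Let I t w := path_inf (X ^~ w) 0 t.

Let I_le0 (t : R) w : 0 <= t -> I t w <= 0.
Proof.
move=> t0; rewrite -[leRHS](levy_start HX w).
by apply: (path_inf_le (levy_cadlag HX w)); rewrite ?lexx.
Qed.

Let erased_ge0 (t : R) w : 0 <= t -> 0 <= - I t w.
Proof. by move=> t0; rewrite oppr_ge0 I_le0. Qed.

Let explorationE (t : R) mu w : 0 < t ->
  exploration X rho0 mu t w = concat (erase (- I t w) mu) (rho0 t w).
Proof. by move=> t0; rewrite /exploration gt_eqF. Qed.

Let measurable_exploration (t : R) mu (F : Mf R -> R) : 0 < t -> continuous F ->
  measurable_fun setT (fun w => F (exploration X rho0 mu t w)).
Proof.
move=> t0 cF; under eq_fun do rewrite explorationE//.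
apply: measurable_concat_erase => //.
- by move=> A mA; apply: (expl_measurable Hrho) => //; exact: ltW.
- by apply: measurableT_comp => //; apply: measurable_path_inf => //; rewrite lexx ltW.
- by move=> w; rewrite erased_ge0// ltW.
Qed.

Lemma transition0 F mu : transition X rho0 0 F mu = F mu.
Proof.
rewrite /transition (_ : (fun w => _) = cst (F mu)) ?expectation_cst//.
by apply/funext => w; rewrite /exploration eqxx.
Qed.

Lemma continuous_transition (t : R) F : 0 <= t -> C0_Mf F ->
  continuous (transition X rho0 t F).
Proof.
rewrite le_eqVlt => /predU1P[<- [cF _]|t0 CF].
  by rewrite (_ : transition _ _ _ _ = F)//; apply/funext => mu; exact: transition0.
have cF := CF.1; have [M _ FM] := C0_Mf_bounded CF.
apply: continuous_Mf_seq => mu_ mu mucv.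
apply: (@expectation_cvg _ _ M) => [n| |n w|//|]; try exact: measurable_exploration.
  exact: FM.
(* I t w in D means that the level mass mu + I t w is a jump of the quantile. The value 0 is in D as
   soon as H^mu is finite, the quantile being +oo beyond mass mu: a vanishing mass placed far away
   then changes H^mu. *)
pose D := (fun u => u - mass mu) @` [set u | ~ right_continuity_pt (quantile mu) u].
have cD : countable D.
  apply: sub_countable (card_image_le _ _) (countable_jumps _).
  exact: quantile_nd.
apply: filterS (path_inf_ae_notin HX Hf Hjump Hgrow t0 cD) => w Dw.
have Qr : right_continuity_pt (quantile mu) (mass mu - - I t w).
  by apply: contrapT => nr; apply: Dw; exists (mass mu - - I t w) => //; rewrite opprK addrC addKr.
have cv : exploration X rho0 (mu_ n) t w @[n --> \oo] --> exploration X rho0 mu t w.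
  under eq_fun do rewrite explorationE//; rewrite explorationE//.
  have It0 := erased_ge0 w (ltW t0).
  apply: (@concat_erase_cvg _ mu_ mu (rho0 t w) (fun=> - I t w) (- I t w)) => //.
    exact: cvg_cst.
  apply: Mf_cvg_quantile => //.
  by apply: cvgB; [exact: Mf_cvg_mass|exact: cvg_cst].
exact: cvg_comp cv (cF _).
Qed.

Lemma transition_vanishing (t : R) F (mu_ : nat -> Mf R) : 0 <= t -> C0_Mf F ->
  mass (mu_ n) @[n --> \oo] --> +oo -> transition X rho0 t F (mu_ n) @[n --> \oo] --> 0.
Proof.
move=> + CF muoo; rewrite le_eqVlt => /predU1P[<-|t0].
  by under eq_fun do rewrite transition0; exact: CF.2.
have [M M0 FM] := C0_Mf_bounded CF.
rewrite -(_ : fine 'E_P[cst 0] = 0); last by rewrite expectation_cst.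
apply: (@expectation_cvg _ _ M) => //.
- by move=> n; apply: measurable_exploration => //; exact: CF.1.
- by move=> w; rewrite normr0.
apply: aeW => w; apply: CF.2; apply/cvgryPge => A.
have /cvgryPge/(_ (A - I t w)) := muoo; apply: filterS => n.
rewrite explorationE// lerBlDr => /le_trans; apply.
by have := mass_concat_erase (mu_ n) (rho0 t w) (erased_ge0 w (ltW t0)); rewrite opprK.
Qed.

Lemma transition_start F mu : C0_Mf F ->
  transition X rho0 t F mu @[t --> 0^'+] --> F mu.
Proof.
move=> CF; have [M M0 FM] := C0_Mf_bounded CF; have cF := CF.1.
apply/cvg_at_rightP => u [u0 ucv].
rewrite -(transition0 F mu) {2}/transition.
apply: (@expectation_cvg _ _ M) => //.
- by move=> n; exact: measurable_exploration.
- rewrite (_ : (fun w => _) = cst (F mu))//.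
  by apply/funext => w; rewrite /exploration eqxx.
apply: filterS (expl_mass Hrho) => w mw.
have cX := levy_cadlag HX w.
have Xcv : X (u n) w @[n --> \oo] --> 0.
  by have /cvg_at_rightP/(_ u (conj u0 ucv)) := cX.1 0 (lexx 0); rewrite (levy_start HX).
have Icv : I (u n) w @[n --> \oo] --> 0.
  apply/cvgrPdist_le => e e0; have [v v0 vP] := cadlag_right cX (lexx 0) e0.
  apply: filterS (cvgr_lt _ ucv _ v0) => n un.
  rewrite sub0r normrN ler0_norm ?I_le0 ?(ltW (u0 n))// lerNl.
  apply/(path_inf_geP _ cX); first by rewrite lexx ltW.
  move=> r /andP[r0 rn]; have := vP r r0 (le_lt_trans rn un).
  by rewrite (levy_start HX) sub0r normrN ltr_norml => /andP[/ltW].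
have cv : exploration X rho0 mu (u n) w @[n --> \oo] --> exploration X rho0 mu 0 w.
  under eq_fun do rewrite explorationE//; rewrite /exploration eqxx.
  apply: concat_erase_cvg_start.
  - by move=> n; rewrite erased_ge0// ltW.
  - by rewrite -oppr0; exact: cvgN.
  - under eq_fun do rewrite mw//.
    have := cvgB Xcv Icv; rewrite subr0; exact.
exact: cvg_comp cv (cF _).
Qed.

End feller_property.

Theorem theorem2p1 (R : realType) (d : measure_display)
    (Omega : measurableType d) (P : probability Omega R)
    (X : R -> {RV P >-> R})
    (alpha0 : R) (Pi : {sigma_finite_measure set R -> \bar R})
    (eps : nat -> R) (rho0 : R -> Omega -> Mf R) :
  levy_process X ->
  no_negative_jumps X ->
  0 <= alpha0 ->
  jump_measure Pi ->
  laplace_exponent X (psi alpha0 Pi) ->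
  (forall k, 0 < eps k) ->
  nonincreasing_seq eps ->
  eps n @[n --> \oo] --> 0 ->
  height_cvg eps X ->
  exploration0 eps X rho0 ->
  feller (transition X rho0).
Proof.
move=> HX Hjump alpha00 HPi Hf _ _ _ _ Hrho F CF; split; last first.
  by move=> mu; exact: (transition_start HX Hrho).
have Hgrow b := psi_drift_gt0 b alpha00 HPi.
move=> t t0; split; first exact: (continuous_transition HX Hf Hjump Hgrow Hrho).
by move=> mu_; exact: (transition_vanishing HX Hrho).
Qed.
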